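(* Let $K_m=\mathbb C^m\times S^1$ be the quotient of the Heisenberg group $H_m$, with its induced Webster metric $g$ and the foliation $\mathcal F$ by the fibers of $\pi:K_m\to\mathbb C^m$, and let $f:(K_m,\mathcal F,g)\to(N,\widetilde{\mathcal F},\widetilde g)$ be a horizontally harmonic map into a Riemannian foliation. For $\rho>0$ let $D_\rho=\{(z,t)\in K_m: z\in\mathbb C^m,\ t\in S^1,\ |z|\le\rho\}$. Suppose that there are constants $\delta$ and $\rho_0>0$ such that $$2\rho\left(\int_{D_\rho}|df_{\mathcal V,\widetilde{\mathcal H}}|^2\,dV_g\right)^{1/2}\le\delta\left(\int_{D_\rho}|df_{\mathcal H,\widetilde{\mathcal H}}|^2\,dV_g\right)^{1/2}\quad\text{for }\rho\ge\rho_0,$$ and $2m-2-2\delta>0$, and that $$\int_{D_\rho}|df_{\mathcal H,\widetilde{\mathcal H}}|^2\,dV_g=o(\rho^{2m-2-2\delta})\qquad\text{as }\rho\to+\infty .$$ Then $f$ is horizontally constant, i.e. $df_{\mathcal H,\widetilde{\mathcal H}}\equiv0$.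
   Context: $K_m$: the Heisenberg group $H_m=\mathbb C^m\times\mathbb R$ has global coordinates $(x^1,\dots,x^m,y^1,\dots,y^m,t)$, $z^j=x^j+\sqrt{-1}\,y^j$. Put $\eta=\frac12dt+\sum_j(x^jdy^j-y^jdx^j)$ and $g=\sum_j\big((dx^j)^2+(dy^j)^2\big)+\eta\otimes\eta$. The field $\xi=\partial/\partial t$ is Killing, and $K_m=H_m/\{\exp(k\xi)\}_{k\in\mathbb Z}=\mathbb C^m\times S^1$ (i.e. $t$ is taken modulo $1$) with the induced metric, still denoted $g$. The projection $\pi:K_m\to\mathbb C^m$ is a Riemannian submersion onto Euclidean $\mathbb C^m=\mathbb R^{2m}$ with totally geodesic fibers. A global orthonormal frame is $X_j=\partial_{x^j}+2y^j\partial_t$, $Y_j=\partial_{y^j}-2x^j\partial_t$, $T=2\partial_t$, with $\mathcal H=\operatorname{span}\{X_j,Y_j\}$, $\mathcal V=\operatorname{span}\{T\}$. General definitions: a foliation on a smooth manifold $M$ is given by an integrable distribution $\mathcal V\subset TM$. Given a Riemannian metric $g$, put $\mathcal H=\mathcal V^\perp$ with orthogonal projections $\pi_{\mathcal H},\pi_{\mathcal V}$ and $g_{\mathcal H}=g(\pi_{\mathcal H}\cdot,\pi_{\mathcal H}\cdot)$. $(M,\mathcal F,g)$ is a Riemannian foliation if $\mathcal L_Ug_{\mathcal H}=0$ for every section $U$ of $\mathcal V$. Let $\nabla$ be the Levi-Civita connection. For $X,Y$ horizontal, $U$ vertical: $\mathcal W_XU=-\pi_{\mathcal V}(\nabla_UX)$,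 $\mathcal T_XY=\pi_{\mathcal V}(\nabla_XY)=\frac12\pi_{\mathcal V}([X,Y])$, extended to $TM$ by first projecting the arguments; $\mathcal T^*$ is defined by $g(\mathcal T_X^*Y,Z)=g(Y,\mathcal T_XZ)$. Objects on $N$ carry a tilde. For a smooth map $f:M\to N$: $df_{\mathcal H,\widetilde{\mathcal H}}=\pi_{\widetilde{\mathcal H}}\circ df\circ\pi_{\mathcal H}$, $df_{\mathcal V,\widetilde{\mathcal H}}=\pi_{\widetilde{\mathcal H}}\circ df\circ\pi_{\mathcal V}$, $df_{\mathcal H,\widetilde{\mathcal V}}=\pi_{\widetilde{\mathcal V}}\circ df\circ\pi_{\mathcal H}$; squared norms are $|\omega|^2=\sum_A|\omega(e_A)|^2$ over a local orthonormal frame of $TM$. With $\widetilde\nabla$ also the pull-back connection on $f^{-1}TN$, $\beta_{\mathcal H,\widetilde{\mathcal H}}(X,Y)=\widetilde\nabla_X(df_{\mathcal H,\widetilde{\mathcal H}}(Y))-df_{\mathcal H,\widetilde{\mathcal H}}(\nabla_XY)$. The map $f$ is horizontally harmonic if it is a critical point of $E_{\mathcal H,\widetilde{\mathcal H}}(f)=\frac12\int_M|df_{\mathcal H,\widetilde{\mathcal H}}|^2dV_g$, that is, $\operatorname{tr}_g\beta_{\mathcal H,\widetilde{\mathcal H}}+\sum_i\big(\widetilde{\mathcal T}^*_{df_{\mathcal H,\widetilde{\mathcal H}}(e_i)}df_{\mathcal H,\widetilde{\mathcal V}}(e_i)+\widetilde{\mathcal W}_{df_{\mathcal H,\widetilde{\mathcal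 H}}(e_i)}df_{\mathcal H,\widetilde{\mathcal V}}(e_i)\big)=0$, with $\{e_i\}$ a local orthonormal frame of $\mathcal H$. *)

(* Defs.v *)
From HB Require Import structures.
From mathcomp Require Import all_boot all_order all_algebra.
From mathcomp Require Import all_classical all_reals all_analysis.
Set Implicit Arguments.
Unset Strict Implicit.
Unset Printing Implicit Defensive.
Import Order.TTheory GRing.Theory Num.Theory.
Import numFieldNormedType.Exports.
Local Open Scope classical_set_scope.
Local Open Scope ring_scope.
Local Open Scope quotient_scope.

(* Tangent vectors in coordinates are row vectors,
   so a linear map is applied as [v *m M], and the differential of a
   coordinate change is [v *m 'J phi x]. *)

(* Needed to write [f =o_F h] with F the filter +oo. *)
Canonical pinfty_filter_on (R : realType) : filter_on R :=
  FilterType (pinfty_nbhs R) _.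

Section Smooth.
Variables (R : realType) (V W : normedModType R).

Fixpoint Ck_on (k : nat) (O : set V) (f : V -> W) : Prop :=
  match k with
  | 0 => forall x, O x -> {for x, continuous f}
  | k'.+1 => (forall x, O x -> differentiable f x) /\
             (forall v, Ck_on k' O ('D_v f))
  end.

(* Meant for open O. *)
Definition smooth_on (O : set V) (f : V -> W) := forall k, Ck_on k O f.

End Smooth.

(* Differential geometry on an open subset of R^n: [G x] is the Gram matrix of
   the metric in the coordinate basis, and a distribution is given by matrices
   [V x], of which only the row space matters. *)
Section Coordinates.
Variables (R : realType) (n : nat).
Implicit Types (B L : 'M[R]_n) (G V : 'rV[R]_n -> 'M[R]_n).
Implicit Types (X Y Z U : 'rV[R]_n -> 'rV[R]_n) (x a b u v : 'rV[R]_n).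

Definition ebase (k : 'I_n) : 'rV[R]_n := delta_mx 0 k.

Definition ip B u v : R := (u *m B *m v^T) 0 0.

(* The row space of [orthmx B L] is {u | ip B u v = 0 for v in L}. *)
Definition orthmx B L : 'M[R]_n := kermx (B *m L^T).
Definition projV B L : 'M[R]_n := proj_mx L (orthmx B L).
Definition projH B L : 'M[R]_n := proj_mx (orthmx B L) L.

(* The vector with components Gamma^k_{ij} a^i b^j; the row vector is the
   covector c |-> (a.g(b,c) + b.g(a,c) - c.g(a,b)) / 2 of the Koszul formula. *)
Definition christoffel G x a b : 'rV[R]_n :=
  (\row_k (2^-1 * ('D_a (fun y => ip (G y) b (ebase k)) x
                   + 'D_b (fun y => ip (G y) a (ebase k)) x
                   - 'D_(ebase k) (fun y => ip (G y) a b) x))) *m invmx (G x).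

Definition levi_civita G X Y x : 'rV[R]_n :=
  'D_(X x) Y x + christoffel G x (X x) (Y x).

Definition lie_bracket X Y x : 'rV[R]_n := 'D_(X x) Y x - 'D_(Y x) X x.

Definition lie_derivative2 U (h : 'rV[R]_n -> 'rV[R]_n -> 'rV[R]_n -> R)
    Y Z x : R :=
  'D_(U x) (fun y => h y (Y y) (Z y)) x
  - h x (lie_bracket U Y x) (Z x) - h x (Y x) (lie_bracket U Z x).

Definition hor_metric G V x u v : R :=
  ip (G x) (u *m projH (G x) (V x)) (v *m projH (G x) (V x)).

(* W and T are tensors, so they may be evaluated on the fields obtained by
   projecting the constant fields with values a and b. *)
Definition hor_ext G V a : 'rV[R]_n -> 'rV[R]_n :=
  fun y => a *m projH (G y) (V y).
Definition ver_ext G V a : 'rV[R]_n -> 'rV[R]_n :=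
  fun y => a *m projV (G y) (V y).

Definition tensorW G V x a b : 'rV[R]_n :=
  - (levi_civita G (ver_ext G V b) (hor_ext G V a) x *m projV (G x) (V x)).

Definition tensorT G V x a b : 'rV[R]_n :=
  levi_civita G (hor_ext G V a) (hor_ext G V b) x *m projV (G x) (V x).

(* g(T^*_a b, c) = g(b, T_a c): the covector of the right-hand side, with its
   index raised. *)
Definition tensorTstar G V x a b : 'rV[R]_n :=
  (\row_k ip (G x) b (tensorT G V x a (ebase k))) *m invmx (G x).

End Coordinates.

(* Lebesgue integral over R^n of a nonnegative function, by iteration. *)
Fixpoint integral_rV (R : realType) (n : nat) :
    ('rV[R]_n -> \bar R) -> \bar R :=
  match n with
  | 0 => fun h => h 0
  | n'.+1 => fun h : 'rV[R]_(1 + n') -> \bar R =>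
      (\int[lebesgue_measure]_s
         integral_rV (fun v : 'rV[R]_n' => h (row_mx (s%:M) v)))%E
  end.

Record smooth_manifold (R : realType) (n : nat) (N : topologicalType) :=
  SmoothManifold {
  chart : Type;
  dom : chart -> set N;
  coord : chart -> N -> 'rV[R]_n;
  param : chart -> 'rV[R]_n -> N;
  chart_at : N -> chart;
  rng := fun i => coord i @` dom i;
  dom_chart_at : forall p, dom (chart_at p) p;
  dom_open : forall i, open (dom i);
  rng_open : forall i, open (rng i);
  coordK : forall i p, dom i p -> param i (coord i p) = p;
  coord_continuous : forall i p, dom i p -> {for p, continuous (coord i)};
  param_continuous : forall i x, rng i x -> {for x, continuous (param i)};
  transition_smooth : forall i j,
    smooth_on (coord i @` (dom i `&` dom j)) (coord j \o param i);
  manifold_hausdorff : hausdorff_space N;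
  manifold_second_countable : @second_countable N }.

Section Manifold.
Variables (R : realType) (n : nat) (N : topologicalType).
Variable A : smooth_manifold R n N.

Definition transition_jac (i j : chart A) (p : N) : 'M[R]_n :=
  'J (coord j \o param i) (coord i p).

Record riemannian_metric := RiemannianMetric {
  gram :> chart A -> 'rV[R]_n -> 'M[R]_n;
  gram_smooth : forall i, smooth_on (rng i) (gram i);
  gram_sym : forall i x, rng i x -> (gram i x)^T = gram i x;
  gram_pos : forall i x, rng i x ->
    forall v, v != 0 -> 0 < ip (gram i x) v v;
  gram_compat : forall i j p, dom i p -> dom j p ->
    gram i (coord i p) =
    transition_jac i j p *m gram j (coord j p) *m (transition_jac i j p)^T }.

Definition section_on (L : 'rV[R]_n -> 'M[R]_n) (O : set 'rV[R]_n)
    (X : 'rV[R]_n -> 'rV[R]_n) : Prop :=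
  smooth_on O X /\ forall x, O x -> (X x <= L x)%MS.

(* A smooth distribution of rank q, integrable in the sense that its sections
   are closed under the Lie bracket. *)
Record foliation (q : nat) := Foliation {
  leafmx :> chart A -> 'rV[R]_n -> 'M[R]_n;
  leaf_rank : forall i x, rng i x -> \rank (leafmx i x) = q;
  leaf_smooth : forall i x, rng i x ->
    exists (O : set 'rV[R]_n) (B : 'rV[R]_n -> 'M[R]_(q, n)),
      [/\ open O, O x, O `<=` rng i, smooth_on O B &
          forall y, O y -> (B y == leafmx i y)%MS];
  leaf_compat : forall i j p, dom i p -> dom j p ->
    (leafmx i (coord i p) *m transition_jac i j p == leafmx j (coord j p))%MS;
  leaf_involutive : forall i (O : set 'rV[R]_n) X Y,
    open O -> O `<=` rng i ->
    section_on (leafmx i) O X -> section_on (leafmx i) O Y ->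
    forall x, O x -> (lie_bracket X Y x <= leafmx i x)%MS }.

Definition riemannian_foliation q (g : riemannian_metric) (F : foliation q) :=
  forall i (O : set 'rV[R]_n) U Y Z,
    open O -> O `<=` rng i ->
    section_on (F i) O U -> smooth_on O Y -> smooth_on O Z ->
    forall x, O x -> lie_derivative2 U (hor_metric (g i) (F i)) Y Z x = 0.

End Manifold.

Section Heisenberg.
Variables (R : realType) (m : nat).

(* Coordinates (x^1, .., x^m, y^1, .., y^m, t). *)
Local Notation HH := 'rV[R]_(m + m + 1).

Definition ix (j : 'I_m) : 'I_(m + m + 1) := lshift 1 (lshift m j).
Definition iy (j : 'I_m) : 'I_(m + m + 1) := lshift 1 (rshift m j).
Definition it : 'I_(m + m + 1) := rshift (m + m) ord0.

Definition d_t : HH := ebase R it.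

Definition Xfield (j : 'I_m) (p : HH) : HH :=
  ebase R (ix j) + (2 * p 0 (iy j)) *: d_t.
Definition Yfield (j : 'I_m) (p : HH) : HH :=
  ebase R (iy j) - (2 * p 0 (ix j)) *: d_t.
Definition Tfield (p : HH) : HH := 2 *: d_t.

Definition hframe : seq (HH -> HH) :=
  [seq Xfield j | j <- enum 'I_m] ++ [seq Yfield j | j <- enum 'I_m].
Definition frame := rcons hframe Tfield.

(* The coefficients of eta; the coordinate covectors dx^j, dy^j, dt have the
   same coefficients as the basis vectors. *)
Definition eta (p : HH) : HH :=
  2^-1 *: d_t
  + \sum_j (p 0 (ix j) *: ebase R (iy j) - p 0 (iy j) *: ebase R (ix j)).

Definition gK (p : HH) : 'M[R]_(m + m + 1) :=
  \sum_j ((ebase R (ix j))^T *m ebase R (ix j)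
          + (ebase R (iy j))^T *m ebase R (iy j))
  + (eta p)^T *m eta p.

Definition VK (p : HH) : 'M[R]_(m + m + 1) := <<Tfield p>>%MS.

(* exp(k xi) is the translation t |-> t + k. *)
Definition deck (p p' : HH) : bool :=
  `[< exists k : int, p' = p + k%:~R *: d_t >].

Lemma deck_equiv : equiv_class_of deck.
Proof.
split=> [p|p p'|p' p p''].
- by apply/asboolP; exists 0; rewrite scale0r addr0.
- apply/asboolP/asboolP => -[k ->]; exists (- k);
    by rewrite intrN scaleNr addrK.
- move=> /asboolP[k ->] /asboolP[l ->]; apply/asboolP; exists (k + l).
  by rewrite intrD scalerDl addrA.
Qed.

Canonical deck_equiv_rel := EquivRelPack deck_equiv.

Definition Km := {eq_quot deck_equiv_rel}.

Definition quoK (p : HH) : Km := \pi_Km p.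

Definition normz (p : HH) : R :=
  Num.sqrt (\sum_j (p 0 (ix j) ^+ 2 + p 0 (iy j) ^+ 2)).

Definition Drho (rho : R) : set Km := quoK @` [set p | normz p <= rho].

(* Integral over D, with respect to dV_g, of the nonnegative function on K_m
   whose lift to H_m is h, computed on the fundamental domain 0 <= t < 1. *)
Definition integralK (D : set Km) (h : HH -> R) : R :=
  fine (integral_rV (fun p =>
    (\1_[set p' | D (quoK p') /\ 0 <= p' 0 it < 1] p *
     (h p * Num.sqrt (\det (gK p))))%:E)).

End Heisenberg.

(* Maps f : K_m -> N are handled through their lift to H_m, which has the same
   local expressions: [loc f i] is the expression in the chart i of N. *)
Section Maps.
Variables (R : realType) (m n q : nat) (N : topologicalType).
Variables (A : smooth_manifold R n N) (g : riemannian_metric A).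
Variables (F : foliation A q) (f : Km R m -> N).
Local Notation HH := 'rV[R]_(m + m + 1).
Implicit Types (i : chart A) (p v : HH) (X Y : HH -> HH).

Definition lift (p : HH) : N := f (quoK p).
Definition loc i (p : HH) : 'rV[R]_n := coord i (lift p).

Definition smooth_map : Prop :=
  continuous lift /\ forall i, smooth_on (lift @^-1` dom i) (loc i).

Definition piH p : 'M[R]_(m + m + 1) := projH (gK p) (VK p).
Definition piV p : 'M[R]_(m + m + 1) := projV (gK p) (VK p).
Definition tpiH i (y : 'rV[R]_n) : 'M[R]_n := projH (g i y) (F i y).
Definition tpiV i (y : 'rV[R]_n) : 'M[R]_n := projV (g i y) (F i y).

Definition dfHH i p v : 'rV[R]_n :=
  'D_(v *m piH p) (loc i) p *m tpiH i (loc i p).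
Definition dfVH i p v : 'rV[R]_n :=
  'D_(v *m piV p) (loc i) p *m tpiH i (loc i p).
Definition dfHV i p v : 'rV[R]_n :=
  'D_(v *m piH p) (loc i) p *m tpiV i (loc i p).

Definition normsq (om : chart A -> HH -> HH -> 'rV[R]_n) (p : HH) : R :=
  let i := chart_at A (lift p) in
  \sum_(e <- frame R m) ip (g i (loc i p)) (om i p (e p)) (om i p (e p)).

Definition betaHH i X Y p : 'rV[R]_n :=
  'D_(X p) (fun p' => dfHH i p' (Y p')) p
  + christoffel (g i) (loc i p) ('D_(X p) (loc i) p) (dfHH i p (Y p))
  - dfHH i p (levi_civita (@gK R m) X Y p).

Definition tensionHH i p : 'rV[R]_n :=
  \sum_(e <- frame R m) betaHH i e e p
  + \sum_(e <- hframe R m)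
      (tensorTstar (g i) (F i) (loc i p) (dfHH i p (e p)) (dfHV i p (e p))
       + tensorW (g i) (F i) (loc i p) (dfHH i p (e p)) (dfHV i p (e p))).

Definition horizontally_harmonic : Prop :=
  forall i p, dom i (lift p) -> tensionHH i p = 0.

Definition horizontally_constant : Prop :=
  forall i p, dom i (lift p) -> forall v, dfHH i p v = 0.

Definition energyHH (rho : R) : R := integralK (@Drho R m rho) (normsq dfHH).
Definition energyVH (rho : R) : R := integralK (@Drho R m rho) (normsq dfVH).

End Maps.

(* Main.v *)
Require Import Defs.
From HB Require Import structures.
From mathcomp Require Import all_boot all_order all_algebra.
From mathcomp Require Import all_classical all_reals all_analysis.
From mathcomp Require Import ring lra zify.
Set Implicit Arguments.
Unset Strict Implicit.
Unset Printing Implicit Defensive.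
Import Order.TTheory GRing.Theory Num.Theory.
Import numFieldNormedType.Exports.
Local Open Scope classical_set_scope.
Local Open Scope ring_scope.

(** The energy of [f] on [Drho rho] is shown to grow at least like
    [rho `^ (2 * m - 2 - 2 * delta)] unless it vanishes identically, which the
    growth hypothesis then forces.  The growth comes from a conservation law
    for the horizontal stress-energy tensor, tested against the position
    field of C^m.

    Notation.  The vectors [hvec a] are the horizontal frame e_a, with
    [a : 'I_(m + m)] running through the X_j and then the Y_j; f_a and f_T
    are the derivatives of a local expression of [f] along e_a and T.  In a
    chart of N with Gram matrix G and horizontal projection P, [Hm] is the
    Gram matrix H = P G of the transverse metric.  The functions
    s_ab = H(f_a, f_b), w_a = H(f_T, f_a) and W = H(f_T, f_T) do not depend
    on the chart, since changes of charts preserve g and the foliation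
    ([pullback_chart]); they live on H_m and are periodic in t, and the two
    energies are the integrals of [density], the sum of the s_aa, and of W.

    The pointwise identity.  Let F_ab be the derivative of f_b along e_a.  A
    map with vanishing tension satisfies, for every vector c at f(p),
    sum_a (H(F_aa, c) + (d_(f_a) H)(f_a, c) - (d_c H)(f_a, f_a) / 2) = 0
    ([euler_lagrange]), the harmonic map equation for the degenerate metric
    H.  For c horizontal the left-hand side is the scalar product of the
    tension with c.  For c vertical it vanishes for any map, because H
    is invariant along the leaves of a Riemannian foliation.  Choose c = f_b,
    multiply by the coordinate z_b and sum over b: derivatives of s_ab
    appear, except that some F_ba have to be exchanged with F_ab.  As
    [e_a, e_b] is a multiple of d/dt, the exchange produces a multiple of
    the w_a, and the stress field [stress] with components
    sum_b z_b s_ba - z_a density / 2 has divergence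
    (1 - m) density + 2 sum_a (Jz)_a w_a ([conservation_law], [div_stress]).

    The integral inequality.  Multiply the stress field by a cutoff
    chi(|z|^2) and integrate over [-r, r]^(2m) x [0, 1].  The e_a are
    divergence free, chi vanishes on the lateral faces, and everything is
    periodic in t, so the divergence integrates to 0 ([flux_int0]).  The
    derivative of chi meets the quadratic form sum_ab z_a z_b s_ab >= 0 with a
    favourable sign, and the term in w is controlled by
    2 sum_a (Jz)_a w_a <= l W + |z|^2 density / l (any l > 0) together with the hypothesis
    comparing the two energies.  As a function of rho^2 the energy E
    satisfies, with k = m - 1,
    (b - a) (k E(a) - delta E(b)) <= (b + (b - a)) (E(b) - E(a))
    for a < b ([energy_step]), a discrete form of s E'(s) >= (k - delta) E(s).
    Hence ln E(s) - (k - delta) ln s decreases on [a, b] by at most a multiple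
    of (b - a)^2; cutting an interval into many pieces shows that it does not
    decrease at all ([power_growth]).

    Integration.  The integral over R^n is an iteration of the integral of
    nonnegative functions.  Only its monotonicity and superadditivity enter,
    which hold without any measurability, the integral being a supremum over
    simple functions.  Linearity and integration by parts are
    used for continuous functions on a box ([boxint]), with which the
    energies are compared through cutoffs. *)

(** * Continuously differentiable maps *)

Section C1.
Variables (R : realType) (V : normedModType R).

Lemma cvg_mx (T : Type) (F : set_system T) (FF : Filter F) m n
    (M : T -> 'M[R]_(m, n)) (L : 'M[R]_(m, n)) :
  (forall i j, M x i j @[x --> F] --> L i j) -> M x @[x --> F] --> L.
Proof.
move=> cM A [P LP PA]; suff H : \forall x \near F, forall i j, P i j (M x i j).
  by apply: filterS H => x Px; exact: PA.
apply: filter_forall => i; apply: filter_forall => j; exact: cM (LP i j).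
Qed.

Lemma cvg_sum_fin (T : Type) (F : set_system T) (FF : Filter F) (I : finType)
    (f : I -> T -> R) (l : I -> R) :
  (forall i, f i x @[x --> F] --> l i) ->
  (fun x => \sum_i f i x) x @[x --> F] --> \sum_i l i.
Proof.
rewrite (_ : (fun x => _) = \sum_i f i); last by apply/funext => x; rewrite fct_sumE.
move=> fl; elim/big_ind2 : _ => [|a b c d fa fc|i _]; first exact: cvg_cst.
  exact: (cvgD fa fc).
exact: fl.
Qed.

Lemma cvg_entry (T : Type) (F : set_system T) (FF : Filter F) m n
    (M : T -> 'M[R]_(m, n)) (L : 'M[R]_(m, n)) i j :
  M x @[x --> F] --> L -> M x i j @[x --> F] --> L i j.
Proof.
move=> cM; apply: (@cvg_comp _ _ _ M (fun A : 'M[R]_(m, n) => A i j)); first exact: cM.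
exact: coord_continuous.
Qed.

Lemma cvg_mulmx (T : Type) (F : set_system T) (FF : Filter F) m n k
    (M : T -> 'M[R]_(m, n)) (N : T -> 'M[R]_(n, k))
    (L : 'M[R]_(m, n)) (K : 'M[R]_(n, k)) :
  M x @[x --> F] --> L -> N x @[x --> F] --> K ->
  M x *m N x @[x --> F] --> L *m K.
Proof.
move=> cM cN; apply: cvg_mx => i j; rewrite mxE.
rewrite (_ : (fun x => _) = fun x => \sum_a M x i a * N x a j); last first.
  by apply/funext => x; rewrite mxE.
by apply: cvg_sum_fin => a; apply: cvgM; exact: cvg_entry.
Qed.

Lemma differentiable_mxP m n (M : V -> 'M[R]_(m, n)) x :
  differentiable M x <-> forall i j, differentiable (fun y => M y i j) x.
Proof.
split=> [dM i j|dM].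
  apply: (@differentiable_comp _ _ _ _ M (fun A => A i j)) => //.
  exact: differentiable_coord.
have -> : M = \sum_(i < m) (\sum_(j < n) (fun y => M y i j *: delta_mx i j)).
  apply/funext => y; rewrite fct_sumE [LHS]matrix_sum_delta.
  by apply: eq_bigr => i _; rewrite fct_sumE.
apply: differentiable_sum => i; apply: differentiable_sum => j.
exact: differentiableZl.
Qed.

Lemma derive_entry m n (M : V -> 'M[R]_(m, n)) x v i j :
  differentiable M x -> 'D_v (fun y => M y i j) x = ('D_v M x) i j.
Proof. by move=> dM; rewrite derive_mx ?mxE//; exact: diff_derivable. Qed.

Lemma differentiable_mulmx m n k (M : V -> 'M[R]_(m, n)) (N : V -> 'M[R]_(n, k)) x :
  differentiable M x -> differentiable N x ->
  differentiable (fun y => M y *m N y) x.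
Proof.
move=> /differentiable_mxP dM /differentiable_mxP dN.
apply/differentiable_mxP => i j.
rewrite (_ : (fun y => _) = \sum_a ((fun y => M y i a) * (fun y => N y a j))).
  by apply: differentiable_sum => a; exact: differentiableM.
by apply/funext => y; rewrite mxE fct_sumE.
Qed.

Lemma derive_mulmx m n k (M : V -> 'M[R]_(m, n)) (N : V -> 'M[R]_(n, k)) x v :
  differentiable M x -> differentiable N x ->
  'D_v (fun y => M y *m N y) x = 'D_v M x *m N x + M x *m 'D_v N x.
Proof.
move=> dM dN; have dMN := differentiable_mulmx dM dN.
have /differentiable_mxP dM' := dM; have /differentiable_mxP dN' := dN.
apply/matrixP => i j; rewrite -derive_entry// !mxE -big_split/=.
rewrite (_ : (fun y => _) = \sum_a ((fun y => M y i a) * (fun y => N y a j))); last first.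
  by apply/funext => y; rewrite mxE fct_sumE.
rewrite derive_sum => [|a]; last first.
  by apply: derivableM; apply: diff_derivable.
apply: eq_bigr => a _; rewrite deriveM; try exact: diff_derivable.
by rewrite !derive_entry// addrC; congr (_ + _); rewrite /GRing.scale/= mulrC.
Qed.

Lemma derive_trmx m n (M : V -> 'M[R]_(m, n)) x v : differentiable M x ->
  'D_v (fun y => (M y)^T) x = ('D_v M x)^T.
Proof.
move=> dM; have /differentiable_mxP dM' := dM.
apply/matrixP => i j; rewrite -derive_entry.
  rewrite [RHS]mxE -derive_entry//; congr ('D_v _ x).
  by apply/funext => y; rewrite mxE.
apply/differentiable_mxP => k l; rewrite (_ : (fun y => _) = fun y => M y l k)//.
by apply/funext => y; rewrite mxE.
Qed.

Lemma differentiable_trmx m n (M : V -> 'M[R]_(m, n)) x : differentiable M x ->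
  differentiable (fun y => (M y)^T) x.
Proof.
move=> /differentiable_mxP dM'.
apply/differentiable_mxP => k l; rewrite (_ : (fun y => _) = fun y => M y l k)//.
by apply/funext => y; rewrite mxE.
Qed.

Lemma derive_lin (W : normedModType R) (f : V -> W) x a b (u v : V) :
  differentiable f x ->
  'D_(a *: u + b *: v) f x = a *: 'D_u f x + b *: 'D_v f x.
Proof. by move=> df; rewrite !deriveE// linearD !linearZ. Qed.


Lemma diff_eps (W : normedModType R) (f : V -> W) x (e : R) : differentiable f x ->
  0 < e -> \forall h \near 0, `|f (h + x) - f x - 'd f x h| <= e * `|h|.
Proof.
move=> /diff_locallyP[_ /eqaddoP] /[apply] H.
by apply: filterS H => h /=; rewrite !fctE/= opprD addrA.
Qed.

(** Differentiability is stated through the canonical differential of the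
    function itself, so that even its invariance under local changes has to go
    through the characterization by little-o. *)
Lemma diff_near_eq (W : normedModType R) (f g : V -> W) x :
  (\near x, f x = g x) -> differentiable f x -> differentiable g x.
Proof.
move=> fg df; have gx : f x = g x by exact: nbhs_singleton fg.
have fg0 : \forall h \near 0, f (h + x) = g (h + x).
  by move: fg; rewrite (near_shift 0) subr0.
have dcf : continuous ('d f x) by exact: diff_continuous.
have E : g \o shift x = cst (g x) + 'd f x +o_ 0 id.
  apply/eqaddoP => e e0; have H := diff_eps df e0.
  near=> h; rewrite !fctE/= opprD addrA -gx.
  have <- : f (h + x) = g (h + x) by near: h.
  by near: h.
have E' := diff_unique dcf E.
by apply/diff_locallyP; rewrite E'.
Unshelve. all: by end_near. Qed.

Lemma near_open (O : set V) (P : V -> Prop) x : open O -> O x ->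
  (forall y, O y -> P y) -> \near x, P x.
Proof.
by move=> oO Ox H; apply: filterS (open_nbhs_nbhs (conj oO Ox)) => y /H.
Qed.

Lemma cvg_near_eq (T : topologicalType) (U : topologicalType) (f g : T -> U) x :
  (\near x, f x = g x) -> {for x, continuous f} -> {for x, continuous g}.
Proof.
move=> fg; have fgx : f x = g x by exact: nbhs_singleton fg.
move=> cf; have {}cf : f y @[y --> x] --> f x by exact: cf.
rewrite fgx in cf; apply: cvg_trans cf; apply: near_eq_cvg.
by apply: filterS fg.
Qed.

Lemma Ck_on_ext (W : normedModType R) (O : set V) k (f g : V -> W) :
  open O -> (forall x, O x -> f x = g x) -> Ck_on k O f -> Ck_on k O g.
Proof.
move=> oO; elim: k f g => [|k IH] f g fg /=.
  by move=> cf x Ox; apply: cvg_near_eq (cf x Ox); exact: near_open fg.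
move=> [df Cf]; split=> [x Ox|v].
  by apply: diff_near_eq (df x Ox); exact: near_open fg.
apply: IH (Cf v) => x Ox; apply: near_eq_derive; exact: near_open fg.
Qed.

Lemma Ck_onS (W : normedModType R) (O O' : set V) k (f : V -> W) :
  O' `<=` O -> Ck_on k O f -> Ck_on k O' f.
Proof.
move=> sO; elim: k f => [|k IH] f /= H; first by move=> x /sO; exact: H.
by case: H => df Cf; split=> [x /sO|v]; [exact: df|exact: IH].
Qed.

(** Computing all directional derivatives by a formula on an open set is
    enough; the basic closure properties below are proved in this way. *)
Lemma C1_intro (W : normedModType R) (O : set V) (f : V -> W)
    (g : V -> V -> W) : open O ->
  (forall x, O x -> differentiable f x) ->
  (forall v x, O x -> 'D_v f x = g v x) ->
  (forall v x, O x -> {for x, continuous (g v)}) -> Ck_on 1 O f.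
Proof.
move=> oO df Df Cg; split=> // v x Ox; apply: cvg_near_eq (Cg v x Ox).
by apply: near_open oO Ox _ => y /(Df v).
Qed.

Lemma C1_continuous (W : normedModType R) (O : set V) (f : V -> W) x :
  Ck_on 1 O f -> O x -> {for x, continuous f}.
Proof. by move=> [df _] Ox; exact/differentiable_continuous/df. Qed.

Lemma C1_cst (W : normedModType R) (O : set V) (a : W) : Ck_on 1 O (fun _ : V => a).
Proof.
split=> [x _|v x _]; first exact: differentiable_cst.
rewrite (_ : 'D_v _ = cst 0); first exact: cvg_cst.
by apply/funext => y; rewrite derive_cst.
Qed.

Lemma smooth_cst (W : normedModType R) (O : set V) (a : W) : smooth_on O (fun _ : V => a).
Proof.
move=> k; elim: k a => [|k IH] a /=; first by move=> x _; exact: cvg_cst.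
split=> [x _|v]; first exact: differentiable_cst.
rewrite (_ : 'D_v _ = fun=> 0); first exact: IH.
by apply/funext => y; rewrite derive_cst.
Qed.

Section real.
Variables (O : set V) (oO : open O).
Implicit Types f g : V -> R.

Lemma C1D f g : Ck_on 1 O f -> Ck_on 1 O g -> Ck_on 1 O (fun x => f x + g x).
Proof.
move=> [df Cf] [dg Cg]; apply: (@C1_intro _ _ _ (fun v x => 'D_v f x + 'D_v g x)) => //.
- by move=> x Ox; apply: differentiableD; [exact: df|exact: dg].
- by move=> v x Ox; rewrite -deriveD//; apply: diff_derivable; [exact: df|exact: dg].
- by move=> v x Ox; exact: (cvgD (Cf v x Ox) (Cg v x Ox)).
Qed.

Lemma C1M f g : Ck_on 1 O f -> Ck_on 1 O g -> Ck_on 1 O (fun x => f x * g x).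
Proof.
move=> [df Cf] [dg Cg].
apply: (@C1_intro _ _ _ (fun v x => f x * 'D_v g x + g x * 'D_v f x)) => //.
- by move=> x Ox; apply: differentiableM; [exact: df|exact: dg].
- by move=> v x Ox; rewrite deriveM//; apply: diff_derivable; [exact: df|exact: dg].
- move=> v x Ox; have cf := C1_continuous (conj df Cf) Ox.
  have cg := C1_continuous (conj dg Cg) Ox.
  exact: (cvgD (cvgM cf (Cg v x Ox)) (cvgM cg (Cf v x Ox))).
Qed.

Lemma C1V f : (forall x, O x -> f x != 0) -> Ck_on 1 O f -> Ck_on 1 O (fun x => (f x)^-1).
Proof.
move=> f0 [df Cf].
have cf x : O x -> {for x, continuous f} by exact: (C1_continuous (conj df Cf)).
apply: (@C1_intro _ _ _ (fun v x => - ((f x)^-1 * (f x)^-1) * 'D_v f x)) => //.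
- by move=> x Ox; apply: differentiableV; [exact: df|exact: f0].
- move=> v x Ox; rewrite deriveV ?f0//; last exact/diff_derivable/df.
  by rewrite /GRing.scale/= -exprVn expr2.
- move=> v x Ox; have cV := cvgV (f0 x Ox) (cf x Ox).
  apply: (@cvgM _ _ _ _ (fun x => - ((f x)^-1 * (f x)^-1))); last exact: Cf.
  exact: (cvgN (cvgM (cV _) (cV _))).
Qed.

Lemma C1_sum (I : Type) (r : seq I) (P : pred I) (f : I -> V -> R) :
  (forall i, P i -> Ck_on 1 O (f i)) -> Ck_on 1 O (fun x => \sum_(i <- r | P i) f i x).
Proof.
move=> Cf; elim: r => [|i r IH].
  by rewrite (_ : (fun x => _) = fun=> 0); [exact: C1_cst|apply/funext => x; rewrite big_nil].
have [Pi|Pi] := boolP (P i).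
  rewrite (_ : (fun x => _) = fun x => f i x + \sum_(j <- r | P j) f j x).
    exact: (C1D (Cf i Pi) IH).
  by apply/funext => x; rewrite big_cons Pi.
by rewrite (_ : (fun x => _) = fun x => \sum_(j <- r | P j) f j x)//; apply/funext => x; rewrite big_cons (negbTE Pi).
Qed.

Lemma C1_prod (I : Type) (r : seq I) (P : pred I) (f : I -> V -> R) :
  (forall i, P i -> Ck_on 1 O (f i)) -> Ck_on 1 O (fun x => \prod_(i <- r | P i) f i x).
Proof.
move=> Cf; elim: r => [|i r IH].
  by rewrite (_ : (fun x => _) = fun=> 1); [exact: C1_cst|apply/funext => x; rewrite big_nil].
have [Pi|Pi] := boolP (P i).
  rewrite (_ : (fun x => _) = fun x => f i x * \prod_(j <- r | P j) f j x).
    exact: (C1M (Cf i Pi) IH).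
  by apply/funext => x; rewrite big_cons Pi.
by rewrite (_ : (fun x => _) = fun x => \prod_(j <- r | P j) f j x)//; apply/funext => x; rewrite big_cons (negbTE Pi).
Qed.

Lemma C1_mxP m n (M : V -> 'M[R]_(m, n)) :
  Ck_on 1 O M <-> forall i j, Ck_on 1 O (fun x => M x i j).
Proof.
split=> [[dM CM] i j|CM].
  apply: (@C1_intro _ _ _ (fun v x => 'D_v M x i j)) => //.
  - by move=> x /dM /differentiable_mxP.
  - by move=> v x /dM; exact: derive_entry.
  - move=> v x Ox; exact: cvg_entry (CM v x Ox).
have dM x : O x -> differentiable M x.
  by move=> Ox; apply/differentiable_mxP => i j; case: (CM i j) => + _; exact.
apply: (@C1_intro _ _ _ (fun v x => \matrix_(i, j) 'D_v (fun y => M y i j) x)) => //.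
  by move=> v x Ox; apply/matrixP => i j; rewrite mxE derive_entry//; exact: dM.
move=> v x Ox; apply: cvg_mx => i j; rewrite mxE.
rewrite (_ : (fun y => _) = 'D_v (fun y => M y i j)); last by apply/funext => y; rewrite mxE.
by case: (CM i j) => _; apply.
Qed.

Lemma C1_mulmx m n k (M : V -> 'M[R]_(m, n)) (N : V -> 'M[R]_(n, k)) :
  Ck_on 1 O M -> Ck_on 1 O N -> Ck_on 1 O (fun x => M x *m N x).
Proof.
move=> /C1_mxP CM /C1_mxP CN; apply/C1_mxP => i j.
rewrite (_ : (fun x => _) = fun x => \sum_a M x i a * N x a j); last first.
  by apply/funext => x; rewrite mxE.
by apply: C1_sum => a _; exact: (C1M (CM i a) (CN a j)).
Qed.

Lemma C1_trmx m n (M : V -> 'M[R]_(m, n)) :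
  Ck_on 1 O M -> Ck_on 1 O (fun x => (M x)^T).
Proof.
move=> /C1_mxP CM; apply/C1_mxP => i j.
by rewrite (_ : (fun x => _) = fun x => M x j i)//; apply/funext => x; rewrite mxE.
Qed.

Lemma C1_det n (M : V -> 'M[R]_n) : Ck_on 1 O M -> Ck_on 1 O (fun x => \det (M x)).
Proof.
move=> /C1_mxP CM; apply: C1_sum => s _; apply: C1M; first exact: C1_cst.
by apply: C1_prod => i _; exact: CM.
Qed.

(** Cramer's rule: the inverse is a polynomial expression in the entries
    divided by the determinant. *)
Lemma C1_invmx n (M : V -> 'M[R]_n) : (forall x, O x -> M x \in unitmx) ->
  Ck_on 1 O M -> Ck_on 1 O (fun x => invmx (M x)).
Proof.
move=> uM CM; have /C1_mxP CM' := CM.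
have E x : O x -> (\det (M x))^-1 *: \adj (M x) = invmx (M x).
  by move=> Ox; rewrite /invmx uM.
apply: (Ck_on_ext oO E); apply/C1_mxP => i j.
rewrite (_ : (fun x => _) = fun x => (\det (M x))^-1 *
    ((-1) ^+ (j + i) * \det (row' j (col' i (M x))))); last first.
  by apply/funext => x; rewrite !mxE.
apply: C1M.
  by apply: C1V (C1_det CM) => x Ox; have := uM x Ox; rewrite unitmxE unitfE.
apply: C1M; first exact: C1_cst.
apply: C1_det; apply/C1_mxP => k l.
by rewrite (_ : (fun x => _) = fun x => M x (lift j k) (lift i l))//; apply/funext => x; rewrite !mxE.
Qed.

Lemma derive_comp n (W : normedModType R) (f : V -> 'rV[R]_n) (g : 'rV[R]_n -> W) x v :
  differentiable f x -> differentiable g (f x) ->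
  'D_v (fun y => g (f y)) x = 'D_('D_v f x) g (f x).
Proof.
move=> df dg; rewrite deriveE; last exact: differentiable_comp.
by rewrite (diff_comp df dg) /= !deriveE.
Qed.

Lemma derive_sum_ebase n (W : normedModType R) (g : 'rV[R]_n -> W) x u :
  differentiable g x -> 'D_u g x = \sum_k u 0 k *: 'D_(ebase R k) g x.
Proof.
move=> dg; rewrite deriveE// {1}[u]row_sum_delta linear_sum/=.
by apply: eq_bigr => k _; rewrite linearZ/= deriveE.
Qed.

(** The chain rule is written in coordinates of the middle space, so that
    continuity of the derivative reduces to that of its finitely many partial
    derivatives. *)
Lemma C1_comp n (O' : set 'rV[R]_n) (f : V -> 'rV[R]_n) (g : 'rV[R]_n -> R) :
  (forall x, O x -> O' (f x)) -> Ck_on 1 O f -> Ck_on 1 O' g ->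
  Ck_on 1 O (fun x => g (f x)).
Proof.
move=> fO [df Cf] [dg Cg].
have dgf x : O x -> differentiable g (f x) by move=> Ox; apply: dg; exact: fO.
apply: (@C1_intro _ _ _ (fun v x => \sum_k ('D_v f x) 0 k * 'D_(ebase R k) g (f x))) => //.
- by move=> x Ox; apply: differentiable_comp; [exact: df|exact: dgf].
- move=> v x Ox; rewrite derive_comp; [|exact: df|exact: dgf].
  by rewrite derive_sum_ebase; [|exact: dgf].
- move=> v x Ox; apply: cvg_sum_fin => k.
  have c1 : 'D_v f y 0 k @[y --> x] --> 'D_v f x 0 k by exact: cvg_entry (Cf v x Ox).
  have c2 : f y @[y --> x] --> f x by exact/differentiable_continuous/df.
  have c3 : 'D_(ebase R k) g (f y) @[y --> x] --> 'D_(ebase R k) g (f x).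
    exact: (@cvg_comp _ _ _ f ('D_(ebase R k) g) _ _ _ c2 (Cg _ (f x) (fO x Ox))).
  exact: cvgM c1 c3.
Qed.

Lemma smooth_mull m n k (c : 'M[R]_(m, n)) (B : V -> 'M[R]_(n, k)) :
  smooth_on O B -> smooth_on O (fun x => c *m B x).
Proof.
move=> sB l; move: (sB l) => {sB}; elim: l B => [|l IH] B /=.
  by move=> CB x Ox; apply: cvg_mulmx; [exact: cvg_cst|exact: CB].
move=> [dB CB]; split=> [x Ox|v].
  apply: differentiable_mulmx; [exact: differentiable_cst|exact: dB].
apply: Ck_on_ext (IH _ (CB v)) => // x Ox.
rewrite derive_mulmx; [|exact: differentiable_cst|exact: dB].
by rewrite derive_cst mul0mx add0r.
Qed.

End real.

End C1.

(** * Symmetry of second derivatives *)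

Section Schwarz.
Variables (R : realType) (V : normedModType R).

(** Reduces directional derivatives to derivatives of functions of one real
    variable, where the mean value theorem lives. *)
Lemma is_derive_line (W : normedModType R) (f : V -> W) (w u : V) (c : R) :
  derivable f (c *: u + w) u ->
  is_derive c 1 (fun s : R => f (s *: u + w)) ('D_u f (c *: u + w)).
Proof.
move=> df; have E : (fun h : R => h^-1 *: (f ((h *: 1 + c) *: u + w) - f (c *: u + w)))
    = (fun h => h^-1 *: (f (h *: u + (c *: u + w)) - f (c *: u + w))).
  apply/funext => h; congr (_ *: (f _ - _)).
  have -> : h *: 1 = h :> R by rewrite /GRing.scale/= mulr1.
  by rewrite scalerDl addrA.
split; first by rewrite /derivable /= E.
by rewrite /derive /= E.
Qed.

Definition cross_difference (f : V -> R) p u v (h : R) :=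
  f (h *: u + h *: v + p) - f (h *: u + p) - f (h *: v + p) + f p.

Lemma cross_differenceC f p u v h :
  cross_difference f p v u h = cross_difference f p u v h.
Proof.
rewrite /cross_difference; have -> : h *: v + h *: u = h *: u + h *: v by exact: addrC.
lra.
Qed.

(** One application of the mean value theorem in the direction [u] suffices:
    the difference of the two values of ['D_u f] that it produces is read off
    from the first order expansion of ['D_u f] at [p], both points being at
    distance O(h). *)
Lemma cross_difference_derive (f : V -> R) (O : set V) p u v (e d : R) :
  'D_v ('D_u f) p = d -> open O -> O p -> (forall x, O x -> differentiable f x) ->
  differentiable ('D_u f) p -> 0 < e ->
  \forall h \near (0 : R)^'+,
    `|cross_difference f p u v h - h * h * d| <= e * (h * h).
Proof.
move=> Ed oO Op df dg e0; set g := 'D_u f.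
(* the two points used in the expansion of ['D_u f] are at distance at most
   h (|u| + |v|) and h |u| from p; the summand 1 keeps K positive *)
pose K := 2 * `|u| + `|v| + 1.
have u0 : 0 <= `|u| by []. have v0 : 0 <= `|v| by [].
have K0 : 0 < K by rewrite /K; lra.
have e1 : 0 < e / K by exact: divr_gt0.
have N1 := diff_eps dg e1.
have N2 : \forall k \near (0 : V), O (k + p).
  have : \forall x \near p, O x by exact: open_nbhs_nbhs.
  by rewrite (near_shift 0) subr0.
have N : \forall k \near (0 : V),
    `|g (k + p) - g p - 'd g p k| <= e / K * `|k| /\ O (k + p) by exact: filterI N1 N2.
have [r /= r0 Hd] := (nbhs_ballP _ _).1 N.
have {}Hd k : `|k| < r -> `|g (k + p) - g p - 'd g p k| <= e / K * `|k| /\ O (k + p).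
  by move=> kd; apply: Hd; rewrite -ball_normE /= sub0r normrN.
near=> h.
have h0 : 0 < h by near: h; exact: nbhs_right_gt.
have hd : h * K < r.
  rewrite -ltr_pdivlMr//; near: h; apply: nbhs_right_lt; exact: divr_gt0.
have small s t : 0 <= s <= h -> 0 <= t <= h -> `|s *: u + t *: v| < r.
  move=> /andP[s0 sh] /andP[t0 th]; apply: le_lt_trans hd.
  rewrite (le_trans (ler_normD _ _))// !normrZ !ger0_norm// /K.
  have : s * `|u| <= h * `|u| by exact: ler_wpM2r.
  have : t * `|v| <= h * `|v| by exact: ler_wpM2r.
  nra.
have hh : 0 <= h <= h by apply/andP; split => //; exact: ltW.
have zh : 0 <= (0 : R) <= h by rewrite lexx ltW.
pose phi s := f (s *: u + (h *: v + p)) - f (s *: u + p).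
have dphi s : 0 <= s <= h ->
    is_derive s 1 phi (g (s *: u + (h *: v + p)) - g (s *: u + p)).
  move=> sh; apply: is_deriveB.
    apply: is_derive_line; apply: diff_derivable; apply: df.
    by rewrite addrA; apply: (Hd _ (small _ _ sh hh)).2.
  apply: is_derive_line; apply: diff_derivable; apply: df.
  by have := (Hd _ (small _ _ sh zh)).2; rewrite scale0r addr0.
have [c ch Ec] : exists2 c, c \in `]0, h[ & phi h - phi 0 =
    (g (c *: u + (h *: v + p)) - g (c *: u + p)) * (h - 0).
  apply: (@MVT _ phi (fun s => g (s *: u + (h *: v + p)) - g (s *: u + p))) => //.
    by move=> x; rewrite in_itv/= => /andP[x0 xh]; apply: dphi; rewrite !ltW.
  apply: derivable_within_continuous => x; rewrite in_itv/= => xh.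
  by have [] := dphi x xh.
have -> : cross_difference f p u v h = phi h - phi 0.
  by rewrite /phi /cross_difference !scale0r !add0r addrA; ring.
rewrite Ec subr0; move: ch; rewrite in_itv/= => /andP[c0 cltb].
have cb : 0 <= c <= h by rewrite !ltW.
have [B1 _] := Hd _ (small _ _ cb hh).
have [B2 _] := Hd _ (small _ _ cb zh).
rewrite scale0r addr0 in B2.
rewrite addrA; have {Ed}-> : d = 'd g p v by rewrite -Ed deriveE.
have n1 : `|c *: u + h *: v| <= h * `|u| + h * `|v|.
  rewrite (le_trans (ler_normD _ _))// !normrZ !ger0_norm ?(ltW h0) ?(ltW c0)//.
  by rewrite lerD2r; apply: ler_wpM2r => //; exact: ltW.
have n2 : `|c *: u| <= h * `|u|.
  by rewrite normrZ ger0_norm ?(ltW c0)//; apply: ler_wpM2r => //; exact: ltW.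
rewrite linearD in B1.
have Lh : 'd g p (h *: v) = h * 'd g p v by rewrite linearZ.
rewrite Lh in B1.
set x1 := g (c *: u + h *: v + p) in B1 *; set x2 := g (c *: u + p) in B2 *.
set Lc := 'd g p (c *: u) in B1 B2; set L := 'd g p v in B1 *.
have -> : (x1 - x2) * h - h * h * L =
   h * ((x1 - g p - (Lc + h * L)) - (x2 - g p - Lc)) by ring.
rewrite normrM (gtr0_norm h0).
have B3 : `|(x1 - g p - (Lc + h * L)) - (x2 - g p - Lc)| <= e * h.
  apply: le_trans (ler_normB _ _) _.
  apply: le_trans (lerD B1 B2) _; rewrite -mulrDr.
  have -> : e * h = e / K * (h * K) by field; rewrite gt_eqF.
  by apply: ler_wpM2l; [exact: ltW|rewrite /K; lra].
by rewrite mulrCA ler_pM2l.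
Unshelve. all: by end_near. Qed.

Lemma common_approximation (X a b e r : R) : 0 < r ->
  `|X - r * b| <= e / 2 * r -> `|X - r * a| <= e / 2 * r -> `|a - b| <= e.
Proof.
move=> r0; rewrite !ler_distl => /andP[? ?] /andP[? ?].
by rewrite -(ler_pM2r r0) -(ler_pM2r r0 (a)); apply/andP; split; nra.
Qed.

(** The cross difference is symmetric in its two directions, and divided by [h
    * h] it tends to either of the two iterated derivatives. *)
Lemma schwarz_real (f : V -> R) (O : set V) p u v :
  open O -> O p -> Ck_on 2 O f -> 'D_u ('D_v f) p = 'D_v ('D_u f) p.
Proof.
move=> oO Op [df C1f]; pose a : R := 'D_u ('D_v f) p; pose b : R := 'D_v ('D_u f) p.
suff H (e : R) : 0 < e -> `|a - b| <= e.
  suff : a = b by [].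
  apply/eqP; rewrite -subr_eq0 -normr_eq0 eq_le normr_ge0 andbT.
  by apply/ler_addgt0Pr => e e0; rewrite add0r; exact: H.
move=> e0; have e2 : 0 < e / 2 by exact: divr_gt0.
have [dfu _] := C1f u; have [dfv _] := C1f v.
have F1 := @cross_difference_derive f O p u v _ b erefl oO Op df (dfu p Op) e2.
have F2 := @cross_difference_derive f O p v u _ a erefl oO Op df (dfv p Op) e2.
have [h [A1 A2 h0]] : exists h, [/\
    `|cross_difference f p u v h - h * h * b| <= e / 2 * (h * h),
    `|cross_difference f p v u h - h * h * a| <= e / 2 * (h * h) & 0 < h].
  apply: (@filter_ex _ (0 : R)^'+).
  by apply: filterS3 F1 F2 (nbhs_right_gt (0 : R)) => h; split.
rewrite cross_differenceC in A2.
have H := @common_approximation (cross_difference f p u v h) a b e (h * h) (mulr_gt0 h0 h0).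
exact (H A1 A2).
Qed.

Lemma schwarz n (f : V -> 'rV[R]_n) (O : set V) p u v :
  open O -> O p -> Ck_on 2 O f -> 'D_u ('D_v f) p = 'D_v ('D_u f) p.
Proof.
move=> oO Op [df C1f].
apply/rowP => k; have [dfu _] := C1f u; have [dfv _] := C1f v.
have E w x : O x -> 'D_w f x 0 k = 'D_w (fun y => f y 0 k) x.
  by move=> Ox; rewrite derive_entry//; exact: df.
have E1 : 'D_u ('D_v f) p 0 k = 'D_u ('D_v (fun y => f y 0 k)) p.
  rewrite -(derive_entry u 0 k (dfv p Op)).
  exact: near_eq_derive u (near_open oO Op (E v)).
have E2 : 'D_v ('D_u f) p 0 k = 'D_v ('D_u (fun y => f y 0 k)) p.
  rewrite -(derive_entry v 0 k (dfu p Op)).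
  exact: near_eq_derive v (near_open oO Op (E u)).
suff C2 : Ck_on 2 O (fun y => f y 0 k).
  exact: etrans E1 (etrans (schwarz_real u v oO Op C2) (esym E2)).
split=> [x Ox|w].
  by have /differentiable_mxP/(_ 0 k) := df x Ox.
apply: (Ck_on_ext oO (E w)).
have /(C1_mxP oO)/(_ 0 k) := C1f w.
exact.
Qed.

End Schwarz.

(** * Iterated integrals of nonnegative functions *)

Section LowerIntegral.
Variable R : realType.
Local Notation mu := (@lebesgue_measure R).
Import HBNNSimple.

Lemma le_integralT (f g : R -> \bar R) : (forall x, (0 <= f x)%E) ->
  (forall x, (f x <= g x)%E) -> (\int[mu]_x f x <= \int[mu]_x g x)%E.
Proof.
move=> f0 fg; have g0 x : (0 <= g x)%E by exact: le_trans (f0 x) (fg x).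
rewrite !ge0_integralTE//; apply: le_ereal_sup => _ [h /= hf <-].
by exists h => // x; exact: le_trans (hf x) (fg x).
Qed.

(** Addition of extended reals does not commute with suprema when infinities
    of both signs may occur; nonnegativity, with 0 in both sets, excludes
    that. *)
Lemma ge_ereal_supD (A B : set (\bar R)) (c : \bar R) :
  (forall x, A x -> (0 <= x)%E) -> A 0%E -> B 0%E -> (forall x, B x -> (0 <= x)%E) ->
  (forall x y, A x -> B y -> (x + y <= c)%E) -> (ereal_sup A + ereal_sup B <= c)%E.
Proof.
move=> A0 Az Bz B0 ABc.
have c0 : (0 <= c)%E by rewrite -[0%E]adde0; exact: ABc.
case: c c0 ABc => [c| |] // c0 ABc; last by rewrite leey.
have Afin x : A x -> x \is a fin_num.
  move=> Ax; rewrite ge0_fin_numE ?A0//; apply: le_lt_trans (ltry c).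
  by rewrite -[x]adde0; exact: ABc.
have H x : A x -> (ereal_sup B <= c%:E - x)%E.
  move=> Ax; apply: ge_ereal_sup => y By; rewrite leeBrDr ?Afin//.
  by rewrite addeC; exact: ABc.
have Bfin : ereal_sup B \is a fin_num.
  have := H _ Az; rewrite sube0 => Bc.
  rewrite ge0_fin_numE; first exact: le_lt_trans Bc (ltry c).
  exact: ereal_sup_ubound.
rewrite -leeBrDr//; apply: ge_ereal_sup => x Ax.
by rewrite leeBrDr// addeC -leeBrDr ?Afin//; exact: H.
Qed.

(** The integral of a nonnegative function is a supremum over simple functions
    below it, and simple functions can be added whether or not the given
    functions are measurable. *)
Lemma integralT_superadd (f g : R -> \bar R) : (forall x, (0 <= f x)%E) ->
  (forall x, (0 <= g x)%E) ->
  (\int[mu]_x f x + \int[mu]_x g x <= \int[mu]_x (f x + g x))%E.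
Proof.
move=> f0 g0; rewrite !ge0_integralTE//; last by move=> x; exact: adde_ge0.
apply: ge_ereal_supD.
- by move=> _ [h _ <-]; exact: sintegral_ge0.
- by exists nnsfun0 => //; exact: sintegral0.
- by exists nnsfun0 => //; exact: sintegral0.
- by move=> _ [h _ <-]; exact: sintegral_ge0.
move=> _ _ [h /= hf <-] [k /= kg <-]; apply: ereal_sup_ubound.
exists (add_nnsfun h k) => /=; first by move=> x; rewrite EFinD; exact: leeD.
by rewrite sintegralD.
Qed.

Lemma integral_rV_ge0 n (h : 'rV[R]_n -> \bar R) :
  (forall p, (0 <= h p)%E) -> (0 <= integral_rV h)%E.
Proof.
elim: n h => [|n IH] h h0 /=; first exact: h0.
by apply: integral_ge0 => s _; apply: IH => v; exact: h0.
Qed.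

Lemma le_integral_rV n (h k : 'rV[R]_n -> \bar R) : (forall p, (0 <= h p)%E) ->
  (forall p, (h p <= k p)%E) -> (integral_rV h <= integral_rV k)%E.
Proof.
elim: n h k => [|n IH] h k h0 hk /=; first exact: hk.
apply: le_integralT => s; first by apply: integral_rV_ge0 => v; exact: h0.
by apply: IH => v; [exact: h0|exact: hk].
Qed.

Lemma eq_integral_rV n (h k : 'rV[R]_n -> \bar R) :
  (forall p, h p = k p) -> integral_rV h = integral_rV k.
Proof. by move=> /funext ->. Qed.

Lemma integral_rV0 n : integral_rV (fun _ : 'rV[R]_n => 0%E) = 0%E :> \bar R.
Proof.
by elim: n => [//|n IH] /=; under eq_integral do rewrite IH; rewrite integral0.
Qed.

Lemma integral_rV_superadd n (h k : 'rV[R]_n -> \bar R) : (forall p, (0 <= h p)%E) ->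
  (forall p, (0 <= k p)%E) ->
  (integral_rV h + integral_rV k <= integral_rV (fun p => h p + k p))%E.
Proof.
elim: n h k => [|n IH] h k h0 k0 //=.
apply: le_trans (integralT_superadd _ _) _ => [s|s|].
- by apply: integral_rV_ge0 => v; exact: h0.
- by apply: integral_rV_ge0 => v; exact: k0.
apply: le_integralT => s; last by apply: IH => v; [exact: h0|exact: k0].
by apply: adde_ge0; apply: integral_rV_ge0 => v; [exact: h0|exact: k0].
Qed.

End LowerIntegral.

(** * Integrals of continuous functions over boxes *)

Section Box.
Variable R : realType.
Local Notation mu := (@lebesgue_measure R).

(** The intervals are closed: on a compact box, continuity of the integrand is
    uniform and makes each inner integral continuous in the outer variable. *)
Fixpoint boxint (n : nat) : 'rV[R]_n -> 'rV[R]_n -> ('rV[R]_n -> R) -> R :=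
  match n with
  | 0 => fun _ _ phi => phi 0
  | n'.+1 => fun (lo hi : 'rV[R]_(1 + n')) (phi : 'rV[R]_(1 + n') -> R) =>
      \int[mu]_(s in `[lo 0 0, hi 0 0])
        boxint (rsubmx lo) (rsubmx hi) (fun v => phi (row_mx s%:M v))
  end.

Fixpoint boxvol (n : nat) : 'rV[R]_n -> 'rV[R]_n -> R :=
  match n with
  | 0 => fun _ _ => 1
  | n'.+1 => fun (lo hi : 'rV[R]_(1 + n')) =>
      (hi 0 0 - lo 0 0) * boxvol (rsubmx lo) (rsubmx hi)
  end.

Lemma row_mx_cvg n (T : Type) (F : set_system T) (FF : Filter F) (s : T -> R) (v : T -> 'rV[R]_n)
    (s0 : R) (v0 : 'rV[R]_n) :
  s x @[x --> F] --> s0 -> v x @[x --> F] --> v0 ->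
  row_mx (s x)%:M (v x) @[x --> F] --> (row_mx s0%:M v0 : 'rV[R]_(1 + n)).
Proof.
move=> cs cv; apply: cvg_mx => i j; rewrite mxE.
rewrite (_ : (fun x => _) = fun x => match fintype.split j with
  | inl j1 => (s x)%:M i j1 | inr j2 => v x i j2 end); last first.
  by apply/funext => x; rewrite mxE.
case: (fintype.split j) => k; last exact: cvg_entry cv.
rewrite !ord1 mxE eqxx mulr1n (_ : (fun x => _) = s)//.
by apply/funext => x; rewrite mxE eqxx mulr1n.
Qed.

Lemma box_compact n (lo hi : 'rV[R]_n) :
  compact [set p : 'rV[R]_n | forall i, lo 0 i <= p 0 i <= hi 0 i].
Proof.
have := @rV_compact R n (fun i => `[lo 0 i, hi 0 i]%classic)
  (fun i => @segment_compact R (lo 0 i) (hi 0 i)).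
by congr compact; apply/seteqP.
Qed.

(** Continuity at all points of a compact fibre gives an estimate uniform
    along the fibre. *)
Lemma box_tube n (T : topologicalType) (lo hi : 'rV[R]_n) (G : T -> 'rV[R]_n -> R) (x0 : T) (e : R) :
  (forall v, (fun x : T * 'rV[R]_n => G x.1 x.2) @ (x0, v) --> G x0 v) -> 0 < e ->
  \forall x \near x0, forall v : 'rV[R]_n, (forall i, lo 0 i <= v 0 i <= hi 0 i) -> `|G x v - G x0 v| <= e.
Proof.
move=> cG e0.
have K := (compact_near_coveringP _).1 (@box_compact _ lo hi).
apply: (K T (nbhs x0) (fun x v => `|G x v - G x0 v| <= e)) => v _.
have e2 : 0 < e / 2 by exact: divr_gt0.
have cv := cG v; have H1 := (cvgrPdist_le _ _).1 cv _ e2.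
case: H1 => -[A B] /= [nA nB] AB.
exists (B, A) => //=.
move=> [v' x] /= [Bv' Ax].
have := AB (x, v') (conj Ax Bv'); have := AB (x0, v') (conj (nbhs_singleton nA) Bv').
rewrite /= !ler_distl => /andP[? ?] /andP[? ?]; apply/andP; split; lra.
Qed.


Lemma continuous_integrable (a b : R) (f : R -> R) : continuous f ->
  mu.-integrable `[a, b] (EFin \o f).
Proof.
move=> cf; apply: continuous_compact_integrable; first exact: segment_compact.
exact: continuous_subspaceT.
Qed.

Lemma RintegralB_cont (a b : R) (f g : R -> R) : continuous f -> continuous g ->
  \int[mu]_(s in `[a, b]) (f s - g s) = \int[mu]_(s in `[a, b]) f s - \int[mu]_(s in `[a, b]) g s.
Proof. by move=> cf cg; rewrite RintegralB//; exact: continuous_integrable. Qed.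

Lemma Rintegral_itv_cst (a b c : R) : a <= b ->
  \int[mu]_(s in `[a, b]) c = c * (b - a).
Proof.
move=> ab; rewrite Rintegral_cst//= lebesgue_measure_itv/= lte_fin.
case: ltP => // ba; have -> : a = b by apply/eqP; rewrite eq_le ab ba.
by rewrite subrr.
Qed.

Lemma slice_continuous n (phi : 'rV[R]_(1 + n) -> R) s : continuous phi ->
  continuous (fun v : 'rV[R]_n => phi (row_mx s%:M v)).
Proof.
move=> cphi; suff H (v : 'rV[R]_n) :
    phi (row_mx s%:M w) @[w --> v] --> phi (row_mx s%:M v) by move=> v; exact: H.
apply: (@cvg_comp _ _ _ (fun v => row_mx s%:M v) phi); last exact: cphi.
have c1 : (fun _ : 'rV[R]_n => s) w @[w --> v] --> s by exact (@cvg_cst _ s _ (nbhs v) (@nbhs_filter _ v)).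
have c2 : (fun w : 'rV[R]_n => w) w @[w --> v] --> v by exact: cvg_id.
exact (row_mx_cvg (@nbhs_filter _ v) c1 c2).
Qed.

Lemma slice_continuous2 n (phi : 'rV[R]_(1 + n) -> R) (s : R) (v : 'rV[R]_n) :
  continuous phi ->
  (fun x : R * 'rV[R]_n => phi (row_mx (x.1)%:M x.2)) @ (s, v) --> phi (row_mx s%:M v).
Proof.
move=> cphi.
apply: (@cvg_comp _ _ _ (fun x : R * 'rV[R]_n => row_mx (x.1)%:M x.2) phi); last exact: cphi.
have c1 : (fun x : R * 'rV[R]_n => x.1) x @[x --> (s, v)] --> s by exact (@cvg_fst _ _ (nbhs s) (nbhs v) (@nbhs_filter _ v)).
have c2 : (fun x : R * 'rV[R]_n => x.2) x @[x --> (s, v)] --> v.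
  by exact (@cvg_snd _ _ (nbhs s) (nbhs v) (@nbhs_filter _ s)).
exact (row_mx_cvg (@nbhs_filter _ (s, v)) c1 c2).
Qed.

Lemma rsubmx_le n (lo hi : 'rV[R]_(1 + n)) : (forall i, lo 0 i <= hi 0 i) ->
  forall i, rsubmx lo 0 i <= rsubmx hi 0 i.
Proof. by move=> lh i; rewrite !mxE; exact: lh. Qed.

Lemma in_box_row_mx n (lo hi : 'rV[R]_(1 + n)) s (v : 'rV[R]_n) :
  lo 0 0 <= s <= hi 0 0 -> (forall i, rsubmx lo 0 i <= v 0 i <= rsubmx hi 0 i) ->
  forall i, lo 0 i <= row_mx s%:M v 0 i <= hi 0 i.
Proof.
move=> sI vI i; case: (split_ordP i) => k ->.
  by rewrite row_mxEl !ord1 mxE eqxx mulr1n (_ : lshift n 0 = 0)//; exact: val_inj.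
by rewrite row_mxEr; have := vI k; rewrite !mxE.
Qed.

Lemma boxvol_ge0 n (lo hi : 'rV[R]_n) : (forall i, lo 0 i <= hi 0 i) -> 0 <= boxvol lo hi.
Proof.
elim: n lo hi => [|n IH] lo hi lh //=; apply: mulr_ge0; first by rewrite subr_ge0; exact: lh.
by apply: IH; exact: rsubmx_le.
Qed.

Section step.
(** The induction for the properties of [boxint] runs on all of them at once,
    because integrability of the inner integral needs its continuity. *)
Variable n : nat.
Implicit Types (lo hi : 'rV[R]_n) (phi psi : 'rV[R]_n -> R).

Definition boxint_spec := forall lo hi, (forall i, lo 0 i <= hi 0 i) ->
  [/\ forall phi psi, continuous phi -> continuous psi ->
        boxint lo hi (fun p => phi p - psi p) = boxint lo hi phi - boxint lo hi psi
    & forall phi c, continuous phi ->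
        (forall p : 'rV[R]_n, (forall i, lo 0 i <= p 0 i <= hi 0 i) -> `|phi p| <= c) ->
        `|boxint lo hi phi| <= c * boxvol lo hi].

Lemma boxint_param (T : topologicalType) lo hi (G : T -> 'rV[R]_n -> R) (x0 : T) :
  boxint_spec -> (forall i, lo 0 i <= hi 0 i) -> (forall x, continuous (G x)) ->
  (forall v, (fun x : T * 'rV[R]_n => G x.1 x.2) @ (x0, v) --> G x0 v) ->
  boxint lo hi (G x) @[x --> x0] --> boxint lo hi (G x0).
Proof.
move=> spec lh cG cGx; have [specB spec_le] := spec lo hi lh.
have V0 := boxvol_ge0 lh.
apply/cvgrPdist_le => e e0.
have e1 : 0 < e / (boxvol lo hi + 1) by apply: divr_gt0 => //; exact: ltr_wpDl.
have := box_tube lo hi cGx e1; apply: filterS => x Hx.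
have cB : continuous (fun v => G x v - G x0 v).
  by move=> v; exact: (cvgB (cG x v) (cG x0 v)).
rewrite distrC -(specB _ _ (cG x) (cG x0)); apply: le_trans (spec_le _ _ cB Hx) _.
rewrite mulrAC ler_pdivrMr; last exact: ltr_wpDl.
by apply: ler_wpM2l; [exact: ltW|rewrite lerDl].
Qed.

End step.

Lemma boxint_specP n : boxint_spec n.
Proof.
elim: n => [|n IH] lo hi lh.
  by split=> [//|phi c _ H] /=; rewrite mulr1; apply: H => -[].
have slh := rsubmx_le lh; have [IHB IHle] := IH _ _ slh.
have cS phi : continuous phi ->
    continuous (fun s => boxint (@rsubmx R 1 1 n lo) (@rsubmx R 1 1 n hi) (fun v : 'rV_n => phi (row_mx s%:M v))).
  move=> cphi s; apply: boxint_param => //; first by move=> x; exact: slice_continuous.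
  by move=> v; exact: slice_continuous2.
split=> [phi psi cphi cpsi|phi c cphi H] /=.
  rewrite -RintegralB_cont; [|exact: cS|exact: cS].
  by apply: eq_Rintegral => s _; rewrite IHB//; exact: slice_continuous.
apply: le_trans (le_normr_Rintegral _ _) _ => //; first exact/continuous_integrable/cS.
have ab : lo 0 0 <= hi 0 0 by exact: lh.
rewrite mulrCA mulrC -Rintegral_itv_cst//; apply: le_Rintegral => //.
- apply: continuous_integrable => s; apply: (continuous_comp (cS _ cphi s)).
  exact: norm_continuous.
- by apply: continuous_integrable; exact: cst_continuous.
move=> s; rewrite /= in_itv/= => sI; apply: IHle; first exact: slice_continuous.
by move=> v vI; apply: H; exact: in_box_row_mx.
Qed.

Section BoxTheory.
Variables (n : nat) (lo hi : 'rV[R]_n).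
Hypothesis lh : forall i, lo 0 i <= hi 0 i.
Implicit Types phi psi : 'rV[R]_n -> R.

Lemma boxintB phi psi : continuous phi -> continuous psi ->
  boxint lo hi (fun p => phi p - psi p) = boxint lo hi phi - boxint lo hi psi.
Proof. by move=> cphi cpsi; case: (boxint_specP lh) => H _; exact: H. Qed.

Lemma norm_boxint_le phi c : continuous phi ->
  (forall p : 'rV[R]_n, (forall i, lo 0 i <= p 0 i <= hi 0 i) -> `|phi p| <= c) ->
  `|boxint lo hi phi| <= c * boxvol lo hi.
Proof. by move=> cphi Hc; case: (boxint_specP lh) => _ H; exact: H. Qed.

Lemma boxint0 : boxint lo hi (fun=> 0) = 0.
Proof.
have c0 : continuous (fun _ : 'rV[R]_n => 0 : R) by exact: cst_continuous.
by have := boxintB c0 c0; rewrite !subrr.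
Qed.

Lemma eq_boxint phi psi : (forall p, phi p = psi p) -> boxint lo hi phi = boxint lo hi psi.
Proof. by move=> /funext ->. Qed.

Lemma boxintD phi psi : continuous phi -> continuous psi ->
  boxint lo hi (fun p => phi p + psi p) = boxint lo hi phi + boxint lo hi psi.
Proof.
move=> cphi cpsi.
have c0 : continuous (fun _ : 'rV[R]_n => 0 : R) by exact: cst_continuous.
have cN : continuous (fun p => 0 - psi p) by move=> p; exact: (cvgB (c0 p) (cpsi p)).
have := boxintB cphi cN; rewrite (boxintB c0 cpsi) boxint0 sub0r opprK => <-.
by apply: eq_boxint => p; rewrite sub0r opprK.
Qed.

End BoxTheory.

Lemma boxintZ n (lo hi : 'rV[R]_n) (c : R) (phi : 'rV[R]_n -> R) : (forall i, lo 0 i <= hi 0 i) ->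
  continuous phi -> boxint lo hi (fun p => c * phi p) = c * boxint lo hi phi.
Proof.
elim: n lo hi phi => [//|n IH] lo hi phi lh cphi /=.
rewrite -RintegralZl//; last first.
  apply: continuous_integrable => s; apply: (boxint_param (@boxint_specP n)).
  - exact: rsubmx_le.
  - by move=> x; exact: slice_continuous.
  - by move=> v; exact: slice_continuous2.
apply: eq_Rintegral => s _; rewrite IH//; first exact: rsubmx_le.
exact: slice_continuous.
Qed.

Lemma boxint_cst n (lo hi : 'rV[R]_n) (c : R) : (forall i, lo 0 i <= hi 0 i) ->
  boxint lo hi (fun=> c) = c * boxvol lo hi.
Proof.
elim: n lo hi => [|n IH] lo hi lh /=; first by rewrite mulr1.
rewrite (IH _ _ (rsubmx_le lh)) Rintegral_itv_cst; last exact: lh.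
by rewrite mulrAC mulrA.
Qed.

Definition inbox n (lo hi p : 'rV[R]_n) : bool :=
  [forall i, lo 0 i <= p 0 i < hi 0 i].

Lemma inbox_row_mx n (lo hi : 'rV[R]_(1 + n)) s (v : 'rV[R]_n) :
  inbox lo hi (row_mx s%:M v) =
  (lo 0 0 <= s < hi 0 0) && inbox (rsubmx lo) (rsubmx hi) v.
Proof.
have l0 : lshift n (0 : 'I_1) = (0 : 'I_(1 + n)) by apply: val_inj.
apply/forallP/andP => [H|[sI /forallP vI] i].
  split.
    by have := H (lshift n 0); rewrite row_mxEl mxE eqxx mulr1n l0.
  by apply/forallP => i; have := H (rshift 1 i); rewrite row_mxEr !mxE.
case: (split_ordP i) => k ->.
  by rewrite row_mxEl !ord1 mxE eqxx mulr1n l0.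
by rewrite row_mxEr; have := vI k; rewrite !mxE.
Qed.

(** The bridge between the two integrals. Half-open boxes are the right
    domains on the left because 0 <= t < 1 is a fundamental domain; endpoints
    do not matter to Lebesgue measure. *)
Lemma integral_rV_box n (lo hi : 'rV[R]_n) (phi : 'rV[R]_n -> R) : (forall i, lo 0 i <= hi 0 i) ->
  continuous phi ->
  integral_rV (fun p => ((inbox lo hi p)%:R * phi p)%:E) = (boxint lo hi phi)%:E.
Proof.
elim: n lo hi phi => [|n IH] lo hi phi lh cphi /=.
  by rewrite (_ : inbox _ _ _ = true) ?mul1r//; apply/forallP => -[].
have slh := rsubmx_le lh.
pose Phi (s : R) := boxint (@rsubmx R 1 1 n lo) (@rsubmx R 1 1 n hi) (fun v : 'rV_n => phi (row_mx s%:M v)).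
pose a : R := lo 0 0; pose b : R := hi 0 0; have cS : continuous Phi.
  move=> s; apply: (boxint_param (@boxint_specP n)) => //.
  - by move=> x; exact: slice_continuous.
  - by move=> v; exact: slice_continuous2.
transitivity (\int[mu]_s ((EFin \o Phi) \_ `[a, b[) s)%E.
  apply: eq_integral => s _; rewrite patchE.
  have -> : (s \in `[a, b[%classic) = (a <= s < b).
    by apply/idP/idP; rewrite inE/= in_itv.
  case: ifPn => sI.
    rewrite /= -IH//; last exact: slice_continuous.
    by apply: eq_integral_rV => v; rewrite inbox_row_mx sI.
  by rewrite -[RHS](integral_rV0 R n); apply: eq_integral_rV => v; rewrite inbox_row_mx (negbTE sI) mul0r.
rewrite -integral_mkcond integral_itv_bndo_bndc; last first.
  have mPhi := measurable_int _ (@continuous_integrable a b Phi cS).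
  by apply: measurable_funS mPhi => //; exact: subset_itv_co_cc.
rewrite /Rintegral fineK//; apply: integrable_fin_num => //.
exact: continuous_integrable.
Qed.

Lemma boxvol_gt0 n (lo hi : 'rV[R]_n) : (forall i, lo 0 i < hi 0 i) -> 0 < boxvol lo hi.
Proof.
elim: n lo hi => [|n IH] lo hi lh //=; apply: mulr_gt0; first by rewrite subr_gt0; exact: lh.
by apply: IH => i; rewrite !mxE.
Qed.

Lemma le_boxint n (lo hi : 'rV[R]_n) (phi psi : 'rV[R]_n -> R) : (forall i, lo 0 i <= hi 0 i) ->
  continuous phi -> continuous psi ->
  (forall p : 'rV[R]_n, (forall i, lo 0 i <= p 0 i <= hi 0 i) -> phi p <= psi p) ->
  boxint lo hi phi <= boxint lo hi psi.
Proof.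
elim: n lo hi phi psi => [|n IH] lo hi phi psi lh cphi cpsi H /=; first by apply: H => -[].
have slh := rsubmx_le lh.
have cS f : continuous f ->
    continuous (fun s => boxint (@rsubmx R 1 1 n lo) (@rsubmx R 1 1 n hi) (fun v : 'rV_n => f (row_mx s%:M v))).
  move=> cf s; apply: (boxint_param (@boxint_specP n)) => //.
  - by move=> x; exact: slice_continuous.
  - by move=> v; exact: slice_continuous2.
apply: le_Rintegral => //; [exact/continuous_integrable/cS|exact/continuous_integrable/cS|].
move=> s; rewrite /= in_itv/= => sI; apply: IH => //; [exact: slice_continuous|exact: slice_continuous|].
by move=> v vI; apply: H; exact: in_box_row_mx.
Qed.

End Box.

(** * Integration by parts on a box *)

Section BoxDivergence.
Variable R : realType.
Local Notation mu := (@lebesgue_measure R).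

(** The order of the two points is left open, since difference quotients use
    increments of both signs. *)
Lemma mean_value (f df : R -> R) (a b : R) : (forall x : R, is_derive x 1 f (df x)) ->
  exists2 c, `|c - a| <= `|b - a| & f b - f a = df c * (b - a).
Proof.
move=> fdf.
have cf (x y : R) : {within `[x, y], continuous f}.
  by apply: derivable_within_continuous => z _; have [] := fdf z.
have [ab|ba] := leP a b.
  have [c cI ->] := MVT_segment ab (fun x _ => fdf x) (cf _ _).
  exists c => //; move: cI; rewrite in_itv/= => /andP[ac cb].
  by rewrite !ger0_norm ?subr_ge0// lerD2r.
have [c cI E] := MVT_segment (ltW ba) (fun x _ => fdf x) (cf _ _).
exists c; last by rewrite -opprB E -mulrN opprB.
move: cI; rewrite in_itv/= => /andP[bc ca].
by rewrite !ler0_norm ?subr_le0 ?(ltW ba)//; lra.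
Qed.

Lemma row_mx_addl n (h s : R) (v : 'rV[R]_n) :
  row_mx (h + s)%:M v = h *: ebase R (lshift n (0 : 'I_1)) + row_mx s%:M v :> 'rV[R]_(1 + n).
Proof.
apply/rowP => i; rewrite [RHS]mxE [X in _ = X + _]mxE.
case: (split_ordP i) => k ->.
  by rewrite !row_mxEl !mxE !ord1 !eqxx !mulr1n mulr1.
by rewrite !row_mxEr mxE eq_rlshift andbF mulr0 add0r.
Qed.

Lemma row_mx_addr n (h s : R) (u v : 'rV[R]_n) :
  row_mx s%:M (h *: u + v) = h *: row_mx 0 u + row_mx s%:M v :> 'rV[R]_(1 + n).
Proof. by rewrite scale_row_mx add_row_mx scaler0 add0r. Qed.

Lemma ebase_rshift n (j : 'I_n) : ebase R (rshift 1 j) = row_mx 0 (ebase R j).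
Proof.
apply/rowP => i; case: (split_ordP i) => k ->.
  by rewrite row_mxEl !mxE eq_lrshift andbF.
by rewrite row_mxEr !mxE eq_rshift.
Qed.

(** Differentiation under the integral sign: by the mean value theorem the
    error of the difference quotient is at most the oscillation of [psi]
    between two nearby slices, which is uniformly small on a compact box. *)
Lemma boxint_slice_derive n (lo hi : 'rV[R]_n) (phi psi : 'rV[R]_(1 + n) -> R) (s : R) :
  (forall i, lo 0 i <= hi 0 i) -> continuous phi -> continuous psi ->
  (forall p, is_derive p (ebase R (lshift n (0 : 'I_1))) phi (psi p)) ->
  is_derive s 1 (fun s => boxint lo hi (fun v => phi (row_mx s%:M v)))
    (boxint lo hi (fun v => psi (row_mx s%:M v))).
Proof.
move=> lh cphi cpsi dphi; set Phi := fun s => boxint _ _ _.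
set Psi := boxint _ _ _.
have V0 := boxvol_ge0 lh.
suff H : (fun h : R => h^-1 *: (Phi (h *: 1 + s) - Phi s)) h @[h --> 0^'] --> Psi.
  by split; [apply/cvg_ex; exists Psi|exact: cvg_lim H].
apply/cvgrPdist_le => e e0.
have e1 : 0 < e / (boxvol lo hi + 1) by apply: divr_gt0 => //; exact: ltr_wpDl.
have := @box_tube R n _ lo hi (fun x v => psi (row_mx x%:M v)) s _
  (fun v => @slice_continuous2 R n psi s v cpsi) e1.
move=> /nbhs_ballP[d /= d0 Hd].
near=> h.
have h0 : h != 0 by near: h; exact: nbhs_dnbhs_neq.
have hd : `|h| < d by near: h; exact: dnbhs0_lt.
have -> : h *: 1 + s = h + s by rewrite /GRing.scale/= mulr1.
have sc x : continuous (fun v : 'rV_n => phi (row_mx x%:M v)) by exact: slice_continuous.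
have sp : continuous (fun v : 'rV_n => psi (row_mx s%:M v)) by exact: slice_continuous.
have spZ : continuous (fun v : 'rV_n => h * psi (row_mx s%:M v)).
  by move=> v; exact: (cvgM (cvg_cst h) (sp v)).
have sB : continuous (fun v : 'rV_n => phi (row_mx (h + s)%:M v) - phi (row_mx s%:M v)).
  by move=> v; exact: (cvgB (sc _ v) (sc _ v)).
have sBB : continuous (fun v : 'rV_n => (phi (row_mx (h + s)%:M v) - phi (row_mx s%:M v))
    - h * psi (row_mx s%:M v)).
  by move=> v; exact: (cvgB (sB v) (spZ v)).
have E : Phi (h + s) - Phi s - h * Psi = boxint lo hi (fun v =>
    (phi (row_mx (h + s)%:M v) - phi (row_mx s%:M v)) - h * psi (row_mx s%:M v)).
  by rewrite (boxintB lh sB spZ) (boxintB lh (sc _) (sc _)) boxintZ.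
have B : `|Phi (h + s) - Phi s - h * Psi| <= `|h| * (e / (boxvol lo hi + 1)) * boxvol lo hi.
  rewrite E; apply: norm_boxint_le => // v vI.
  have dl (x : R) : is_derive x 1 (fun x : R => phi (x *: ebase R (lshift n (0 : 'I_1)) + row_mx 0%:M v))
      (psi (x *: ebase R (lshift n (0 : 'I_1)) + row_mx 0%:M v)).
    have [dp Ep] := dphi (x *: ebase R (lshift n (0 : 'I_1)) + row_mx 0%:M v).
    by rewrite -Ep; exact: is_derive_line.
  have [c cs Ec] := mean_value s (h + s) dl.
  move: Ec cs; rewrite -!row_mx_addl !addr0 addrK => -> cs.
  rewrite mulrC -mulrBr normrM; apply: ler_wpM2l => //.
  apply: Hd => //; rewrite -ball_normE /= distrC; exact: le_lt_trans cs hd.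
have -> : Psi - h^-1 *: (Phi (h + s) - Phi s) = - (h^-1 * (Phi (h + s) - Phi s - h * Psi)).
  by rewrite /GRing.scale/=; field.
rewrite normrN normrM normfV ler_pdivrMl ?normr_gt0//.
apply: le_trans B _; rewrite -mulrA; apply: ler_wpM2l => //.
rewrite mulrAC ler_pdivrMr; last exact: ltr_wpDl.
by apply: ler_wpM2l; [exact: ltW|rewrite lerDl].
Unshelve. all: by end_near. Qed.

(** The fundamental theorem of calculus in the [j]-th variable when the two
    faces contribute equally. This covers both functions periodic in that
    variable and functions vanishing on the two faces. *)
Lemma boxint_derive0 n (lo hi : 'rV[R]_n) (j : 'I_n) (phi psi : 'rV[R]_n -> R) :
  (forall i, lo 0 i < hi 0 i) -> continuous phi -> continuous psi ->
  (forall p, is_derive p (ebase R j) phi (psi p)) ->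
  (forall p : 'rV[R]_n, p 0 j = lo 0 j -> phi ((hi 0 j - lo 0 j) *: ebase R j + p) = phi p) ->
  boxint lo hi psi = 0.
Proof.
elim: n lo hi j phi psi => [? ? []//|n IH].
(* the integrals split the dimension as 1 + n rather than n.+1 *)
change (forall (lo hi : 'rV[R]_(1 + n)) (j : 'I_(1 + n)) (phi psi : 'rV[R]_(1 + n) -> R),
  (forall i, lo 0 i < hi 0 i) -> continuous phi -> continuous psi ->
  (forall p, is_derive p (ebase R j) phi (psi p)) ->
  (forall p : 'rV[R]_(1 + n), p 0 j = lo 0 j -> phi ((hi 0 j - lo 0 j) *: ebase R j + p) = phi p) ->
  \int[mu]_(s in `[lo 0 0, hi 0 0])
     boxint (rsubmx lo) (rsubmx hi) (fun v => psi (row_mx s%:M v)) = 0).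
move=> lo hi j phi psi lh cphi cpsi dphi Hper.
have slh i : rsubmx lo 0 i < rsubmx hi 0 i by rewrite !mxE; exact: lh.
case: (split_ordP j) => k jE; subst j.
  rewrite ord1 in dphi Hper.
  pose Phi (s : R) := boxint (rsubmx lo) (rsubmx hi) (fun v => phi (row_mx s%:M v)).
  pose Psi (s : R) := boxint (rsubmx lo) (rsubmx hi) (fun v => psi (row_mx s%:M v)).
  have wlh i : rsubmx lo 0 i <= rsubmx hi 0 i by exact: ltW.
  have dPhi (s : R) : is_derive s 1 Phi (Psi s) by exact: boxint_slice_derive.
  have cPhi : continuous Phi.
    by move=> s; apply/differentiable_continuous/derivable1_diffP; have [] := dPhi s.
  have cPsi : continuous Psi.
    move=> s; apply: (boxint_param (@boxint_specP _ n)) => //.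
    - by move=> x; exact: slice_continuous.
    - by move=> v; exact: slice_continuous2.
  have FTC := @continuous_FTC2 R Psi Phi (lo 0 0) (hi 0 0) (lh 0).
  rewrite -/Psi /Rintegral FTC.
  - have -> : Phi (hi 0 0) = Phi (lo 0 0).
      apply: eq_boxint => v.
      have l0 : lshift n (0 : 'I_1) = (0 : 'I_(1 + n)) by apply: val_inj.
      rewrite -[in LHS](subrK (lo 0 0) (hi 0 0)) row_mx_addl l0 -l0 Hper//.
      by rewrite row_mxEl mxE eqxx mulr1n.
    by rewrite -EFinB subrr.
  - exact: continuous_subspaceT.
  - split; first by move=> x _; have [] := dPhi x.
    + by apply: cvg_at_right_filter; exact: cPhi.
    + by apply: cvg_at_left_filter; exact: cPhi.
  - by move=> x _; rewrite derive1E; have [_ ->] := dPhi x.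
rewrite (_ : (fun s => _) = fun=> 0); first by rewrite Rintegral_itv_cst ?mul0r//; exact/ltW/lh.
apply/funext => s; apply: (IH _ _ k (fun v => phi (row_mx s%:M v))) => //.
- exact: slice_continuous.
- exact: slice_continuous.
- move=> v; have [dp Ep] := dphi (row_mx s%:M v).
  have E : (fun h : R => h^-1 *: (phi (row_mx s%:M (h *: ebase R k + v)) - phi (row_mx s%:M v)))
    = (fun h : R => h^-1 *: (phi (h *: ebase R (rshift 1 k) + row_mx s%:M v) - phi (row_mx s%:M v))).
    by apply/funext => h; rewrite row_mx_addr -ebase_rshift.
  split; first by rewrite /derivable /= E.
  by rewrite -Ep /derive /= E.
- move=> v; rewrite !mxE => vk; rewrite row_mx_addr -ebase_rshift Hper//.
  by rewrite row_mxEr.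
Qed.

End BoxDivergence.

(** * Power growth and cutoff functions *)

Section RealAnalysis.
Variable R : realType.

(** Cut the interval into N equal pieces: the losses add up to at most C (b -
    a)^2 / N. *)
Lemma le_of_quadratic_loss (G : R -> R) (a b C : R) : a <= b ->
  (forall x y, a <= x -> x <= y -> y <= b -> G x - G y <= C * (y - x) ^+ 2) ->
  G a <= G b.
Proof.
move=> ab HG; rewrite -subr_le0; apply/ler_addgt0Pr => e e0; rewrite add0r.
have [N HN] : exists N : nat, C * (b - a) ^+ 2 / e < N.+1%:R.
  exists (Num.trunc (C * (b - a) ^+ 2 / e)); exact: truncnS_gt.
have N0 : 0 < N.+1%:R :> R by [].
pose h := (b - a) / N.+1%:R.
have h0 : 0 <= h by rewrite divr_ge0 ?subr_ge0// ltW.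
have hN : h * N.+1%:R = b - a by rewrite /h divfK// gt_eqF.
have step i : (i <= N.+1)%N -> G a - G (a + i%:R * h) <= i%:R * (C * h ^+ 2).
  elim: i => [|i IH] iN; first by rewrite !mul0r addr0 subrr.
  have iN' : i.+1%:R * h <= b - a.
    by rewrite -hN mulrC; apply: ler_wpM2l => //; rewrite ler_nat.
  have ih0 : 0 <= i%:R * h by rewrite mulr_ge0.
  have E : i.+1%:R * h = i%:R * h + h by rewrite -natr1 mulrDl mul1r.
  have A1 : a <= a + i%:R * h by lra.
  have A2 : a + i%:R * h <= a + i.+1%:R * h by rewrite E; lra.
  have A3 : a + i.+1%:R * h <= b by lra.
  have := HG _ _ A1 A2 A3.
  have -> : a + i.+1%:R * h - (a + i%:R * h) = h by rewrite E; ring.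
  have E2 : i.+1%:R * (C * h ^+ 2) = i%:R * (C * h ^+ 2) + C * h ^+ 2.
    by rewrite -natr1 mulrDl mul1r.
  rewrite E2 => Hs; have IHi := IH (ltnW iN).
  by rewrite -(subrKA (G (a + i%:R * h))) lerD.
have := step _ (leqnn _); rewrite mulrC in hN; have abb : a + (b - a) = b by ring.
rewrite hN abb => /le_trans; apply.
rewrite ltr_pdivrMr// in HN.
have -> : N.+1%:R * (C * h ^+ 2) = (C * (b - a) ^+ 2) / N.+1%:R.
  by rewrite /h; field; rewrite gt_eqF.
by rewrite ler_pdivrMr// [leRHS]mulrC ltW.
Qed.

Lemma ln_le_subr1 (y : R) : 0 < y -> ln y <= y - 1.
Proof.
move=> y0; rewrite -ler_expR lnK ?posrE//.
by apply: le_trans (expR_ge1Dx _); rewrite addrC subrK.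
Qed.

(** The hypothesis bounds E(a) / E(b) by 1 - (k - delta) d / (b + d + k d),
    where d = b - a. Since ln y <= y - 1, ln E grows by at least (k - delta) d
    / (b + d + k d), which up to a term of order d^2 offsets (k - delta) (ln b
    - ln a) <= (k - delta) d / a. *)
Lemma log_growth_step (k delta s0 a b Ea Eb : R) : 0 <= delta -> delta <= k ->
  0 < s0 -> s0 <= a -> a <= b -> 0 < Ea -> 0 < Eb ->
  (b - a) * (k * Ea - delta * Eb) <= (b + (b - a)) * (Eb - Ea) ->
  (ln Ea - (k - delta) * ln a) - (ln Eb - (k - delta) * ln b)
    <= ((k - delta) * (k + 2) / s0 ^+ 2) * (b - a) ^+ 2.
Proof.
move=> d0 dk s00 s0a ab Ea0 Eb0 H.
have a0 : 0 < a by exact: lt_le_trans s0a.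
have b0 : 0 < b by exact: lt_le_trans ab.
have k0 : 0 <= k by exact: le_trans dk.
pose d := b - a; have dd : 0 <= d by rewrite subr_ge0.
pose q := k - delta; have q0 : 0 <= q by rewrite subr_ge0.
have kd : 0 <= k * d by exact: mulr_ge0.
have P0 : 0 < b + d + k * d by lra.
have L1 : ln Ea - ln Eb <= - (q * d / (b + d + k * d)).
  rewrite -ln_div ?posrE//; apply: le_trans (ln_le_subr1 (divr_gt0 Ea0 Eb0)) _.
  rewrite -[X in _ - X](divff (lt0r_neq0 Eb0)) -mulrBl ler_pdivrMr// -mulNr mulrAC ler_pdivlMr//.
  rewrite /q /d in H *; nra.
have L2 : ln b - ln a <= d / a.
  rewrite -ln_div ?posrE//; apply: le_trans (ln_le_subr1 (divr_gt0 b0 a0)) _.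
  by rewrite -[X in _ - X](divff (lt0r_neq0 a0)) -mulrBl.
have L3 : d / a - d / (b + d + k * d) <= (k + 2) / s0 ^+ 2 * d ^+ 2.
  have -> : d / a - d / (b + d + k * d) = (d / a) * ((b + d + k * d - a) / (b + d + k * d)).
    by field; rewrite !gt_eqF.
  have -> : b + d + k * d - a = (k + 2) * d by rewrite /d; ring.
  have -> : (k + 2) / s0 ^+ 2 * d ^+ 2 = (d / s0) * ((k + 2) * d / s0) by field; rewrite gt_eqF.
  apply: ler_pM.
  - exact/divr_ge0/ltW.
  - apply: divr_ge0; last exact: ltW.
    by apply: mulr_ge0 => //; lra.
  - by apply: ler_wpM2l => //; rewrite lef_pV2 ?posrE.
  - apply: ler_wpM2l; first by apply: mulr_ge0 => //; lra.
    by rewrite lef_pV2 ?posrE//; lra.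
have M1 : q * (ln b - ln a) <= q * (d / a) by exact: ler_wpM2l.
have M3 := ler_wpM2l q0 L3.
rewrite -/q -/d.
have -> : q * (k + 2) / s0 ^+ 2 * d ^+ 2 = q * ((k + 2) / s0 ^+ 2 * d ^+ 2) by ring.
have E1 : q * d / (b + d + k * d) = q * (d / (b + d + k * d)) by rewrite mulrA.
rewrite E1 in L1; lra.
Qed.

(** The hypothesis is a discrete form of s E'(s) >= (k - delta) E(s), with an
    error of order (b - a)^2 that disappears by subdivision. *)
Lemma power_growth (k delta s0 : R) (E : R -> R) : 0 <= delta -> delta <= k ->
  0 < s0 -> (forall s, s0 <= s -> 0 < E s) ->
  (forall a b, s0 <= a -> a < b ->
    (b - a) * (k * E a - delta * E b) <= (b + (b - a)) * (E b - E a)) ->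
  forall s, s0 <= s -> ln (E s0) - (k - delta) * ln s0 <= ln (E s) - (k - delta) * ln s.
Proof.
move=> d0 dk s00 E0 HE s s0s.
apply: (@le_of_quadratic_loss (fun s => ln (E s) - (k - delta) * ln s) _ _
  ((k - delta) * (k + 2) / s0 ^+ 2)) => // x y s0x xy ys.
apply: log_growth_step => //; [exact: E0|by apply: E0; exact: le_trans xy|].
move: xy; rewrite le_eqVlt => /predU1P[->|xy]; last exact: HE.
by rewrite !subrr mul0r mulr0.
Qed.

Definition ramp (u : R) := Num.max u 0.
(** A primitive of [ramp]; the cutoffs are combinations of its translates, so
    that their C1 regularity and their derivative need not be checked piece by
    piece. *)
Definition ramp2 (u : R) := ramp u ^+ 2 / 2.

Lemma ramp_continuous : continuous ramp.
Proof. by move=> u; apply: continuous_max => //; exact: cst_continuous. Qed.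

Lemma ramp2_taylor (u h : R) : 0 <= ramp2 (h + u) - ramp2 u - h * ramp u <= h ^+ 2 / 2.
Proof.
rewrite /ramp2 /ramp; case: (leP u 0) => u0; case: (leP (h + u) 0) => hu0; apply/andP; split; nra.
Qed.

Lemma ramp2_derive (u : R) : is_derive u 1 ramp2 (ramp u).
Proof.
suff H : (fun h : R => h^-1 *: (ramp2 (h *: 1 + u) - ramp2 u)) h @[h --> 0^'] --> ramp u.
  by split; [apply/cvg_ex; exists (ramp u)|exact: cvg_lim H].
apply/cvgrPdist_le => e e0; near=> h.
have h0 : h != 0 by near: h; exact: nbhs_dnbhs_neq.
have hd : `|h| < e by near: h; exact: dnbhs0_lt.
have -> : h *: 1 + u = h + u by rewrite /GRing.scale/= mulr1.
have -> : ramp u - h^-1 *: (ramp2 (h + u) - ramp2 u) =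
    - (h^-1 * (ramp2 (h + u) - ramp2 u - h * ramp u)).
  by rewrite /GRing.scale/=; field.
rewrite normrN normrM normfV ler_pdivrMl ?normr_gt0//.
have /andP[T1 T2] := ramp2_taylor u h; rewrite ger0_norm//; apply: le_trans T2 _.
rewrite -normr_id -(real_normK (num_real h)) normr_id.
have : `|h| * `|h| <= `|h| * e by apply: ler_wpM2l => //; exact: ltW.
have : 0 <= `|h| by []; nra.
Unshelve. all: by end_near. Qed.

Section Cutoff.
Variables (a b M : R).
Hypotheses (ab : a < b) (M1 : 1 < M * (b - a)) (M2 : M * (b - a) <= 2).

(** The length of each sloping side of the trapezoid [plateau], chosen so that
    the trapezoid has area 1 / M; then [cutoff], whose derivative is - M *
    plateau, falls from 1 to exactly 0. *)
Definition cutoff_width := (b - a) - M^-1.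
Local Notation w := cutoff_width.

Definition plateau (s : R) :=
  (ramp (s - a) - ramp (s - a - w) - ramp (s - b + w) + ramp (s - b)) / w.
(** A C1 function falling from 1 at [a] to 0 at [b] has a slope steeper than 1
    / (b - a) somewhere, and any M with M (b - a) > 1 is enough as a bound; M
    (b - a) <= 2 keeps the sloping sides of the trapezoid apart. *)
Definition cutoff (s : R) :=
  1 - M / w * (ramp2 (s - a) - ramp2 (s - a - w) - ramp2 (s - b + w) + ramp2 (s - b)).

Lemma cutoff_M_gt0 : 0 < M.
Proof.
have d0 : 0 < b - a by rewrite subr_gt0.
by rewrite -(pmulr_lgt0 _ d0); exact: lt_trans M1.
Qed.

Lemma cutoff_width_bounds : 0 < w /\ w <= (b - a) / 2.
Proof.
have M0 := cutoff_M_gt0; have E : M * M^-1 = 1 by rewrite divff// gt_eqF.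
have := M1; have := M2; set d := b - a => Md2 Md1; rewrite /w -/d; split.
  by rewrite -(pmulr_rgt0 _ M0) mulrBr E; lra.
by rewrite -subr_ge0 -(pmulr_rge0 _ M0) 2!mulrBr E mulrA; lra.
Qed.

Lemma plateau_continuous : continuous plateau.
Proof.
have c (t : R) : continuous (fun s => ramp (s + t)).
  move=> s; apply: (continuous_comp (f := fun s => s + t) (g := ramp)).
    by apply: cvgD; [exact: cvg_id|exact: cvg_cst].
  exact: ramp_continuous.
have E s : plateau s = (ramp (s + (- a)) - ramp (s + (- a - w)) - ramp (s + (- b + w)) + ramp (s + (- b))) * w^-1.
  by rewrite /plateau !addrA.
rewrite (funext E) => s.
exact: (cvgM (cvgD (cvgB (cvgB (c _ s) (c _ s)) (c _ s)) (c _ s)) (cvg_cst _)).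
Qed.

Lemma plateau_itv s : 0 <= plateau s <= 1.
Proof.
have [w0 wd] := cutoff_width_bounds.
have H : 0 <= ramp (s - a) - ramp (s - a - w) - ramp (s - b + w) + ramp (s - b) <= w.
  rewrite /ramp; move: (w) w0 wd => v v0 vd.
  case: (leP (s - a) 0) => ?; case: (leP (s - a - v) 0) => ?;
  case: (leP (s - b + v) 0) => ?; case: (leP (s - b) 0) => ?; apply/andP; split; lra.
have /andP[H1 H2] := H; apply/andP; split; first by apply: divr_ge0 => //; exact: ltW.
by rewrite ler_pdivrMr// mul1r.
Qed.

Lemma plateau_eq0 s : s <= a \/ b <= s -> plateau s = 0.
Proof.
have [w0 wd] := cutoff_width_bounds.
move=> sab; rewrite /plateau (_ : _ + _ = 0) ?mul0r//.
rewrite /ramp; move: (w) w0 wd sab => v v0 vd sab.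
case: (leP (s - a) 0) => ?; case: (leP (s - a - v) 0) => ?;
case: (leP (s - b + v) 0) => ?; case: (leP (s - b) 0) => ?; case: sab => ?; lra.
Qed.

Lemma ramp2_shift_derive (c s : R) : is_derive s 1 (fun s => ramp2 (s + c)) (ramp (s + c)).
Proof.
have [d E] := ramp2_derive (s + c).
have E1 (x : R) : x *: 1 + c = x + c by rewrite /GRing.scale/= mulr1.
have F : (fun s : R => ramp2 (s *: 1 + c)) = fun s => ramp2 (s + c).
  by apply/funext => x; rewrite E1.
have H := @is_derive_line R R R ramp2 c 1 s.
by rewrite F E1 E in H; exact: H.
Qed.

Lemma cutoff_derive (s : R) : is_derive s 1 cutoff (- (M * plateau s)).
Proof.
have E : cutoff = (cst 1 - (M / w) *: ((fun s => ramp2 (s + (- a))) - (fun s => ramp2 (s + (- a - w)))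
   - (fun s => ramp2 (s + (- b + w))) + (fun s => ramp2 (s + (- b))))).
  by apply/funext => x; rewrite /cutoff !fctE /= !addrA.
have H := is_deriveB (is_derive_cst (1 : R) s 1) (is_deriveZ (M / w)
  (is_deriveD (is_deriveB (is_deriveB (ramp2_shift_derive (- a) s) (ramp2_shift_derive (- a - w) s))
    (ramp2_shift_derive (- b + w) s)) (ramp2_shift_derive (- b) s))).
rewrite E; apply: (is_derive_eq H).
by rewrite /plateau sub0r !addrA /GRing.scale/=; congr (- _); ring.
Qed.

Lemma cutoff_left s : s <= a -> cutoff s = 1.
Proof.
have [w0 wd] := cutoff_width_bounds.
move=> sa; rewrite /cutoff /ramp2 /ramp; move: (w) w0 wd => v v0 vd.
case: (leP (s - a) 0) => ?; case: (leP (s - a - v) 0) => ?;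
case: (leP (s - b + v) 0) => ?; case: (leP (s - b) 0) => ?; try lra.
Qed.

Lemma cutoff_right s : b <= s -> cutoff s = 0.
Proof.
have [w0 wd] := cutoff_width_bounds.
move=> sb; rewrite /cutoff /ramp2 /ramp.
have M0 := cutoff_M_gt0.
have E : M * w = M * (b - a) - 1 by rewrite mulrBr divff// gt_eqF.
have D : (M / w) * (w * ((b - a) - w)) = 1.
  have -> : M / w * (w * (b - a - w)) = M * (b - a - w) by field; rewrite gt_eqF.
  by rewrite mulrBr E; ring.
rewrite -{1}D; move: (w) w0 wd => v v0 vd.
have -> : Num.max (s - a) 0 = s - a by apply: max_l; lra.
have -> : Num.max (s - a - v) 0 = s - a - v by apply: max_l; lra.
have -> : Num.max (s - b + v) 0 = s - b + v by apply: max_l; lra.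
have -> : Num.max (s - b) 0 = s - b by apply: max_l; lra.
by field; rewrite gt_eqF.
Qed.

Lemma cutoff_nincr s t : s <= t -> cutoff t <= cutoff s.
Proof.
move=> st; have [c _ E] := @mean_value R cutoff _ s t cutoff_derive.
rewrite -subr_le0 E mulNr oppr_le0; apply: mulr_ge0; last by rewrite subr_ge0.
by apply: mulr_ge0; [exact/ltW/cutoff_M_gt0|have /andP[] := plateau_itv c].
Qed.

Lemma cutoff_itv s : 0 <= cutoff s <= 1.
Proof.
apply/andP; split.
  have [sb|bs] := leP s b; last by rewrite cutoff_right// ltW.
  by rewrite -(cutoff_right (lexx b)); exact: cutoff_nincr.
have [sa|sa] := leP s a; first by rewrite cutoff_left.
by rewrite -(cutoff_left (lexx a)); exact/cutoff_nincr/ltW.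
Qed.

End Cutoff.

End RealAnalysis.

(** * Positivity of box integrals *)

Section Positivity.
Variable R : realType.

(** The function exceeds half its value at [p] on a small box with corner [p].
    Working with the integral over R^n, of which this small box is a part,
    needs no additivity over subdivisions. *)
Lemma boxint_gt0 n (lo hi : 'rV[R]_n) (phi : 'rV[R]_n -> R) p :
  (forall i, lo 0 i < hi 0 i) -> continuous phi -> (forall p, 0 <= phi p) ->
  inbox lo hi p -> 0 < phi p -> 0 < boxint lo hi phi.
Proof.
move=> lh cphi phi0 /forallP pI pp0.
have wlh i : lo 0 i <= hi 0 i by exact: ltW.
have e0 : 0 < phi p / 2 by exact: divr_gt0.
have H0 := (cvgrPdist_le _ _).1 (cphi p) _ e0.
have [d /= d0 Hd] := (nbhs_ballP _ _).1 (H0 _).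
have [eta [eta0 etad etah]] : exists eta : R, [/\ 0 < eta, eta < d &
    forall i, eta < hi 0 i - p 0 i].
  apply: (@filter_ex _ (0 : R)^'+); near=> x; split.
  - by near: x; exact: nbhs_right_gt.
  - by near: x; exact: nbhs_right_lt.
  - near: x; apply: filter_forall => i; apply: nbhs_right_lt.
    by have /andP[_] := pI i; rewrite subr_gt0.
pose hi' : 'rV[R]_n := \row_i (p 0 i + eta).
have lh' i : p 0 i < hi' 0 i by rewrite mxE ltrDl.
have cc : continuous (fun _ : 'rV[R]_n => phi p / 2) by exact: cst_continuous.
have V0 := boxvol_gt0 lh'.
rewrite -lte_fin -integral_rV_box//.
apply: (@lt_le_trans _ _ (boxint p hi' (fun=> phi p / 2))%:E).
  rewrite lte_fin boxint_cst; first exact: mulr_gt0.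
  by move=> i; exact: ltW.
rewrite -integral_rV_box//; last by move=> i; exact: ltW.
apply: le_integral_rV => x; rewrite lee_fin; first by apply: mulr_ge0 => //; exact: ltW.
have [xI|] := boolP (inbox p hi' x); last by rewrite mul0r => _; exact: mulr_ge0.
have /forallP xI' := xI.
have -> : inbox lo hi x.
  apply/forallP => i; have := xI' i; have := pI i; have := etah i; rewrite mxE.
  move=> h1 /andP[h2 h3] /andP[h4 h5]; apply/andP; split; lra.
rewrite !mul1r; have : `|phi p - phi x| <= phi p / 2.
  apply: Hd; rewrite -ball_normE /=.
  rewrite /Num.Def.normr /= mx_normrE; apply/bigmax_ltP; split => // -[i j] _ /=.
  have := xI' j; rewrite !mxE !ord1 => /andP[h1 h2]; rewrite ler0_norm; lra.
rewrite ler_distl => /andP[h1 h2]; lra.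
Unshelve. all: by end_near. Qed.

End Positivity.

(** * Coordinates and energies on the Heisenberg group *)

Section ContinuousFun.
Variables (R : realType) (T : topologicalType).
Implicit Types f g : T -> R.

Lemma contD f g : continuous f -> continuous g -> continuous (fun x => f x + g x).
Proof. by move=> cf cg x; exact: (cvgD (cf x) (cg x)). Qed.

Lemma contB f g : continuous f -> continuous g -> continuous (fun x => f x - g x).
Proof. by move=> cf cg x; exact: (cvgB (cf x) (cg x)). Qed.

Lemma contM f g : continuous f -> continuous g -> continuous (fun x => f x * g x).
Proof. by move=> cf cg x; exact: (cvgM (cf x) (cg x)). Qed.

Lemma cont_sum (I : finType) (f : I -> T -> R) :
  (forall i, continuous (f i)) -> continuous (fun x => \sum_i f i x).
Proof.
by move=> cf x; exact: (@cvg_sum_fin _ _ _ (@nbhs_filter _ x) _ _ _ (fun i => cf i x)).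
Qed.

Lemma cont_comp (h : R -> R) f : continuous h -> continuous f -> continuous (fun x => h (f x)).
Proof. by move=> ch cf x; exact: (@cvg_comp _ _ _ f h _ _ _ (cf x) (ch (f x))). Qed.

End ContinuousFun.

Section HeisenbergCalculus.
Variables (R : realType) (m : nat).
Local Notation HH := 'rV[R]_(m + m + 1).
Local Notation dt := (d_t R m).

Definition zc (a : 'I_(m + m)) (p : HH) : R := p 0 (lshift 1 a).

(** The complex structure applied to z: X_j and Y_j become the single
    expression of [hvec]. *)
Definition Jz (a : 'I_(m + m)) (p : HH) : R :=
  match fintype.split a with
  | inl j => - p 0 (iy j)
  | inr j => p 0 (ix j)
  end.

Definition hvec (a : 'I_(m + m)) (p : HH) : HH :=
  ebase R (lshift 1 a) - (2 * Jz a p) *: dt.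

Definition normz2 (p : HH) : R := \sum_a zc a p ^+ 2.

Lemma normz2E p : normz2 p = \sum_j (p 0 (@ix m j) ^+ 2 + p 0 (iy j) ^+ 2).
Proof. by rewrite /normz2 big_split_ord big_split. Qed.

Lemma normz_le p (rho : R) : 0 <= rho -> (normz p <= rho) = (normz2 p <= rho ^+ 2).
Proof.
move=> r0; rewrite normz2E /normz -[in LHS](ger0_norm r0) -sqrtr_sqr ler_sqrt//.
exact: sqr_ge0.
Qed.

Lemma Jz_lshift j (p : HH) : Jz (lshift m j) p = - p 0 (iy j).
Proof. by rewrite /Jz (unsplitK (inl j) : fintype.split (lshift m j) = _). Qed.

Lemma Jz_rshift j (p : HH) : Jz (rshift m j) p = p 0 (ix j).
Proof. by rewrite /Jz (unsplitK (inr j) : fintype.split (rshift m j) = _). Qed.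

Lemma sum_Jz2 p : \sum_a Jz a p ^+ 2 = normz2 p.
Proof.
rewrite normz2E big_split_ord /= -big_split; apply: eq_bigr => j _.
by rewrite Jz_lshift Jz_rshift sqrrN addrC.
Qed.

Lemma zc_dt a c p : zc a (c *: dt + p) = zc a p.
Proof. by rewrite /zc !mxE eq_lrshift andbF mulr0 add0r. Qed.

Lemma Jz_dt a c p : Jz a (c *: dt + p) = Jz a p.
Proof.
rewrite /Jz; case: (fintype.split a) => j; rewrite !mxE eq_lrshift andbF mulr0 add0r//.
Qed.

Lemma normz2_dt c p : normz2 (c *: dt + p) = normz2 p.
Proof. by apply: eq_bigr => a _; rewrite zc_dt. Qed.

Lemma hvec_dt a c p : hvec a (c *: dt + p) = hvec a p.
Proof. by rewrite /hvec Jz_dt. Qed.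


Lemma quoK_dt (k : int) p : quoK (k%:~R *: dt + p) = quoK p :> Km R m.
Proof.
apply/esym/eqquotP/asboolP; exists k; by rewrite addrC.
Qed.

Lemma quoK_eq p p' : quoK p = quoK p' :> Km R m -> exists k : int, p' = k%:~R *: dt + p.
Proof. by move=> /eqquotP/asboolP[k ->]; exists k; rewrite addrC. Qed.

Lemma DrhoE (rho : R) p : 0 <= rho -> @Drho R m rho (quoK p) <-> normz2 p <= rho ^+ 2.
Proof.
move=> r0; rewrite -normz_le//; split=> [[p' /= Hp' E]|H]; last by exists p.
have [k pE] := quoK_eq E.
move: Hp'; rewrite !normz_le// => Hp'.
by rewrite pE normz2_dt.
Qed.

(** The rows are dx^j, dy^j and eta, an orthonormal coframe; it is block
    triangular, and its determinant gives the volume form. *)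
Definition coframe (p : HH) : 'M[R]_(m + m + 1) := col_mx (row_mx 1%:M 0) (Defs.eta p).

Lemma eta_ix j (p : HH) : Defs.eta p 0 (@ix m j) = - p 0 (iy j).
Proof.
rewrite /Defs.eta !mxE eq_lrshift andbF mulr0 add0r summxE (bigD1 j)//= big1 => [|k kj].
  by rewrite !mxE ?eq_shift ?eqxx /= !mulr0 !mulr1 sub0r addr0.
by rewrite !mxE ?eq_shift eq_sym (negbTE kj) andbF /= !mulr0 subr0.
Qed.

Lemma eta_iy j (p : HH) : Defs.eta p 0 (@iy m j) = p 0 (ix j).
Proof.
rewrite /Defs.eta !mxE eq_lrshift andbF mulr0 add0r summxE (bigD1 j)//= big1 => [|k kj].
  by rewrite !mxE ?eq_shift ?eqxx /= !mulr0 !mulr1 subr0 addr0.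
by rewrite !mxE ?eq_shift eq_sym (negbTE kj) andbF /= !mulr0 subr0.
Qed.

Lemma eta_it (p : HH) : Defs.eta p 0 (it m) = 2^-1.
Proof.
rewrite /Defs.eta !mxE !eqxx mulr1 summxE big1 ?addr0// => k _.
by rewrite !mxE ?eq_shift !andbF !mulr0 subr0.
Qed.

Lemma eta_hor a (p : HH) : Defs.eta p 0 (lshift 1 a) = Jz a p.
Proof.
by case: (split_ordP a) => j ->; [rewrite eta_ix Jz_lshift|rewrite eta_iy Jz_rshift].
Qed.

Lemma gK_coframe (p : HH) : gK p = (coframe p)^T *m coframe p.
Proof.
rewrite /coframe tr_col_mx mul_row_col; congr (_ + _).
transitivity (\sum_(a < m + m) (ebase R (lshift 1 a))^T *m ebase R (lshift 1 a)).
  by rewrite big_split_ord /= -big_split.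
apply/matrixP => i k; rewrite summxE !mxE; apply: eq_bigr => a _.
rewrite !mxE big_ord_recl big_ord0 !mxE addr0 /=.
by congr (_ * _); [case: (split_ordP i)|case: (split_ordP k)] => l ->;
  rewrite ?row_mxEl ?row_mxEr !mxE ?eq_lshift ?eq_rlshift // eq_sym.
Qed.

Lemma det_gK (p : HH) : \det (gK p) = 2^-1 ^+ 2.
Proof.
rewrite gK_coframe det_mulmx det_tr -expr2; congr (_ ^+ 2).
rewrite /coframe -[Defs.eta p]hsubmxK -/(block_mx _ _ _ _) det_lblock det1 mul1r det_mx11.
by rewrite mxE -(eta_it p); congr (Defs.eta p 0 _); apply: val_inj.
Qed.

Lemma dVE p : Num.sqrt (\det (gK (p : HH))) = 2^-1.
Proof. by rewrite det_gK sqrtr_sqr ger0_norm. Qed.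

(** The integral underlying [integralK] before truncation to a real number,
    for which monotonicity holds without finiteness conditions. *)
Definition ext_energy (rho : R) (g : HH -> R) : \bar R :=
  integral_rV (fun p => (\1_[set p' | @Drho R m rho (quoK p') /\ 0 <= p' 0 (it m) < 1] p *
     (g p * Num.sqrt (\det (gK p))))%:E).

Lemma ext_energyE rho g : 0 <= rho -> ext_energy rho g = integral_rV (fun p =>
  (((normz2 p <= rho ^+ 2) && (0 <= p 0 (it m) < 1))%:R * (g p * 2^-1))%:E).
Proof.
move=> r0; apply: eq_integral_rV => p; rewrite dVE indicE; congr ((_%:R * _)%:E).
congr nat_of_bool; apply/idP/idP.
  by rewrite inE /= => -[/(DrhoE _ r0) -> ->].
by move=> /andP[H pt]; rewrite inE /=; split => //; apply/(DrhoE _ r0).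
Qed.

(** Lower corner of the box [-r0, r0]^(2m) x [0, 1], which contains a
    fundamental domain of the cylinder |z| < r0. *)
Definition blo (r0 : R) : HH := row_mx (const_mx (- r0)) 0.
Definition bhi (r0 : R) : HH := row_mx (const_mx r0) (const_mx 1).

Lemma blo_z r0 a : blo r0 0 (lshift 1 a) = - r0. Proof. by rewrite row_mxEl mxE. Qed.
Lemma bhi_z r0 a : bhi r0 0 (lshift 1 a) = r0. Proof. by rewrite row_mxEl mxE. Qed.
Lemma blo_t r0 k : blo r0 0 (rshift (m + m) k) = 0. Proof. by rewrite row_mxEr mxE. Qed.
Lemma bhi_t r0 k : bhi r0 0 (rshift (m + m) k) = 1. Proof. by rewrite row_mxEr mxE. Qed.

Lemma box_lt r0 : 0 < r0 -> forall i, blo r0 0 i < bhi r0 0 i.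
Proof.
move=> r00 i; case: (split_ordP i) => k ->; first by rewrite blo_z bhi_z; lra.
by rewrite blo_t bhi_t.
Qed.

Lemma box_le r0 : 0 < r0 -> forall i, blo r0 0 i <= bhi r0 0 i.
Proof. by move=> r00 i; exact/ltW/box_lt. Qed.

Lemma inboxE r0 p : inbox (blo r0) (bhi r0) p =
  [forall a, - r0 <= zc a p < r0] && (0 <= p 0 (it m) < 1).
Proof.
apply/forallP/andP => [H|[/forallP Hz Ht] i].
  split; last by have := H (it m); rewrite blo_t bhi_t.
  by apply/forallP => a; have := H (lshift 1 a); rewrite blo_z bhi_z.
case: (split_ordP i) => k ->; first by rewrite blo_z bhi_z; exact: Hz.
by rewrite blo_t bhi_t ord1.
Qed.

Lemma normz2_inbox r0 p : normz2 p < r0 ^+ 2 -> 0 < r0 -> [forall a, - r0 <= zc a p < r0].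
Proof.
move=> H r00; apply/forallP => a.
have : zc a p ^+ 2 < r0 ^+ 2.
  apply: le_lt_trans H; rewrite /normz2 (bigD1 a)//= lerDl.
  by apply: sumr_ge0 => b _; exact: sqr_ge0.
rewrite -(real_normK (num_real (zc a p))) ltr_pXn2r ?nnegrE ?(ltW r00)//.
by rewrite ltr_norml => /andP[/ltW -> ->].
Qed.

Lemma zc_continuous a : continuous (zc a).
Proof. by move=> p; exact: coord_continuous. Qed.

Lemma normz2_continuous : continuous normz2.
Proof.
apply: cont_sum => a; under eq_fun do rewrite expr2.
exact: contM (@zc_continuous a) (@zc_continuous a).
Qed.

Section Energy.
Variables (g : HH -> R) (r0 : R).
Hypotheses (cg : continuous g) (g0 : forall p, 0 <= g p) (r00 : 0 < r0).
Local Notation J := (boxint (blo r0) (bhi r0)).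

Lemma cutoff_continuous (chi : R -> R) : continuous chi ->
  continuous (fun p => chi (normz2 p) * (g p * 2^-1)).
Proof.
move=> cchi; apply: contM; first exact: cont_comp cchi normz2_continuous.
by apply: contM => //; exact: cst_continuous.
Qed.

Lemma half_ge0 p : 0 <= g p * 2^-1. Proof. by rewrite divr_ge0. Qed.

Lemma boxint_le_energy (chi : R -> R) rho : continuous chi -> 0 <= rho ->
  (forall s, 0 <= chi s <= 1) -> (forall s, rho ^+ 2 <= s -> chi s = 0) ->
  ((J (fun p => chi (normz2 p) * (g p * 2^-1)))%:E <= ext_energy rho g)%E.
Proof.
move=> cchi rho0 chi01 chi0; rewrite ext_energyE// -integral_rV_box.
- apply: le_integral_rV => p; rewrite lee_fin.
    by apply: mulr_ge0 => //; apply: mulr_ge0 => //; [have /andP[] := chi01 (normz2 p)|exact: half_ge0].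
  have [Hp|Hp] := leP (normz2 p) (rho ^+ 2); last first.
    rewrite chi0; last exact: ltW.
    by rewrite !(mul0r, mulr0).
  rewrite inboxE /=; case: (0 <= p 0 (it m) < 1); last by rewrite andbF !mul0r.
  rewrite andbT mul1r; apply: (@le_trans _ _ (1 * (g p * 2^-1))); last by rewrite mul1r.
  rewrite mulrA; apply: ler_wpM2r; first exact: half_ge0.
  have /andP[c0 c1] := chi01 (normz2 p).
  by case: [forall a, _]; rewrite ?mul1r ?mul0r.
- exact: box_le.
- exact: cutoff_continuous.
Qed.

Lemma energy_le_boxint (chi : R -> R) rho : continuous chi -> 0 <= rho -> rho < r0 ->
  (forall s, 0 <= chi s) -> (forall s, s <= rho ^+ 2 -> chi s = 1) ->
  (ext_energy rho g <= (J (fun p => chi (normz2 p) * (g p * 2^-1)))%:E)%E.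
Proof.
move=> cchi rho0 rhor chi0 chi1; rewrite ext_energyE// -integral_rV_box.
- apply: le_integral_rV => p; rewrite lee_fin.
    by apply: mulr_ge0 => //; exact: half_ge0.
  rewrite inboxE; have [Hp|Hp] := leP (normz2 p) (rho ^+ 2); last first.
    by rewrite /= mul0r; apply: mulr_ge0 => //; apply: mulr_ge0 => //; exact: half_ge0.
  rewrite chi1//= mul1r normz2_inbox//=.
  by apply: le_lt_trans Hp _; rewrite ltr_pXn2r ?nnegrE// ltW.
- exact: box_le.
- exact: cutoff_continuous.
Qed.

(** The function [tau] of |z|^2 lives on the shell between the two cylinders,
    so the sum of the two integrands is below that of the larger cylinder.
    This replaces additivity of the integral over the shell. *)
Lemma energy_superadd (tau : R -> R) rho1 rho2 : continuous tau -> 0 <= rho1 -> rho1 <= rho2 ->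
  (forall s, 0 <= tau s <= 1) ->
  (forall s, s <= rho1 ^+ 2 \/ rho2 ^+ 2 <= s -> tau s = 0) ->
  (ext_energy rho1 g + (J (fun p => tau (normz2 p) * (g p * 2^-1)))%:E <= ext_energy rho2 g)%E.
Proof.
move=> ctau rho10 rho12 tau01 tau0; have rho20 : 0 <= rho2 by exact: le_trans rho12.
rewrite !ext_energyE// -integral_rV_box; [|exact: box_le|exact: cutoff_continuous].
have F1 p : 0 <= ((normz2 p <= rho1 ^+ 2) && (0 <= p 0 (it m) < 1))%:R * (g p * 2^-1).
  by apply: mulr_ge0 => //; exact: half_ge0.
have F2 p : 0 <= (inbox (blo r0) (bhi r0) p)%:R * (tau (normz2 p) * (g p * 2^-1)).
  by apply: mulr_ge0 => //; apply: mulr_ge0 => //; [have /andP[] := tau01 (normz2 p)|exact: half_ge0].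
apply: le_trans (integral_rV_superadd _ _) _ => [p|p|].
- by rewrite lee_fin.
- by rewrite lee_fin.
apply: le_integral_rV => p; first by rewrite -EFinD lee_fin; exact: addr_ge0.
rewrite -EFinD lee_fin inboxE; have /andP[t0 t1] := tau01 (normz2 p).
have hp := half_ge0 p.
have tg : tau (normz2 p) * (g p * 2^-1) <= g p * 2^-1 by rewrite ler_piMl.
have [H1|H1] := leP (normz2 p) (rho1 ^+ 2).
  rewrite (tau0 (normz2 p)); last by left.
  rewrite mul0r mulr0 addr0 (le_trans H1)//.
  by rewrite ler_pXn2r ?nnegrE.
rewrite /= mul0r add0r; have [H2|H2] := leP (normz2 p) (rho2 ^+ 2); last first.
  by rewrite (tau0 (normz2 p)) ?mul0r ?mulr0//; right; exact: ltW.
case: (0 <= p 0 (it m) < 1); last by rewrite andbF !mul0r.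
rewrite /= andbT mul1r; case: [forall a, _]; first by rewrite mul1r.
by rewrite mul0r.
Qed.

(** A continuous function is integrable over the box containing the cylinder. *)
Lemma ext_energy_fin rho : 0 <= rho -> rho < r0 -> ext_energy rho g \is a fin_num.
Proof.
move=> rho0 rhor; rewrite ge0_fin_numE; last first.
  by rewrite ext_energyE//; apply: integral_rV_ge0 => p; rewrite lee_fin;
    apply: mulr_ge0 => //; exact: half_ge0.
apply: le_lt_trans (energy_le_boxint (chi := fun=> 1) _ rho0 rhor _ _) _ => //.
  exact: cst_continuous.
exact: ltry.
Qed.

End Energy.

Lemma integralKE rho g : integralK (@Drho R m rho) g = fine (ext_energy rho g).
Proof. by []. Qed.

End HeisenbergCalculus.

(** * The monotonicity inequality *)

Section DeriveFun.
Variables (R : realType) (V : normedModType R).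
Implicit Types f g : V -> R.

Lemma derive_mulf f g x v : differentiable f x -> differentiable g x ->
  'D_v (fun y => f y * g y) x = f x * 'D_v g x + g x * 'D_v f x.
Proof.
move=> df dg.
have -> : (fun y => f y * g y) = f * g by [].
by rewrite deriveM//; exact: diff_derivable.
Qed.

Lemma derive_subf f g x v : differentiable f x -> differentiable g x ->
  'D_v (fun y => f y - g y) x = 'D_v f x - 'D_v g x.
Proof. by move=> df dg; rewrite -deriveB//; exact: diff_derivable. Qed.

Lemma derive_sumf n (f : 'I_n -> V -> R) x v : (forall i, differentiable (f i) x) ->
  'D_v (fun y => \sum_i f i y) x = \sum_i 'D_v (f i) x.
Proof.
move=> df; have -> : (fun y => \sum_i f i y) = \sum_i f i by apply/funext => y; rewrite fct_sumE.
by rewrite derive_sum// => i; exact: diff_derivable.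
Qed.

Lemma derive_compf (h : R -> R) (dh : R) f x v : is_derive (f x) 1 h dh -> differentiable f x ->
  'D_v (fun y => h (f y)) x = dh * 'D_v f x.
Proof.
move=> [dhx Eh] df; have Dh : differentiable h (f x) by exact/derivable1_diffP.
rewrite deriveE; last exact: differentiable_comp.
rewrite (diff_comp df Dh) /= (deriv1E dhx) derive1E Eh deriveE//.
by rewrite /GRing.scale/= mulrC.
Qed.

Lemma C1_compf (h h' : R -> R) f : (forall s : R, is_derive s 1 h (h' s)) -> continuous h' ->
  Ck_on 1 setT f -> Ck_on 1 setT (fun x => h (f x)).
Proof.
move=> dh ch' [df Cf].
have cf x : {for x, continuous f} by exact: (C1_continuous (conj df Cf)).
apply: (@C1_intro _ _ _ _ _ (fun v x => h' (f x) * 'D_v f x)).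
- exact: openT.
- move=> x _; apply: differentiable_comp; first exact: df.
  by apply/derivable1_diffP; have [] := dh (f x).
- by move=> v x _; apply: derive_compf => //; exact: df.
- move=> v x _; have c1 : h' (f y) @[y --> x] --> h' (f x).
    exact: (@cvg_comp _ _ _ f h' _ _ _ (cf x) (ch' (f x))).
  exact: (cvgM c1 (Cf v x I)).
Qed.

End DeriveFun.

Section Coordinates.
Variables (R : realType) (n : nat).

Lemma differentiable_rV (i : 'I_n) (x : 'rV[R]_n) : differentiable (fun p : 'rV[R]_n => p 0 i) x.
Proof. exact: differentiable_coord. Qed.

Lemma derive_rV (i : 'I_n) (x v : 'rV[R]_n) : 'D_v (fun p : 'rV[R]_n => p 0 i) x = v 0 i.
Proof.
have dx : differentiable (fun p : 'rV[R]_n => p) x by exact: (@ex_diff _ _ _ _ _ _ _ (is_diff_id x)).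
have H := derive_entry v 0 i dx.
have E : 'D_v (fun p : 'rV[R]_n => p) x = v by exact: derive_id.
by rewrite H E.
Qed.

Lemma C1_rV (i : 'I_n) : Ck_on 1 setT (fun p : 'rV[R]_n => p 0 i).
Proof.
apply: (@C1_intro R 'rV[R]_n R setT (fun p => p 0 i) (fun (v _ : 'rV[R]_n) => v 0 i)).
- exact: openT.
- by move=> x _; exact: differentiable_rV.
- by move=> v x _; exact: derive_rV.
- by move=> v x _; exact: cst_continuous.
Qed.

End Coordinates.

Section BoxSum.
Variables (R : realType) (n : nat) (lo hi : 'rV[R]_n).
Hypothesis lh : forall i, lo 0 i <= hi 0 i.

Lemma boxint_sum k (f : 'I_k -> 'rV[R]_n -> R) : (forall i, continuous (f i)) ->
  boxint lo hi (fun p => \sum_i f i p) = \sum_i boxint lo hi (f i).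
Proof.
elim: k f => [|k IH] f cf.
  rewrite big_ord0; transitivity (boxint lo hi (fun=> 0)); last exact: boxint0.
  by apply: eq_boxint => p; rewrite big_ord0.
have cl : continuous (fun p => \sum_(i < k) f (lift ord0 i) p).
  by apply: cont_sum => i; exact: cf.
rewrite big_ord_recl -(IH _ (fun i => cf (lift ord0 i))) -(boxintD lh (cf ord0) cl).
by apply: eq_boxint => p; rewrite big_ord_recl.
Qed.

End BoxSum.

Section Core.
Variables (R : realType) (m : nat).
Local Notation HH := 'rV[R]_(m + m + 1).
Local Notation dt := (d_t R m).
(* The integral estimates use only these properties of the components s, w, W
   of the transverse metric pulled back to H_m. *)
Variables (s : 'I_(m + m) -> 'I_(m + m) -> HH -> R).
Variables (w : 'I_(m + m) -> HH -> R) (W : HH -> R).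
Hypothesis C1s : forall a b, Ck_on 1 setT (s a b).
Hypothesis cW : continuous W.
Hypothesis s_per : forall a b (k : int) p, s a b (k%:~R *: dt + p) = s a b p.
Hypothesis psd : forall (c : 'I_(m + m) -> R) (l : R) p,
  0 <= \sum_a \sum_b c a * c b * s a b p + 2 * l * (\sum_a c a * w a p) + l ^+ 2 * W p.
Hypothesis psd2 : forall a b (x y : R) p,
  x * y * (s a b p + s b a p) <= x ^+ 2 * s b b p + y ^+ 2 * s a a p.
Hypothesis conservation : forall p,
  \sum_b zc b p * (\sum_a 'D_(hvec a p) (s b a) p - 2^-1 * \sum_a 'D_(hvec b p) (s a a) p)
  = 2 * \sum_a Jz a p * w a p.

Definition density (p : HH) : R := \sum_a s a a p.
(** The term through which the derivative of the map along T enters the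
    divergence of [stress]. *)
Definition coupling (p : HH) : R := 2 * \sum_a Jz a p * w a p.
(** The squared transverse length of the derivative along the radial field
    sum_a z_a e_a. *)
Definition radial (p : HH) : R := \sum_a \sum_b zc a p * zc b p * s b a p.
(** The horizontal stress-energy tensor contracted with the position field
    sum_b z_b e_b. *)
Definition stress a (p : HH) : R := \sum_b zc b p * s b a p - 2^-1 * (zc a p * density p).

Lemma s_diag_ge0 a p : 0 <= s a a p.
Proof. by have := psd2 a a 0 1 p; rewrite !mul0r expr0n /= mul0r add0r expr1n mul1r. Qed.

Lemma density_ge0 p : 0 <= density p.
Proof. by apply: sumr_ge0 => a _; exact: s_diag_ge0. Qed.

Lemma W_ge0 p : 0 <= W p.
Proof.
have := psd (fun=> 0) 1 p; rewrite big1 ?add0r => [|a _]; last by rewrite big1// => b _; rewrite !mul0r.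
by rewrite big1 ?mulr0 ?add0r ?expr1n ?mul1r// => a _; rewrite mul0r.
Qed.

Lemma quad_ge0 (c : 'I_(m + m) -> R) p : 0 <= \sum_a \sum_b c a * c b * s a b p.
Proof. by have := psd c 0 p; rewrite mulr0 mul0r addr0 expr0n /= mul0r addr0. Qed.

Lemma radial_ge0 p : 0 <= radial p.
Proof.
rewrite /radial exchange_big /=; have := quad_ge0 (fun a => zc a p) p.
by congr (0 <= _); apply: eq_bigr => a _; apply: eq_bigr => b _; rewrite (mulrC (zc b p)).
Qed.

(** A positive semidefinite quadratic form is bounded by its trace. *)
Lemma quad_le (c : 'I_(m + m) -> R) p :
  \sum_a \sum_b c a * c b * s a b p <= (\sum_a c a ^+ 2) * density p.
Proof.
have H : \sum_a \sum_b c a * c b * (s a b p + s b a p) <=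
    \sum_a \sum_b (c a ^+ 2 * s b b p + c b ^+ 2 * s a a p).
  by apply: ler_sum => a _; apply: ler_sum => b _; exact: psd2.
have E1 : \sum_a \sum_b c a * c b * (s a b p + s b a p) = 2 * \sum_a \sum_b c a * c b * s a b p.
  rewrite mulr_natl mulr2n.
  have -> : \sum_a \sum_b c a * c b * (s a b p + s b a p) =
      \sum_a \sum_b c a * c b * s a b p + \sum_a \sum_b c b * c a * s b a p.
    rewrite -big_split; apply: eq_bigr => a _ /=.
    by rewrite -big_split; apply: eq_bigr => b _ /=; ring.
  by congr (_ + _); rewrite exchange_big.
have E2 : \sum_a \sum_b (c a ^+ 2 * s b b p + c b ^+ 2 * s a a p) = 2 * ((\sum_a c a ^+ 2) * density p).
  rewrite mulr_natl mulr2n.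
  have -> : \sum_a \sum_b (c a ^+ 2 * s b b p + c b ^+ 2 * s a a p) =
      \sum_a \sum_b c a ^+ 2 * s b b p + \sum_a \sum_b c b ^+ 2 * s a a p.
    by rewrite -big_split; apply: eq_bigr => a _ /=; rewrite -big_split.
  rewrite [X in _ + X]exchange_big /= /density mulr_suml.
  by congr (_ + _); apply: eq_bigr => a _; rewrite mulr_sumr.
by move: H; rewrite E1 E2 ler_pM2l.
Qed.

(** Positivity of the quadratic form of H on l f_T - sum_a (Jz)_a f_a,
    together with |Jz| = |z|. *)
Lemma coupling_le (l : R) p : 0 < l ->
  coupling p <= l * W p + l^-1 * (normz2 p * density p).
Proof.
move=> l0; have := psd (fun a => - Jz a p) l p.
have -> : \sum_a \sum_b - Jz a p * - Jz b p * s a b p = \sum_a \sum_b Jz a p * Jz b p * s a b p.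
  by apply: eq_bigr => a _; apply: eq_bigr => b _; rewrite mulrNN.
have -> : \sum_a - Jz a p * w a p = - \sum_a Jz a p * w a p.
  by rewrite -sumrN; apply: eq_bigr => a _; rewrite mulNr.
have := quad_le (fun a => Jz a p) p; rewrite sum_Jz2 => H1 H2.
rewrite -(ler_pM2l l0) mulrDr !mulrA divff ?gt_eqF// mul1r /coupling.
set X := \sum_a Jz a p * w a p in H2 *; set Y := normz2 p * density p in H1 *.
nra.
Qed.

Lemma C1_continuousT (f : HH -> R) : Ck_on 1 setT f -> continuous f.
Proof. by move=> Cf x; exact: (C1_continuous Cf). Qed.

Lemma C1_diff (f : HH -> R) p : Ck_on 1 setT f -> differentiable f p.
Proof. by move=> [df _]; exact: df. Qed.

Lemma C1_derive_cont (f : HH -> R) v : Ck_on 1 setT f -> continuous ('D_v f).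
Proof. by move=> [_ Cf] x; exact: Cf. Qed.

Lemma C1_zc a : Ck_on 1 setT (@zc R m a). Proof. exact: C1_rV. Qed.

Lemma C1_density : Ck_on 1 setT density.
Proof. by apply: (C1_sum (@openT HH)) => a _; exact: C1s. Qed.

Lemma C1Z (c : R) (f : HH -> R) : Ck_on 1 setT f -> Ck_on 1 setT (fun p => c * f p).
Proof. by move=> Cf; apply: (C1M (@openT HH) (C1_cst _ _) Cf). Qed.

Lemma C1B (f g : HH -> R) : Ck_on 1 setT f -> Ck_on 1 setT g -> Ck_on 1 setT (fun p => f p - g p).
Proof.
move=> Cf Cg; have -> : (fun p => f p - g p) = fun p => f p + -1 * g p.
  by apply/funext => p; rewrite mulN1r.
exact: (C1D (@openT HH) Cf (C1Z (-1) Cg)).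
Qed.

Lemma C1_zs a b c : Ck_on 1 setT (fun p => zc c p * s b a p).
Proof. exact: (C1M (@openT HH) (C1_zc c) (C1s b a)). Qed.

Lemma C1_zd a : Ck_on 1 setT (fun p => zc a p * density p).
Proof. exact: (C1M (@openT HH) (C1_zc a) C1_density). Qed.

Lemma C1_stress a : Ck_on 1 setT (stress a).
Proof.
apply: C1B; last exact/C1Z/C1_zd.
by apply: (C1_sum (@openT HH)) => b _; exact: C1_zs.
Qed.

Lemma C1_normz2 : Ck_on 1 setT (@normz2 R m).
Proof.
apply: (C1_sum (@openT HH)) => a _.
have -> : (fun p : HH => zc a p ^+ 2) = (fun p => zc a p * zc a p).
  by apply/funext => p; rewrite expr2.
exact: (C1M (@openT HH) (C1_zc a) (C1_zc a)).
Qed.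

Lemma hvec_z a b (p : HH) : hvec a p 0 (lshift 1 b) = (a == b)%:R.
Proof. by rewrite !mxE eq_lrshift andbF mulr0 subr0 eqxx /= eq_lshift eq_sym. Qed.

Lemma derive_zc a (v p : HH) : 'D_v (@zc R m a) p = v 0 (lshift 1 a).
Proof. exact: derive_rV. Qed.

Lemma derive_normz2 a (p : HH) : 'D_(hvec a p) (@normz2 R m) p = 2 * zc a p.
Proof.
have -> : @normz2 R m = fun p => \sum_b zc b p * zc b p.
  by apply/funext => q; apply: eq_bigr => b _; rewrite expr2.
rewrite derive_sumf => [|b]; last first.
  exact: (C1_diff _ (C1M (@openT HH) (C1_zc b) (C1_zc b))).
rewrite (bigD1 a)//= big1 ?addr0 => [|b ba].
  by rewrite derive_mulf; [|exact: C1_diff (C1_zc a)|exact: C1_diff (C1_zc a)];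
    rewrite derive_zc hvec_z eqxx !mulr1 mulr_natl.
rewrite derive_mulf; [|exact: C1_diff (C1_zc b)|exact: C1_diff (C1_zc b)].
by rewrite derive_zc hvec_z eq_sym (negbTE ba) !mulr0 addr0.
Qed.

Lemma derive_stress a p : 'D_(hvec a p) (stress a) p =
  s a a p + \sum_b zc b p * 'D_(hvec a p) (s b a) p
  - 2^-1 * (zc a p * \sum_b 'D_(hvec a p) (s b b) p + density p).
Proof.
have dS : differentiable (fun p => \sum_b zc b p * s b a p) p.
  by apply: C1_diff; apply: (C1_sum (@openT HH)) => b _; exact: C1_zs.
rewrite /stress derive_subf//; last exact/C1_diff/C1Z/C1_zd.
congr (_ - _).
  rewrite derive_sumf => [|b]; last exact/C1_diff/C1_zs.
  have E b : 'D_(hvec a p) (fun y => zc b y * s b a y) p =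
      zc b p * 'D_(hvec a p) (s b a) p + s b a p * (a == b)%:R.
    by rewrite derive_mulf; [rewrite derive_zc hvec_z|exact/C1_diff/C1_zc|exact/C1_diff/C1s].
  rewrite (eq_bigr _ (fun b _ => E b)) big_split /= addrC; congr (_ + _).
  rewrite (bigD1 a)//= eqxx mulr1 big1 ?addr0// => b ba.
  by rewrite eq_sym (negbTE ba) mulr0.
rewrite derive_mulf; [|exact: differentiable_cst|exact/C1_diff/C1_zd].
rewrite derive_cst mulr0 addr0; congr (_ * _).
rewrite derive_mulf; [|exact/C1_diff/C1_zc|exact/C1_diff/C1_density].
rewrite derive_zc hvec_z eqxx mulr1; congr (_ * _ + _).
by rewrite derive_sumf// => b; exact/C1_diff/C1s.
Qed.

(** Apart from the terms in [conservation], differentiating the coordinates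
    gives sum_a s_aa - (2 m / 2) density, since e_a(z_b) is the Kronecker
    symbol. *)
Lemma div_stress p : \sum_a 'D_(hvec a p) (stress a) p = (1 - m%:R) * density p + coupling p.
Proof.
rewrite /coupling -conservation.
under eq_bigr do rewrite derive_stress.
rewrite sumrB big_split /= -/(density p).
rewrite exchange_big /= -mulr_sumr big_split /= sumr_const card_ord.
have -> : \sum_b zc b p * (\sum_a 'D_(hvec a p) (s b a) p - 2^-1 * \sum_a 'D_(hvec b p) (s a a) p)
   = \sum_b \sum_a zc b p * 'D_(hvec a p) (s b a) p
     - 2^-1 * \sum_b zc b p * \sum_a 'D_(hvec b p) (s a a) p.
  rewrite mulr_sumr -sumrB; apply: eq_bigr => b _.
  by rewrite mulrBr mulr_sumr mulrCA.
have -> : density p *+ (m + m) = 2 * (m%:R * density p).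
  by rewrite mulr_natl mulr2n mulr_natl mulrnDr.
by field.
Qed.

Section Cut.
Variables (a b M r0 : R).
Hypotheses (ab : a < b) (M1 : 1 < M * (b - a)) (M2 : M * (b - a) <= 2).
Hypotheses (r00 : 0 < r0) (br0 : b <= r0 ^+ 2).
Local Notation chi := (cutoff a b M).
Local Notation tau := (plateau a b M).
Local Notation J := (boxint (blo m r0) (bhi m r0)).

Definition flux i (p : HH) : R := chi (normz2 p) * stress i p.

Lemma C1_cut : Ck_on 1 setT (fun p : HH => chi (normz2 p)).
Proof.
apply: (C1_compf (h' := fun x => - (M * tau x))); last exact: C1_normz2.
  by move=> x; exact: cutoff_derive.
move=> x; apply: (cvgN (cvgM (cvg_cst M) _)); exact: plateau_continuous.
Qed.

Lemma C1_flux i : Ck_on 1 setT (flux i).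
Proof. exact: (C1M (@openT HH) C1_cut (C1_stress i)). Qed.

Lemma derive_flux i p : 'D_(hvec i p) (flux i) p =
  chi (normz2 p) * 'D_(hvec i p) (stress i) p
  - 2 * M * tau (normz2 p) * (zc i p * stress i p).
Proof.
rewrite /flux derive_mulf; [|exact/C1_diff/C1_cut|exact/C1_diff/C1_stress].
rewrite (@derive_compf R HH chi _ (@normz2 R m) p (hvec i p)
  (cutoff_derive a b M (normz2 p)) (C1_diff p C1_normz2)).
by rewrite derive_normz2; ring.
Qed.

Lemma density_per (k : int) p : density (k%:~R *: dt + p) = density p.
Proof. by apply: eq_bigr => i _; rewrite s_per. Qed.

Lemma stress_per i (k : int) p : stress i (k%:~R *: dt + p) = stress i p.
Proof.
rewrite /stress density_per zc_dt; congr (_ - _).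
by apply: eq_bigr => j _; rewrite zc_dt s_per.
Qed.

Lemma derive_hvec (f : HH -> R) i p : differentiable f p ->
  'D_(hvec i p) f p = 'D_(ebase R (lshift 1 i)) f p - 2 * Jz i p * 'D_dt f p.
Proof.
move=> df; have := derive_lin 1 (- (2 * Jz i p)) (ebase R (lshift 1 i)) dt df.
by rewrite scale1r scaleNr scale1r => ->; rewrite scaleNr.
Qed.

Lemma Jz_continuous i : continuous (@Jz R m i).
Proof.
case: (split_ordP i) => j ->.
  by rewrite (funext (@Jz_lshift R m j)) => p; apply: (cvgN (@coord_continuous R 1 _ 0 (iy j) p)).
by rewrite (funext (@Jz_rshift R m j)) => p; exact: (@coord_continuous R 1 _ 0 (ix j) p).
Qed.

(** In coordinates e_a = d_a - 2 (Jz)_a d_t with (Jz)_a independent of t, so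
    each of the two pieces is a coordinate derivative. The first vanishes
    since the cutoff is 0 on the lateral faces, the second by periodicity in
    t. *)
Lemma flux_int0 i : J (fun p => 'D_(hvec i p) (flux i) p) = 0.
Proof.
have Cf := C1_flux i.
have df p : differentiable (flux i) p by exact: C1_diff.
have c1 : continuous ('D_(ebase R (lshift 1 i)) (flux i)) by exact: C1_derive_cont.
have c2 : continuous (fun p => 2 * Jz i p * 'D_dt (flux i) p).
  apply: contM; last exact: C1_derive_cont.
  by apply: contM; [exact: cst_continuous|exact: Jz_continuous].
have lh := box_lt (m := m) r00.
have lh' := box_le (m := m) r00.
have -> : J (fun p => 'D_(hvec i p) (flux i) p) =
    J ('D_(ebase R (lshift 1 i)) (flux i)) - J (fun p => 2 * Jz i p * 'D_dt (flux i) p).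
  by rewrite -boxintB//; apply: eq_boxint => p; rewrite derive_hvec.
have -> : J ('D_(ebase R (lshift 1 i)) (flux i)) = 0.
  apply: (boxint_derive0 (j := lshift 1 i) (phi := flux i)) => //.
  - exact: C1_continuousT.
  - by move=> p; apply/derivableP/diff_derivable.
  move=> p; rewrite blo_z bhi_z => pz.
  have far (q : HH) : q 0 (lshift 1 i) ^+ 2 = r0 ^+ 2 -> flux i q = 0.
    move=> q2; rewrite /flux cutoff_right ?mul0r//; apply: le_trans br0 _.
    rewrite -q2 /normz2 (bigD1 i)//= /zc lerDl.
    by apply: sumr_ge0 => j _; exact: sqr_ge0.
  rewrite (far p) ?pz ?sqrrN// far// !mxE !eqxx pz mulr1; ring.
rewrite sub0r; apply/eqP; rewrite oppr_eq0; apply/eqP.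
apply: (boxint_derive0 (j := rshift (m + m) ord0) (phi := fun p => 2 * Jz i p * flux i p)) => //.
- apply: contM; last exact: C1_continuousT.
  by apply: contM; [exact: cst_continuous|exact: Jz_continuous].
- move=> p; have [dp Ep] : is_derive p dt (flux i) ('D_dt (flux i) p).
    by apply/derivableP/diff_derivable.
  have E : (fun h : R => h^-1 *: (2 * Jz i (h *: dt + p) * flux i (h *: dt + p) - 2 * Jz i p * flux i p))
    = (fun h : R => (2 * Jz i p) * (h^-1 *: (flux i (h *: dt + p) - flux i p))).
    by apply/funext => h; rewrite Jz_dt -mulrBr /GRing.scale/= mulrCA.
  have H : (fun h : R => (2 * Jz i p) * (h^-1 *: (flux i (h *: dt + p) - flux i p))) h @[h --> 0^']
      --> 2 * Jz i p * 'D_dt (flux i) p.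
    by apply: cvgM; [exact: cvg_cst|exact: dp].
  rewrite -E in H; split; first by apply/cvg_ex; exists (2 * Jz i p * 'D_dt (flux i) p).
  exact: cvg_lim H.
- move=> p _; rewrite blo_t bhi_t subr0 Jz_dt /flux normz2_dt.
  by rewrite -[1](_ : 1%:~R = 1)// stress_per.
Qed.

Lemma sum_stress p : \sum_i zc i p * stress i p = radial p - 2^-1 * (normz2 p * density p).
Proof.
rewrite /stress; under eq_bigr do rewrite mulrBr.
rewrite sumrB; congr (_ - _).
  by apply: eq_bigr => i _; rewrite mulr_sumr; apply: eq_bigr => j _; rewrite mulrA.
rewrite /normz2 mulr_suml mulr_sumr; apply: eq_bigr => i _.
by rewrite expr2; ring.
Qed.

Lemma div_flux p : \sum_i 'D_(hvec i p) (flux i) p =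
  chi (normz2 p) * ((1 - m%:R) * density p + coupling p)
  - 2 * M * tau (normz2 p) * (radial p - 2^-1 * (normz2 p * density p)).
Proof.
under eq_bigr do rewrite derive_flux.
by rewrite sumrB -!mulr_sumr div_stress sum_stress.
Qed.

Lemma C1_div_flux_cont i : continuous (fun p => 'D_(hvec i p) (flux i) p).
Proof.
have -> : (fun p => 'D_(hvec i p) (flux i) p) =
    fun p => 'D_(ebase R (lshift 1 i)) (flux i) p - 2 * Jz i p * 'D_dt (flux i) p.
  by apply/funext => p; rewrite derive_hvec//; exact/C1_diff/C1_flux.
apply: contB; first exact/C1_derive_cont/C1_flux.
apply: contM; last exact/C1_derive_cont/C1_flux.
by apply: contM; [exact: cst_continuous|exact: Jz_continuous].
Qed.

(** The integral of [div_flux] is 0. The cutoff terms are estimated where they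
    are supported, namely |z|^2 <= b; the term with [radial] has the sign that
    allows dropping it. The parameter [l] of the weighted arithmetic-geometric
    inequality is left free, to be optimized against the energies. *)
Lemma integrated_inequality (l : R) : 0 < l ->
  (m%:R - 1) * J (fun p => chi (normz2 p) * (density p * 2^-1))
  <= l * J (fun p => chi (normz2 p) * (W p * 2^-1))
     + l^-1 * b * J (fun p => chi (normz2 p) * (density p * 2^-1))
     + M * b * J (fun p => tau (normz2 p) * (density p * 2^-1)).
Proof.
move=> l0; have lh := box_le (m := m) r00.
have M0 := cutoff_M_gt0 ab M1.
have cchi : continuous (fun p : HH => chi (normz2 p)) by exact: C1_continuousT C1_cut.
have ctau : continuous (fun p : HH => tau (normz2 p)).
  by apply: cont_comp; [exact: plateau_continuous|exact: normz2_continuous].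
have cd : continuous density by exact: C1_continuousT C1_density.
have ch (f : HH -> R) : continuous f -> continuous (fun p => f p * 2^-1).
  by move=> cf; apply: contM => //; exact: cst_continuous.
have cA := contM cchi (ch _ cd); have cB := contM cchi (ch _ cW); have cT := contM ctau (ch _ cd).
have cZ c (f : HH -> R) : continuous f -> continuous (fun p => c * f p).
  by move=> cf; apply: contM => //; exact: cst_continuous.
have cF : continuous (fun p => \sum_i 'D_(hvec i p) (flux i) p).
  by apply: cont_sum => i; exact: C1_div_flux_cont.
have J0 : J (fun p => - 2^-1 * \sum_i 'D_(hvec i p) (flux i) p) = 0.
  rewrite boxintZ// boxint_sum//; last exact: C1_div_flux_cont.
  by rewrite big1 ?mulr0// => i _; exact: flux_int0.
rewrite -subr_le0 -J0.
rewrite -!boxintZ// -!boxintD//; try by do ?[apply: contD]; apply: cZ.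
rewrite -boxintB//; try by do ?[apply: contD]; apply: cZ.
apply: le_boxint => //; first by apply: contB; do ?[apply: contD]; apply: cZ.
  exact: cZ.
move=> p _; rewrite div_flux.
have := coupling_le p l0; have := radial_ge0 p; have := density_ge0 p.
have /andP[c0 c1] := cutoff_itv ab M1 M2 (normz2 p).
have /andP[t0 t1] := plateau_itv ab M1 M2 (normz2 p).
have bound : chi (normz2 p) * (normz2 p) <= chi (normz2 p) * b.
  have [rb|rb] := leP (normz2 p) b; first exact: ler_wpM2l.
  by rewrite cutoff_right// ?mul0r// ltW.
have boundt : tau (normz2 p) * (normz2 p) <= tau (normz2 p) * b.
  have [rb|rb] := leP (normz2 p) b; first exact: ler_wpM2l.
  by rewrite plateau_eq0 ?mul0r//; right; exact: ltW.
set C := chi _ in c0 c1 bound *; set T := tau _ in t0 t1 boundt *.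
set D := density p; set K := coupling p; set r := normz2 p in bound boundt *.
move=> D0 rad0 HK.
have li0 : 0 < l^-1 by rewrite invr_gt0.
have H1 : C * K <= C * (l * W p + l^-1 * (r * D)) by exact: ler_wpM2l.
have H2 : l^-1 * D * (C * r) <= l^-1 * D * (C * b).
  by apply: ler_wpM2l => //; apply: mulr_ge0 => //; exact: ltW.
have H3 : M * D * (T * r) <= M * D * (T * b).
  by apply: ler_wpM2l => //; apply: mulr_ge0 => //; exact: ltW.
have H4 : 0 <= M * T * radial p by apply: mulr_ge0 => //; apply: mulr_ge0 => //; exact: ltW.
lra.
Qed.

End Cut.

Local Notation EH rho := (integralK (@Drho R m rho) density).
Local Notation EV rho := (integralK (@Drho R m rho) W).

Let cd : continuous density. Proof. exact: C1_continuousT C1_density. Qed.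

Lemma energy_fineE (g : HH -> R) rho : continuous g -> (forall p, 0 <= g p) -> 0 <= rho ->
  ext_energy rho g = (integralK (@Drho R m rho) g)%:E.
Proof.
move=> cg g0 rho0; rewrite integralKE fineK//.
by apply: (@ext_energy_fin R m g (rho + 1)) => //; lra.
Qed.

Lemma energy_ge0 (g : HH -> R) rho : continuous g -> (forall p, 0 <= g p) -> 0 <= rho ->
  0 <= integralK (@Drho R m rho) g.
Proof.
move=> cg g0 rho0; rewrite -lee_fin -energy_fineE// ext_energyE//.
by apply: integral_rV_ge0 => p; rewrite lee_fin; apply: mulr_ge0 => //; exact: divr_ge0.
Qed.

(** The minimum over l of l V + b E / l is 2 sqrt(b V E). Allowing the
    strictly positive slope d avoids dividing by V or E, which may vanish. *)
Lemma amgm_optimize (V E d b : R) : 0 < b -> 0 <= E -> 0 < d -> 4 * b * V <= d ^+ 2 * E ->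
  exists2 l, 0 < l & l * V + l^-1 * b * E <= d * E.
Proof.
move=> b0 E0 d0 H; exists (2 * b / d); first by apply: divr_gt0 => //; exact: mulr_gt0.
have -> : (2 * b / d)^-1 * b * E = d * E / 2 by field; rewrite !gt_eqF.
have : 2 * b / d * V <= d * E / 2.
  have -> : 2 * b / d * V = (4 * b * V) / (2 * d) by field; rewrite gt_eqF.
  rewrite ler_pdivrMr; last exact: mulr_gt0.
  apply: le_trans H _; rewrite expr2; lra.
lra.
Qed.

(** The cutoff between rho1^2 and rho2^2 is chosen with slope M slightly above
    1 / (b - a), so that M b equals (b + (b - a)) / (b - a). The excess is of
    second order in b - a and is lost in the subdivision of [power_growth]. *)
Lemma energy_step (delta rho1 rho2 : R) : 0 <= delta -> 0 <= rho1 -> rho1 < rho2 -> 0 <= m%:R - 1 :> R ->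
  2 * rho2 * Num.sqrt (EV rho2) <= delta * Num.sqrt (EH rho2) ->
  (rho2 ^+ 2 - rho1 ^+ 2) * ((m%:R - 1) * EH rho1 - delta * EH rho2)
    <= (rho2 ^+ 2 + (rho2 ^+ 2 - rho1 ^+ 2)) * (EH rho2 - EH rho1).
Proof.
move=> delta0 rho10 rho12 k0 Hdelta.
have rho20 : 0 < rho2 by exact: le_lt_trans rho12.
set a := rho1 ^+ 2; set b := rho2 ^+ 2.
have a0 : 0 <= a by exact: sqr_ge0.
have b0 : 0 < b by exact: exprn_gt0.
have ab : a < b by rewrite ltr_pXn2r ?nnegrE// ltW.
(* a box strictly larger than the cylinder, so that the cutoff vanishes near
   its lateral faces *)
pose r0 := rho2 + 1; have r00 : 0 < r0 by rewrite /r0; lra.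
have rho1r : rho1 < r0 by rewrite /r0; lra.
have rho2r : rho2 < r0 by rewrite /r0; lra.
have br0 : b <= r0 ^+ 2 by rewrite ler_pXn2r ?nnegrE//; exact: ltW.
pose M := (1 + (b - a) / b) / (b - a).
have dab : 0 < b - a by rewrite subr_gt0.
have hb0 : 0 < (b - a) / b by exact: divr_gt0.
have hb1 : (b - a) / b <= 1 by rewrite ler_pdivrMr//; lra.
have Md : M * (b - a) = 1 + (b - a) / b by rewrite divfK// gt_eqF.
have M1 : 1 < M * (b - a) by rewrite Md; lra.
have M2 : M * (b - a) <= 2 by rewrite Md; lra.
have rho2ge : 0 <= rho2 by exact: ltW.
have cchi : continuous (cutoff a b M).
  by move=> x; apply/differentiable_continuous/derivable1_diffP; have [] := cutoff_derive a b M x.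
have chi01 := cutoff_itv ab M1 M2.
have d0 := density_ge0; have w0 := W_ge0.
pose A := boxint (blo m r0) (bhi m r0) (fun p => cutoff a b M (normz2 p) * (density p * 2^-1)).
pose AW := boxint (blo m r0) (bhi m r0) (fun p => cutoff a b M (normz2 p) * (W p * 2^-1)).
pose T := boxint (blo m r0) (bhi m r0) (fun p => plateau a b M (normz2 p) * (density p * 2^-1)).
have E1A : EH rho1 <= A.
  rewrite -lee_fin -energy_fineE//; apply: energy_le_boxint => // x.
    by have /andP[] := chi01 x.
  exact: cutoff_left.
have AE2 : A <= EH rho2.
  rewrite -lee_fin -energy_fineE//; apply: boxint_le_energy => // x; exact: cutoff_right.
have AWV : AW <= EV rho2.
  rewrite -lee_fin -energy_fineE//; apply: boxint_le_energy => // x; exact: cutoff_right.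
have ETE : EH rho1 + T <= EH rho2.
  rewrite -lee_fin EFinD -!energy_fineE//; apply: energy_superadd => //.
  - exact: plateau_continuous.
  - exact: ltW.
  - exact: plateau_itv.
  - by move=> x; exact: plateau_eq0.
have V0 : 0 <= EV rho2 by exact: energy_ge0.
have E0 : 0 <= EH rho2 by exact: energy_ge0.
have Hsq d : delta <= d -> 4 * b * EV rho2 <= d ^+ 2 * EH rho2.
  move=> dd; have H2 : 2 * rho2 * Num.sqrt (EV rho2) <= d * Num.sqrt (EH rho2).
    by apply: le_trans Hdelta _; apply: ler_wpM2r => //; exact: sqrtr_ge0.
  have L0 : 0 <= 2 * rho2 * Num.sqrt (EV rho2).
    by apply: mulr_ge0; [exact: mulr_ge0|exact: sqrtr_ge0].
  have := ler_pM L0 L0 H2 H2; rewrite -!expr2 !exprMn !sqr_sqrtr//.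
  by rewrite /b; have -> : (2 : R) ^+ 2 = 4 by ring.
have M0 := cutoff_M_gt0 ab M1.
have Mb : (b - a) * (M * b) = b + (b - a).
  by rewrite mulrA (mulrC (b - a)) Md mulrDl mul1r divfK// gt_eqF.
suff main : (m%:R - 1) * EH rho1 - delta * EH rho2 <= M * b * (EH rho2 - EH rho1).
  by rewrite -Mb -mulrA ler_pM2l.
have kA : (m%:R - 1) * EH rho1 <= (m%:R - 1) * A by exact: ler_wpM2l.
have TE : M * b * T <= M * b * (EH rho2 - EH rho1).
  by apply: ler_wpM2l; [apply: mulr_ge0; exact: ltW|lra].
suff : (m%:R - 1) * A <= delta * EH rho2 + M * b * T by lra.
apply/ler_addgt0Pr => e e0.
(* a slope slightly larger than delta, as delta may be 0 *)
pose d := delta + e / (EH rho2 + 1).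
have dd : delta < d by rewrite ltrDl; apply: divr_gt0 => //; lra.
have dgt0 : 0 < d by exact: le_lt_trans dd.
have [l l0 Hl] := amgm_optimize b0 E0 dgt0 (Hsq _ (ltW dd)).
have := integrated_inequality ab M1 M2 r00 br0 l0; rewrite -/A -/AW -/T => Hint.
have h1 : l * AW <= l * EV rho2 by apply: ler_wpM2l => //; exact: ltW.
have h2 : l^-1 * b * A <= l^-1 * b * EH rho2.
  by apply: ler_wpM2l => //; apply: mulr_ge0; [rewrite invr_ge0; exact: ltW|exact: ltW].
have h3 : d * EH rho2 <= delta * EH rho2 + e.
  rewrite /d mulrDl lerD2l mulrAC ler_pdivrMr; last by lra.
  by apply: ler_wpM2l; [exact: ltW|lra].
lra.
Qed.

Lemma energy_le (rho1 rho2 : R) : 0 <= rho1 -> rho1 <= rho2 -> EH rho1 <= EH rho2.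
Proof.
move=> rho10 rho12; have rho20 : 0 <= rho2 by exact: le_trans rho12.
rewrite -lee_fin -!energy_fineE//; try exact: density_ge0.
rewrite !ext_energyE//; apply: le_integral_rV => p; rewrite lee_fin.
  by apply: mulr_ge0 => //; apply: divr_ge0 => //; exact: density_ge0.
apply: ler_wpM2r; first by apply: divr_ge0 => //; exact: density_ge0.
rewrite ler_nat; have [H|//] := leP (normz2 p) (rho1 ^+ 2).
rewrite (_ : normz2 p <= rho2 ^+ 2)//; apply: le_trans H _.
by rewrite ler_pXn2r ?nnegrE.
Qed.

(** A point with positive density is first translated in t to the fundamental
    domain, as the integrals only see 0 <= t < 1. *)
Lemma density_eq0_of_energy (rho0 : R) : 0 <= rho0 ->
  (forall rho, rho0 <= rho -> EH rho <= 0) -> forall p, density p = 0.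
Proof.
move=> rho00 HE p; apply/eqP; rewrite eq_le density_ge0 andbT leNgt; apply/negP => dp.
pose k := - Num.floor (p 0 (it m)); pose p' := k%:~R *: dt + p.
have dp' : 0 < density p' by rewrite density_per.
pose rho := rho0 + normz2 p + 1.
have z0 : 0 <= normz2 p by apply: sumr_ge0 => i _; exact: sqr_ge0.
have rho0' : 0 <= rho by rewrite /rho; lra.
pose r0 := rho + 2; have r00 : 0 < r0 by rewrite /r0; lra.
have zrho : normz2 p' <= rho ^+ 2 by rewrite normz2_dt expr2 /rho; nra.
have rr : rho ^+ 2 < r0 ^+ 2 by rewrite ltr_pXn2r ?nnegrE ?(ltW r00)// /r0; lra.
pose a := rho ^+ 2; pose b := (rho + 1) ^+ 2.
have ab : a < b by rewrite /a /b ltr_pXn2r ?nnegrE//; lra.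
pose M := 2 / (b - a).
have M2e : M * (b - a) = 2 by rewrite divfK// gt_eqF// subr_gt0.
have M1 : 1 < M * (b - a) by rewrite M2e; lra.
have M2 : M * (b - a) <= 2 by rewrite M2e.
have cchi : continuous (cutoff a b M).
  by move=> x; apply/differentiable_continuous/derivable1_diffP; have [] := cutoff_derive a b M x.
have chi01 := cutoff_itv ab M1 M2.
pose phi p := cutoff a b M (normz2 p) * (density p * 2^-1).
have : 0 < boxint (blo m r0) (bhi m r0) phi.
  apply: (@boxint_gt0 _ _ _ _ _ p').
  - exact: box_lt.
  - exact: cutoff_continuous.
  - move=> q; apply: mulr_ge0; first by have /andP[] := chi01 (normz2 q).
    by apply: divr_ge0 => //; exact: density_ge0.
  - rewrite inboxE normz2_inbox//=; last exact: le_lt_trans rr.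
    have -> : p' 0 (it m) = p 0 (it m) - (Num.floor (p 0 (it m)))%:~R.
      by rewrite /p' !mxE !eqxx mulr1 /k intrN addrC.
    have := floor_itv (p 0 (it m)); rewrite intrD => /andP[f1 f2].
    by apply/andP; split; lra.
  - by rewrite /phi cutoff_left// mul1r divr_gt0.
rewrite ltNge => /negP; apply; apply: le_trans (HE (rho + 1) _); last by rewrite /rho; lra.
rewrite -lee_fin -energy_fineE//; try exact: density_ge0; last by lra.
apply: boxint_le_energy => //; [exact: density_ge0|lra|].
by move=> x; exact: cutoff_right.
Qed.

(** If the energy is positive at some rho1 >= rho0, it stays positive by
    monotonicity, and [power_growth] bounds it from below by a constant
    multiple of the comparison function, against the little-o hypothesis.
    Positivity of the energy also makes [delta] nonnegative. *)
Theorem density_eq0 (delta rho0 : R) : 0 < rho0 ->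
  (forall rho, rho0 <= rho -> 2 * rho * Num.sqrt (EV rho) <= delta * Num.sqrt (EH rho)) ->
  0 < 2 * m%:R - 2 - 2 * delta ->
  (fun rho => EH rho) =o_+oo (fun rho : R => rho `^ (2 * m%:R - 2 - 2 * delta)) ->
  forall p, density p = 0.
Proof.
move=> rho00 Hdelta Hpos Hgrowth.
apply: (@density_eq0_of_energy rho0); first exact: ltW.
move=> rho1 rho01; rewrite leNgt; apply/negP => E1.
have rho10 : 0 < rho1 by exact: lt_le_trans rho01.
have delta0 : 0 <= delta.
  have sE : 0 < Num.sqrt (EH rho1) by rewrite sqrtr_gt0.
  rewrite -(pmulr_lge0 _ sE); apply: le_trans (Hdelta _ rho01).
  by apply: mulr_ge0; [apply: mulr_ge0 => //; exact: ltW|exact: sqrtr_ge0].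
pose k : R := m%:R - 1; pose s0 := rho1 ^+ 2; pose E x := EH (Num.sqrt x).
have s00 : 0 < s0 by exact: exprn_gt0.
have k0 : 0 <= k by rewrite /k; lra.
have dk : delta <= k by rewrite /k; lra.
have sqs : Num.sqrt s0 = rho1 by rewrite sqrtr_sqr ger0_norm// ltW.
have sqle x : s0 <= x -> rho1 <= Num.sqrt x.
  by move=> s0x; rewrite -sqs ler_sqrt//; exact: le_trans (ltW s00) s0x.
have Epos x : s0 <= x -> 0 < E x.
  by move=> s0x; apply: lt_le_trans E1 _; apply: energy_le; [exact: ltW|exact: sqle].
have step a b : s0 <= a -> a < b ->
    (b - a) * (k * E a - delta * E b) <= (b + (b - a)) * (E b - E a).
  move=> s0a ab; have a0 : 0 <= a by exact: le_trans (ltW s00) s0a.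
  have b0 : 0 <= b by exact: le_trans (ltW ab).
  have := @energy_step delta (Num.sqrt a) (Num.sqrt b) delta0 (sqrtr_ge0 _) _ k0 _.
  rewrite !sqr_sqrtr//; apply; first by rewrite ltr_sqrt//; exact: le_lt_trans ab.
  by apply: Hdelta; apply: le_trans rho01 _; apply: sqle; exact: le_trans (ltW ab).
have G := power_growth delta0 dk s00 Epos step.
set L0 := ln (E s0) - _ in G.
have e0 : 0 < expR L0 / 2 by apply: divr_gt0 => //; exact: expR_gt0.
have /eqoP/(_ _ e0) Hlit := Hgrowth.
have [rho [rho1r Hr]] : exists rho, rho1 <= rho /\
    `|EH rho| <= expR L0 / 2 * `|rho `^ (2 * m%:R - 2 - 2 * delta)|.
  apply: (@filter_ex _ (pinfty_nbhs R)); apply: filterS2 Hlit (nbhs_pinfty_ge (num_real rho1)).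
  by move=> x h1 h2; split.
have rhogt0 : 0 < rho by exact: lt_le_trans rho1r.
have s0r : s0 <= rho ^+ 2 by rewrite ler_pXn2r ?nnegrE// ltW.
have := G _ s0r; rewrite /E sqrtr_sqr (ger0_norm (ltW rhogt0)).
have EHr : 0 < EH rho by apply: lt_le_trans E1 _; apply: energy_le => //; exact: ltW.
rewrite lerBrDr -ler_expR lnK ?posrE// expRD lnXn// => Hlow.
have PE : expR ((k - delta) * (ln rho *+ 2)) = rho `^ (2 * m%:R - 2 - 2 * delta).
  by rewrite /powR gt_eqF//; congr expR; rewrite /k mulr2n; ring.
rewrite PE in Hlow.
have P0 : 0 < rho `^ (2 * m%:R - 2 - 2 * delta) by exact: powR_gt0.
move: Hr; rewrite (gtr0_norm EHr) (gtr0_norm P0) => Hr.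
have X0 : 0 < expR L0 * rho `^ (2 * m%:R - 2 - 2 * delta) by apply: mulr_gt0 => //; exact: expR_gt0.
lra.
Qed.

End Core.

(** * Orthogonal projections *)

Section Projections.
Variables (R : realType) (n : nat) (B L : 'M[R]_n).
Hypothesis Bsym : B^T = B.
Hypothesis Bpos : forall v : 'rV[R]_n, v != 0 -> 0 < ip B v v.
Local Notation P := (projH B L).
Local Notation Q := (projV B L).

Lemma ip_eq0 (v : 'rV[R]_n) : ip B v v = 0 -> v = 0.
Proof. by move=> H; apply/eqP; apply: contraT => /Bpos; rewrite H ltxx. Qed.

Lemma orthmxP k (u : 'M[R]_(k, n)) : reflect (u *m B *m L^T = 0) (u <= orthmx B L)%MS.
Proof. by rewrite -mulmxA; exact: sub_kermxP. Qed.

Lemma leaf_cap_orth : (L :&: orthmx B L = 0)%MS.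
Proof.
apply/eqP; rewrite -submx0; apply/row_subP => i; rewrite submx0; apply/eqP.
set v := row i _.
have vL : (v <= L)%MS by apply: submx_trans (row_sub _ _) _; exact: capmxSl.
have vO : (v <= orthmx B L)%MS by apply: submx_trans (row_sub _ _) _; exact: capmxSr.
apply: ip_eq0; have /submxP[c E] := vL; rewrite /ip {2}E trmx_mul mulmxA.
by rewrite (orthmxP v vO) mul0mx mxE.
Qed.

Lemma leaf_add_orth : (1%:M <= L + orthmx B L)%MS.
Proof.
rewrite sub1mx /row_full eqn_leq rank_leq_row /=.
have := mxrank_sum_cap L (orthmx B L); rewrite leaf_cap_orth mxrank0 addn0 => ->.
rewrite /orthmx mxrank_ker.
have : (\rank (B *m L^T) <= \rank L)%N by rewrite -[X in (_ <= X)%N]mxrank_tr mxrankM_maxr.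
have := rank_leq_row L; lia.
Qed.

Lemma projHV : P + Q = 1%:M.
Proof.
have := @add_proj_mx R n n (orthmx B L) L 1%:M; rewrite !mul1mx; apply.
  by rewrite capmxC; exact: leaf_cap_orth.
by rewrite addsmxC; exact: leaf_add_orth.
Qed.

Lemma projV_sub : (Q <= L)%MS.
Proof. by rewrite -[Q]mul1mx; exact: proj_mx_sub. Qed.

Lemma projH_orth : P *m B *m L^T = 0.
Proof. by apply/orthmxP; rewrite -[P]mul1mx; exact: proj_mx_sub. Qed.

Lemma projH_id k (u : 'M[R]_(k, n)) : u *m B *m L^T = 0 -> u *m P = u.
Proof. by move=> /orthmxP uO; apply: proj_mx_id => //; rewrite capmxC; exact: leaf_cap_orth. Qed.

Lemma projH_leaf k (u : 'M[R]_(k, n)) : (u <= L)%MS -> u *m P = 0.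
Proof. by move=> uL; apply: proj_mx_0 => //; rewrite capmxC; exact: leaf_cap_orth. Qed.

Lemma projH_projH : P *m P = P. Proof. exact/projH_id/projH_orth. Qed.

Lemma projVE : Q = 1%:M - P. Proof. by rewrite -projHV addrC addKr. Qed.

(** Self-adjointness of the orthogonal projection: the horizontal and vertical
    spaces are orthogonal, and P is idempotent. *)
Lemma projH_sym : P *m B = B *m P^T.
Proof.
have PBQ : P *m B *m Q^T = 0.
  have /submxP[c ->] := projV_sub; rewrite trmx_mul mulmxA projH_orth mul0mx//.
have PB : P *m B = P *m B *m P^T.
  by rewrite -[LHS]mulmx1 -trmx1 -projHV linearD mulmxDr /= PBQ addr0.
move: (P) PB => p pB.
have S : (p *m B *m p^T)^T = p *m B *m p^T by rewrite !trmx_mul trmxK Bsym mulmxA.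
by rewrite pB -S -pB trmx_mul Bsym.
Qed.

(** Since P is idempotent and self-adjoint, one factor P is enough. The single
    matrix P B thus represents the transverse metric. *)
Lemma hor_metricE (u v : 'rV[R]_n) : ip B (u *m P) (v *m P) = ip (P *m B) u v.
Proof.
have -> : ip B (u *m P) (v *m P) = (u *m (P *m (B *m P^T)) *m v^T) 0 0.
  by rewrite /ip trmx_mul !mulmxA.
by rewrite -projH_sym (mulmxA P) projH_projH.
Qed.

Variables (q : nat) (b : 'M[R]_(q, n)).
Hypotheses (bL : (b == L)%MS) (rb : \rank L = q).

Lemma gram_unit : b *m B *m b^T \in unitmx.
Proof.
have fb : row_free b by rewrite /row_free (eqmxP bL) rb.
rewrite -row_free_unit -kermx_eq0 -submx0; apply/row_subP => i; rewrite submx0.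
set c := row i _; have cK : c *m (b *m B *m b^T) = 0 by apply/sub_kermxP; exact: row_sub.
rewrite -(mulmx_free_eq0 _ fb); apply/eqP/ip_eq0.
by rewrite /ip trmx_mul !mulmxA -(mulmxA c) -(mulmxA c) cK mul0mx mxE.
Qed.

(** The Gram formula in a basis of the leaf. Unlike the abstract projection,
    it visibly depends smoothly on the metric and on the basis. *)
Lemma projV_formula : Q = B *m b^T *m invmx (b *m B *m b^T) *m b.
Proof.
set Q' := RHS.
have Q'L : (Q' <= L)%MS by rewrite -(eqmxP bL); exact: submxMl.
have /submxP[C LE] : (L <= b)%MS by case/andP: bL.
have K : Q' *m B *m b^T = B *m b^T.
  transitivity (B *m b^T *m (invmx (b *m B *m b^T) *m (b *m B *m b^T))).
    by rewrite /Q' !mulmxA.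
  by rewrite mulVmx ?gram_unit// mulmx1.
have O : (1%:M - Q') *m B *m L^T = 0.
  by rewrite LE trmx_mul mulmxA mulmxBl mulmxBl mul1mx K subrr mul0mx.
have E : P = 1%:M - Q'.
  by rewrite -[LHS]mul1mx -[X in X *m _](subrK Q' 1%:M) mulmxDl (projH_id O) projH_leaf// addr0.
by rewrite projVE E opprB addrC subrK.
Qed.

End Projections.

(** * The Euler-Lagrange identity of a Riemannian foliation *)

Section Ip.
Variables (R : realType) (n : nat).
Implicit Types (M A : 'M[R]_n) (u v w : 'rV[R]_n).

Lemma ipDl M u v w : ip M (u + v) w = ip M u w + ip M v w.
Proof. by rewrite /ip !mulmxDl mxE. Qed.

Lemma ipDr M u v w : ip M u (v + w) = ip M u v + ip M u w.
Proof. by rewrite /ip linearD mulmxDr mxE. Qed.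

Lemma ipZl M (a : R) u w : ip M (a *: u) w = a * ip M u w.
Proof. by rewrite /ip -!scalemxAl mxE. Qed.

Lemma ipZr M (a : R) u w : ip M u (a *: w) = a * ip M u w.
Proof. by rewrite /ip linearZ /= -scalemxAr mxE. Qed.

Lemma ip0l M w : ip M 0 w = 0. Proof. by rewrite /ip !mul0mx mxE. Qed.

Lemma ip0r M w : ip M w 0 = 0. Proof. by rewrite /ip trmx0 mulmx0 mxE. Qed.

Lemma ipDm M A u v : ip (M + A) u v = ip M u v + ip A u v.
Proof. by rewrite /ip mulmxDr mulmxDl mxE. Qed.

Lemma ipZm (a : R) M u v : ip (a *: M) u v = a * ip M u v.
Proof. by rewrite /ip -scalemxAr -scalemxAl mxE. Qed.

Lemma ip_sym M u v : M^T = M -> ip M u v = ip M v u.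
Proof.
move=> Ms; rewrite /ip -[u *m M *m v^T]trmxK [LHS]mxE !trmx_mul trmxK Ms.
by rewrite mulmxA.
Qed.

Lemma ip_mull A M u v : ip (A *m M) u v = ip M (u *m A) v.
Proof. by rewrite /ip mulmxA. Qed.

Lemma ip_mulr A M u v : ip (M *m A^T) u v = ip M u (v *m A).
Proof. by rewrite /ip trmx_mul !mulmxA. Qed.

Lemma ip_suml M (I : Type) (r : seq I) (F : I -> 'rV[R]_n) w :
  ip M (\sum_(i <- r) F i) w = \sum_(i <- r) ip M (F i) w.
Proof. by elim/big_rec2 : _ => [|i x y _ <-]; rewrite ?ip0l ?ipDl. Qed.

Lemma linear_ebase (phi : 'rV[R]_n -> R) (c : 'rV[R]_n) :
  (forall (a : R) (u v : 'rV[R]_n), phi (a *: u + v) = a * phi u + phi v) ->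
  \sum_k phi (ebase R k) * c 0 k = phi c.
Proof.
move=> lin; rewrite [in RHS](row_sum_delta c).
have phi0 : phi 0 = 0.
  by have := lin 1 0 0; rewrite scaler0 addr0 mul1r => /(congr1 (fun x => x - phi 0)); rewrite addrK subrr.
by elim/big_rec2 : _ => [//|k x y _ ->]; rewrite lin mulrC.
Qed.

(** A linear form is the scalar product with the vector obtained by raising
    its index; this undoes the [invmx] in the Christoffel symbols and in the
    adjoint tensor. *)
Lemma ip_raise M (phi : 'rV[R]_n -> R) c : M \in unitmx ->
  (forall (a : R) (u v : 'rV[R]_n), phi (a *: u + v) = a * phi u + phi v) ->
  ip M ((\row_k phi (ebase R k)) *m invmx M) c = phi c.
Proof.
move=> uM lin; rewrite /ip mulmxKV// -(linear_ebase c lin) mxE.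
by apply: eq_bigr => k _; rewrite !mxE.
Qed.

End Ip.

Lemma derive_ipm (R : realType) n (M : 'rV[R]_n -> 'M[R]_n) (x v a c : 'rV[R]_n) : differentiable M x ->
  'D_v (fun y => ip (M y) a c) x = ip ('D_v M x) a c.
Proof.
move=> dM; rewrite /ip.
have d1 : differentiable (fun y => a *m M y) x.
  exact: (differentiable_mulmx (differentiable_cst a x) dM).
have d2 : differentiable (fun y => a *m M y *m c^T) x.
  exact: (differentiable_mulmx d1 (differentiable_cst (c^T) x)).
rewrite (derive_entry v 0 0 d2) (derive_mulmx v d1 (differentiable_cst (c^T) x)).
rewrite (derive_mulmx v (differentiable_cst a x) dM).
have -> : 'D_v (cst a) x = 0 by exact: derive_cst.
have -> : 'D_v (cst c^T) x = 0 by exact: derive_cst.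
by rewrite mul0mx add0r mulmx0 addr0.
Qed.

Lemma ip_linr (R : realType) n (M : 'M[R]_n) u (a : R) v w :
  ip M u (a *: v + w) = a * ip M u v + ip M u w.
Proof. by rewrite ipDr ipZr. Qed.

Lemma ip_mulD (R : realType) n (H H' : 'M[R]_n) (u u' Z : 'rV[R]_n) :
  u' *m H + u *m H' = 0 -> ip H' u Z + ip H u' Z = 0.
Proof.
move=> E; rewrite /ip; transitivity (((u' *m H + u *m H') *m Z^T) 0 0).
  by rewrite mulmxDl [RHS]mxE addrC.
by rewrite E mul0mx mxE.
Qed.


Lemma sub2_eq0 (R : zmodType) (X a b X' a' b' : R) :
  X = X' -> a = a' -> b = b' -> X - a - b = 0 -> X' = a' + b'.
Proof. by move=> <- <- <- /eqP; rewrite -addrA -opprD subr_eq0 => /eqP. Qed.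

Section ELAlgebra.
(* Linear algebra at one point: [dG v] and [dP v] stand for the derivatives of
   the metric and of the horizontal projection in the direction [v]. *)
Variables (R : realType) (n : nat) (G P : 'M[R]_n) (dG dP : 'rV[R]_n -> 'M[R]_n).
Hypothesis G_unit : G \in unitmx.
Hypothesis G_sym : G^T = G.
Hypothesis P_sym : P *m G = G *m P^T.
Hypothesis P_idem : P *m P = P.
Hypothesis dG_lin : forall (a : R) (u v : 'rV[R]_n), dG (a *: u + v) = a *: dG u + dG v.
Hypothesis dP_lin : forall (a : R) (u v : 'rV[R]_n), dP (a *: u + v) = a *: dP u + dP v.
Hypothesis dG_sym : forall v, (dG v)^T = dG v.
Hypothesis dP_idem : forall v, dP v *m P + P *m dP v = dP v.
Local Notation Q := (1%:M - P).

(** The derivative of the transverse metric h = P G. By symmetry of h it also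
    equals the transposed expression, hypothesis [dh_E]. *)
Definition dh (v : 'rV[R]_n) := dP v *m G + P *m dG v.
Hypothesis dh_E : forall v, dh v = dG v *m P^T + G *m (dP v)^T.
Hypothesis bundle_like : forall U Y Z : 'rV[R]_n, U *m P = 0 ->
  ip (dh U) Y Z = ip (dh Y) U Z + ip (dh Z) U Y.

(** The Christoffel symbols, with arbitrary linear data [dG] in place of the
    derivative of the metric. *)
Definition chris (u v : 'rV[R]_n) : 'rV[R]_n :=
  (\row_k (2^-1 * (ip (dG u) v (ebase R k) + ip (dG v) u (ebase R k) - ip (dG (ebase R k)) u v)))
  *m invmx G.

Definition Tten (u c : 'rV[R]_n) : 'rV[R]_n := (c *m dP (u *m P) + chris (u *m P) (c *m P)) *m Q.
Definition Tst (u v : 'rV[R]_n) : 'rV[R]_n := (\row_k ip G v (Tten u (ebase R k))) *m invmx G.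

(** The contribution of one frame vector to the tension. The vector [w] stands
    for the covariant derivative that defines the tensor W of the target: its
    vertical part is orthogonal to horizontal vectors, so it may be arbitrary. *)
Definition tension_term (f F w : 'rV[R]_n) : 'rV[R]_n :=
  F *m P + f *m dP f + chris f (f *m P) + (Tst (f *m P) (f *m Q) + - (w *m Q)).

(** One summand of the Euler-Lagrange expression for the energy density h(f,
    f) / 2, paired with the variation [c]; [F] is the second derivative. *)
Definition EL (f F c : 'rV[R]_n) : R :=
  ip (P *m G) F c + ip (dh f) f c - 2^-1 * ip (dh c) f f.

Lemma chris_ip (u v c : 'rV[R]_n) : ip G (chris u v) c =
  2^-1 * (ip (dG u) v c + ip (dG v) u c - ip (dG c) u v).
Proof.
pose psi (k : 'rV[R]_n) : R := 2^-1 * (ip (dG u) v k + ip (dG v) u k - ip (dG k) u v).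
have lin (a : R) (y z : 'rV[R]_n) : psi (a *: y + z) = a * psi y + psi z.
  rewrite /psi (ip_linr (dG u)) (ip_linr (dG v)) dG_lin ipDm ipZm.
  move: (ip (dG u) v y) (ip (dG u) v z) (ip (dG v) u y) (ip (dG v) u z)
    (ip (dG y) u v) (ip (dG z) u v) => *; ring.
exact (@ip_raise R n G psi c G_unit lin).
Qed.

Lemma hor_ver_orth (u v : 'rV[R]_n) : u *m P = u -> v *m P = 0 -> ip G u v = 0.
Proof. by move=> uP vP; rewrite -uP -ip_mull P_sym ip_mulr vP ip0r. Qed.

Lemma ver_hor_orth (u v : 'rV[R]_n) : u *m P = 0 -> v *m P = v -> ip G u v = 0.
Proof. by move=> uP vP; rewrite ip_sym//; exact: hor_ver_orth. Qed.

Lemma hor_dP (u v : 'rV[R]_n) : u *m P = u -> u *m dP v *m P = 0.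
Proof.
move=> uP; have := congr1 (mulmx u) (dP_idem v); rewrite mulmxDr !mulmxA uP.
by move=> /(congr1 (fun z => z - u *m dP v)); rewrite addrK subrr.
Qed.

Lemma ver_dP (u v : 'rV[R]_n) : u *m P = 0 -> u *m dP v *m P = u *m dP v.
Proof.
by move=> uP; have := congr1 (mulmx u) (dP_idem v); rewrite mulmxDr !mulmxA uP mul0mx addr0.
Qed.

Lemma dh_sym v : (dh v)^T = dh v.
Proof.
rewrite [in RHS]dh_E /dh linearD /= (trmx_mul (dP v)) (trmx_mul P) dG_sym G_sym.
by rewrite addrC.
Qed.

Lemma ip_dh (v u c : 'rV[R]_n) : ip (dh v) u c = ip G (u *m dP v) c + ip (dG v) (u *m P) c.
Proof. by rewrite ipDm !ip_mull. Qed.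

Lemma ip_dh_r (v u c : 'rV[R]_n) : ip (dh v) u c = ip (dG v) u (c *m P) + ip G u (c *m dP v).
Proof. by rewrite dh_E ipDm !ip_mulr. Qed.

Lemma QP (u : 'rV[R]_n) : u *m Q *m P = 0.
Proof. by rewrite mulmxBr mulmx1 mulmxBl -mulmxA P_idem subrr. Qed.

Lemma PPu (u : 'rV[R]_n) : u *m P *m P = u *m P.
Proof. by rewrite -mulmxA P_idem. Qed.

Lemma PQu (u : 'rV[R]_n) : u = u *m P + u *m Q.
Proof. by rewrite mulmxBr mulmx1 addrC subrK. Qed.

Lemma dG_D u v : dG (u + v) = dG u + dG v.
Proof. by have := dG_lin 1 u v; rewrite !scale1r. Qed.

Lemma dh_lin (a : R) u v : dh (a *: u + v) = a *: dh u + dh v.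
Proof.
rewrite /dh dG_lin dP_lin mulmxDl mulmxDr -scalemxAl -scalemxAr scalerDr.
by rewrite addrACA.
Qed.

Lemma dh_D u v : dh (u + v) = dh u + dh v.
Proof. by have := dh_lin 1 u v; rewrite !scale1r. Qed.

(** The transverse metric is degenerate along [c], so the first term is 0, and
    [bundle_like] gives (d_c h)(f, f) = 2 (d_f h)(f, c): the two derivative
    terms cancel. *)
Lemma EL_ver (f F c : 'rV[R]_n) : c *m P = 0 -> EL f F c = 0.
Proof.
move=> cP; rewrite /EL (bundle_like f f cP) P_sym ip_mulr cP ip0r.
rewrite (ip_sym c f (dh_sym f)) add0r; move: (ip (dh f) f c) => z; lra.
Qed.

Lemma ip_ver_Q (v w : 'rV[R]_n) : v *m P = 0 -> ip G v (w *m Q) = ip G v w.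
Proof.
move=> vP; rewrite {2}(PQu w) ipDr.
by rewrite (ver_hor_orth vP (PPu w)) add0r.
Qed.

Lemma Tst_ip (u v c : 'rV[R]_n) : v *m P = 0 -> ip G (Tst u v) c =
  ip G v (c *m dP (u *m P)) + 2^-1 * (ip (dG (u *m P)) (c *m P) v
    + ip (dG (c *m P)) (u *m P) v - ip (dG v) (u *m P) (c *m P)).
Proof.
move=> vP.
pose psi (k : 'rV[R]_n) : R := ip G v (k *m dP (u *m P)) + 2^-1 * (ip (dG (u *m P)) (k *m P) v
    + ip (dG (k *m P)) (u *m P) v - ip (dG v) (u *m P) (k *m P)).
have E k : ip G v (Tten u k) = psi k.
  rewrite /Tten (ip_ver_Q _ vP) ipDr; congr (_ + _).
  by rewrite ip_sym// chris_ip.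
have lin (a : R) (y z : 'rV[R]_n) : psi (a *: y + z) = a * psi y + psi z.
  rewrite /psi !mulmxDl -!scalemxAl dG_lin.
  rewrite (ip_linr G) (ip_linr (dG v)) ipDm ipZm.
  rewrite (ipDl (dG (u *m P))) (ipZl (dG (u *m P))).
  move: (ip G v (y *m dP (u *m P))) (ip G v (z *m dP (u *m P)))
    (ip (dG (u *m P)) (y *m P) v) (ip (dG (u *m P)) (z *m P) v)
    (ip (dG (y *m P)) (u *m P) v) (ip (dG (z *m P)) (u *m P) v)
    (ip (dG v) (u *m P) (y *m P)) (ip (dG v) (u *m P) (z *m P)) => *; ring.
transitivity (ip G ((\row_k psi (ebase R k)) *m invmx G) c).
  by congr (ip G (_ *m _) c); apply/rowP => k; rewrite !mxE E.
exact (@ip_raise R n G psi c G_unit lin).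
Qed.

(** Write f = u + v with u horizontal and v vertical. The mixed part of (d_c
    h)(f, f) is evaluated by [bundle_like] and matches the terms of [Tst],
    while (d_c h)(v, v) = 0 since v dP is horizontal, hence orthogonal to v.
    What remains is the Koszul formula for u. *)
Lemma EL_hor (f F w c : 'rV[R]_n) : c *m P = c -> EL f F c = ip G (tension_term f F w) c.
Proof.
move=> cP; pose u := f *m P; pose v := f *m Q.
have uP : u *m P = u by exact: PPu.
have vP : v *m P = 0 by exact: QP.
have fuv : f = u + v by exact: PQu.
have wQ : ip G (- (w *m Q)) c = 0.
  by rewrite -scaleN1r ipZl (ver_hor_orth (QP w) cP) mulr0.
rewrite /EL /tension_term -/u -/v !ipDl wQ addr0 (Tst_ip _ _ vP) uP cP chris_ip.
rewrite (ip_mull P) (ip_dh f f c) -/u.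
set FP := ip G (F *m P) c; set fdP := ip G (f *m dP f) c.
(* the differential of the transverse metric on the two components of [f] *)
have D1 : ip (dh c) f f = ip (dh c) u u + 2 * ip (dh c) u v + ip (dh c) v v.
  by rewrite fuv ipDl !ipDr (ip_sym v u (dh_sym c)) -!addrA; ring.
have D2 : ip (dh c) v v = 0.
  by rewrite ip_dh vP ip0l addr0; exact: (hor_ver_orth (ver_dP c vP) vP).
have D3 : ip (dh c) u u = ip (dG c) u u.
  by rewrite ip_dh uP (ver_hor_orth (hor_dP c uP) uP) add0r.
have D4 : ip (dh c) u v = ip (dh v) u c - ip (dh u) v c.
  by rewrite (bundle_like u c vP) (ip_sym u v (dh_sym c)) addrC addKr.
have D5 : ip (dh v) u c = ip (dG v) u c.
  by rewrite ip_dh uP (ver_hor_orth (hor_dP v uP) cP) add0r.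
have D6 : ip (dh u) v c = ip (dG u) v c + ip G v (c *m dP u).
  by rewrite ip_dh_r cP.
rewrite D1 D2 D3 D4 D5 D6.
have G1 : ip (dG f) u c = ip (dG u) u c + ip (dG v) u c by rewrite fuv dG_D ipDm.
have G2 : ip (dG u) f c = ip (dG u) u c + ip (dG u) v c by rewrite fuv ipDl.
have G3 : ip (dG c) f u = ip (dG c) u u + ip (dG c) u v.
  by rewrite fuv ipDl (ip_sym v u (dG_sym c)).
have G4 : ip (dG u) c v = ip (dG u) v c by exact: ip_sym.
rewrite G1 G2 G3 G4.
move: FP fdP (ip (dG u) u c) (ip (dG v) u c) (ip (dG u) v c) (ip (dG c) u u)
  (ip (dG c) u v) (ip G v (c *m dP u)) => *; lra.
Qed.

Lemma EL_D (f F c c' : 'rV[R]_n) : EL f F (c + c') = EL f F c + EL f F c'.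
Proof.
rewrite /EL !ipDr dh_D (ipDm (dh c) (dh c')); move: (ip _ F c) (ip _ F c') (ip _ f c) (ip _ f c')
  (ip _ f f) (ip _ f f) => *; ring.
Qed.

(** Splitting the variation into horizontal and vertical parts combines the
    two previous cases, so the vanishing of the horizontal vector field, the
    tension, controls all variations. *)
Lemma EL_sum_eq0 (I : Type) (r : seq I) (f F w : I -> 'rV[R]_n) (c : 'rV[R]_n) :
  \sum_(a <- r) tension_term (f a) (F a) (w a) = 0 ->
  \sum_(a <- r) EL (f a) (F a) c = 0.
Proof.
move=> T0.
have E a : EL (f a) (F a) c = ip G (tension_term (f a) (F a) (w a)) (c *m P).
  by rewrite {1}(PQu c) EL_D (EL_ver _ _ (QP c)) addr0; exact: EL_hor (PPu c).
by rewrite (eq_bigr _ (fun a _ => E a)) -ip_suml T0 ip0l.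
Qed.

End ELAlgebra.


Section FoliationCalculus.
Variables (R : realType) (n q : nat).
Variables (G V : 'rV[R]_n -> 'M[R]_n) (O : set 'rV[R]_n) (b : 'rV[R]_n -> 'M[R]_(q, n)).
Hypothesis oO : open O.
Hypothesis G_smooth : smooth_on O G.
Hypothesis G_sym : forall x, O x -> (G x)^T = G x.
Hypothesis G_pos : forall x, O x -> forall v, v != 0 -> 0 < ip (G x) v v.
Hypothesis V_rank : forall x, O x -> \rank (V x) = q.
Hypothesis b_smooth : smooth_on O b.
Hypothesis bV : forall x, O x -> (b x == V x)%MS.
Hypothesis bundle_like : forall U Y Z, section_on V O U -> smooth_on O Y -> smooth_on O Z ->
  forall x, O x -> lie_derivative2 U (hor_metric G V) Y Z x = 0.

Definition Pm (y : 'rV[R]_n) := projH (G y) (V y).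
Definition Hm (y : 'rV[R]_n) := Pm y *m G y.

Lemma C1_G : Ck_on 1 O G. Proof. exact: (G_smooth 1). Qed.

Lemma C1_Pm : Ck_on 1 O Pm.
Proof.
have Cb : Ck_on 1 O b by exact: (b_smooth 1).
have CbT := C1_trmx oO Cb.
have CM : Ck_on 1 O (fun y => b y *m G y *m (b y)^T).
  exact: (C1_mulmx oO (C1_mulmx oO Cb C1_G) CbT).
have CI : Ck_on 1 O (fun y => invmx (b y *m G y *m (b y)^T)).
  have uM y : O y -> b y *m G y *m (b y)^T \in unitmx.
    by move=> Oy; exact (gram_unit (G_pos Oy) (bV Oy) (V_rank Oy)).
  exact: (C1_invmx oO uM CM).
have CQ : Ck_on 1 O (fun y => G y *m (b y)^T *m invmx (b y *m G y *m (b y)^T) *m b y).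
  exact: (C1_mulmx oO (C1_mulmx oO (C1_mulmx oO C1_G CbT) CI) Cb).
have E y : O y -> 1%:M - G y *m (b y)^T *m invmx (b y *m G y *m (b y)^T) *m b y = Pm y.
  move=> Oy; rewrite -(projV_formula (G_pos Oy) (bV Oy) (V_rank Oy)).
  by rewrite (projVE (V y) (G_pos Oy)) opprB addrC subrK.
apply: (Ck_on_ext oO E); apply/(C1_mxP oO) => i j.
have /(C1_mxP oO)/(_ i j) CQij := CQ.
set Q := (fun y => _) in CQ CQij *.
apply: (Ck_on_ext (f := fun y => (1%:M : 'M[R]_n) i j + -1 * (G y *m (b y)^T *m invmx (b y *m G y *m (b y)^T) *m b y) i j) oO).
  by move=> y _; rewrite mulN1r [RHS]mxE [X in _ = _ + X]mxE.
exact: (C1D oO (C1_cst _ _) (C1M oO (C1_cst _ _) CQij)).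
Qed.

Lemma C1_Hm : Ck_on 1 O Hm. Proof. exact: (C1_mulmx oO C1_Pm C1_G). Qed.

Variables (x : 'rV[R]_n).
Hypothesis Ox : O x.
Local Notation P := (Pm x).
Local Notation Q := (projV (G x) (V x)).
Local Notation dG v := ('D_v G x).
Local Notation dP v := ('D_v Pm x).
Local Notation dH v := ('D_v Hm x).

Lemma dif_G : differentiable G x. Proof. exact: (proj1 C1_G). Qed.
Lemma dif_P : differentiable Pm x. Proof. exact: (proj1 C1_Pm). Qed.
Lemma dif_H : differentiable Hm x. Proof. exact: (proj1 C1_Hm). Qed.

Lemma dP_idem (v : 'rV[R]_n) : dP v *m P + P *m dP v = dP v.
Proof.
rewrite -(derive_mulmx v dif_P dif_P).
apply: near_eq_derive; apply: near_open oO Ox _ => y Oy; exact (projH_projH (V y) (G_pos Oy)).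
Qed.

Lemma dH_E (v : 'rV[R]_n) : dH v = dP v *m G x + P *m dG v.
Proof. exact: (derive_mulmx v dif_P dif_G). Qed.

Lemma dH_E' (v : 'rV[R]_n) : dH v = dG v *m P^T + G x *m (dP v)^T.
Proof.
rewrite -(derive_trmx v dif_P) -(derive_mulmx v dif_G (differentiable_trmx dif_P)).
apply: near_eq_derive; apply: near_open oO Ox _ => y Oy.
exact (projH_sym (V y) (G_sym Oy) (G_pos Oy)).
Qed.

Lemma dG_sym (v : 'rV[R]_n) : (dG v)^T = dG v.
Proof.
rewrite -(derive_trmx v dif_G).
by apply: near_eq_derive; apply: near_open oO Ox _ => y Oy; exact: G_sym.
Qed.

Lemma Hm_sym y : O y -> (Hm y)^T = Hm y.
Proof.
move=> Oy; rewrite /Hm (trmx_mul (Pm y)) (G_sym Oy); apply/esym.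
exact (projH_sym (V y) (G_sym Oy) (G_pos Oy)).
Qed.

Lemma d_lin (W : normedModType R) (M : 'rV[R]_n -> W) (a : R) (u v : 'rV[R]_n) : differentiable M x ->
  'D_(a *: u + v) M x = a *: 'D_u M x + 'D_v M x.
Proof. by move=> dM; rewrite -{1}[v]scale1r derive_lin// scale1r. Qed.

Lemma G_unit : G x \in unitmx.
Proof.
have := @gram_unit R n (G x) 1%:M (G_pos Ox) n 1%:M.
by rewrite mul1mx trmx1 mulmx1; apply; [rewrite submx_refl|rewrite mxrank1].
Qed.

Lemma decomp (u : 'rV[R]_n) : u = u *m P + u *m Q.
Proof. by rewrite -mulmxDr (projHV (V x) (G_pos Ox)) mulmx1. Qed.

Lemma ver_section (U : 'rV[R]_n) : U *m P = 0 -> exists c : 'rV[R]_q, U = c *m b x.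
Proof.
move=> UP; have : (U <= b x)%MS.
  rewrite (eqmxP (bV Ox)) [U]decomp UP add0r; apply: submx_trans (submxMl _ _) _.
  exact: projV_sub.
by move=> /submxP.
Qed.

(** The condition L_U g_H = 0 for a vertical field U extending the given
    vector, tested on constant fields. The derivatives of U in the brackets
    are traded for derivatives of H by differentiating U H = 0. *)
Lemma bundle_like_dH (U Y Z : 'rV[R]_n) : U *m P = 0 ->
  ip (dH U) Y Z = ip (dH Y) U Z + ip (dH Z) U Y.
Proof.
move=> /ver_section[c Uc]; pose Uf y := c *m b y.
have sU : smooth_on O Uf by exact: smooth_mull.
have dU : differentiable Uf x by exact: (proj1 (sU 1%N)).
have UfV y : O y -> (Uf y <= V y)%MS.
  by move=> Oy; rewrite -(eqmxP (bV Oy)); exact: submxMl.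
have hmE y (Y' Z' : 'rV[R]_n) : O y -> hor_metric G V y Y' Z' = ip (Hm y) Y' Z'.
  by move=> Oy; exact (hor_metricE (V y) (G_sym Oy) (G_pos Oy) _ _).
have Ufx : Uf x = U by [].
have bracket (Y' : 'rV[R]_n) : lie_bracket Uf (fun=> Y') x = - 'D_Y' Uf x.
  by rewrite /lie_bracket derive_cst sub0r.
have key (Y' Z' : 'rV[R]_n) : ip (Hm x) (lie_bracket Uf (fun=> Y') x) Z' = ip (dH Y') U Z'.
  have dUH : differentiable (fun y => Uf y *m Hm y) x by exact: differentiable_mulmx dU dif_H.
  have : 'D_Y' (fun y => Uf y *m Hm y) x = 0.
    rewrite -(derive_cst (0 : 'rV[R]_n) x Y'); apply: near_eq_derive.
    apply: near_open oO Ox _ => y Oy /=.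
    by rewrite /Hm mulmxA (projH_leaf (G_pos Oy) (UfV y Oy)) mul0mx.
  rewrite (derive_mulmx Y' dU dif_H) Ufx => E.
  have /eqP := ip_mulD Z' E; rewrite addr_eq0 => /eqP ->.
  by rewrite bracket -scaleN1r ipZl mulN1r.
have B := bundle_like (conj sU UfV) (smooth_cst O Y) (smooth_cst O Z) Ox.
rewrite /lie_derivative2 Ufx in B.
have E0 : 'D_U (fun y => hor_metric G V y Y Z) x = ip (dH U) Y Z.
  rewrite -(derive_ipm U Y Z dif_H); apply: near_eq_derive.
  by apply: near_open oO Ox _ => y Oy; exact: hmE.
have E1 : hor_metric G V x (lie_bracket Uf (fun=> Y) x) Z = ip (dH Y) U Z.
  exact (etrans (hmE x _ Z Ox) (key Y Z)).
have E2 : hor_metric G V x Y (lie_bracket Uf (fun=> Z) x) = ip (dH Z) U Y.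
  pose br : 'rV[R]_n := lie_bracket Uf (fun=> Z) x.
  exact (etrans (hmE x Y br Ox) (etrans (ip_sym Y br (Hm_sym Ox)) (key Z Y))).
exact (sub2_eq0 E0 E1 E2 B).
Qed.

Lemma christoffelE (u v : 'rV[R]_n) :
  christoffel G x u v = chris (G x) (fun w => dG w) u v.
Proof.
congr (_ *m _); apply/rowP => k; rewrite [LHS]mxE [RHS]mxE; congr (_ * _).
exact (congr2 (fun s t => s - t)
  (congr2 +%R (derive_ipm u v (ebase R k) dif_G) (derive_ipm v u (ebase R k) dif_G))
  (derive_ipm (ebase R k) u v dif_G)).
Qed.

Lemma tensorTE (u c : 'rV[R]_n) :
  tensorT G V x u c = Tten (G x) P (fun w => dG w) (fun w => dP w) u c.
Proof.
rewrite /tensorT /Tten -(projVE (V x) (G_pos Ox)) /levi_civita christoffelE.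
congr ((_ + _) *m _).
have := derive_mulmx (u *m P) (differentiable_cst c x) dif_P.
have -> : 'D_(u *m P) (cst c) x = 0 by exact: derive_cst.
by rewrite mul0mx add0r.
Qed.

Lemma tensorTstarE (u v : 'rV[R]_n) :
  tensorTstar G V x u v = Tst (G x) P (fun w => dG w) (fun w => dP w) u v.
Proof. by congr (_ *m _); apply/rowP => k; rewrite [LHS]mxE [RHS]mxE tensorTE. Qed.

(** Here [f a] is the derivative of the map along the a-th frame vector, and
    [F a] the second derivative in that direction; the algebra is done summand
    by summand. The left-hand side of the hypothesis is the tension, expanded
    with the product rule. *)
Lemma euler_lagrange (I : Type) (r : seq I) (f F : I -> 'rV[R]_n) (c : 'rV[R]_n) :
  \sum_(a <- r) (F a *m P + f a *m dP (f a) + christoffel G x (f a) (f a *m P)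
    + (tensorTstar G V x (f a *m P) (f a *m Q) + tensorW G V x (f a *m P) (f a *m Q))) = 0 ->
  \sum_(a <- r) (ip (Hm x) (F a) c + ip (dH (f a)) (f a) c - 2^-1 * ip (dH c) (f a) (f a)) = 0.
Proof.
pose dGf (w : 'rV[R]_n) : 'M[R]_n := dG w; pose dPf (w : 'rV[R]_n) : 'M[R]_n := dP w.
pose wf a := levi_civita G (ver_ext G V (f a *m Q)) (hor_ext G V (f a *m P)) x.
have QE : projV (G x) (V x) = 1%:M - P by exact: projVE (G_pos Ox).
have TE a : F a *m P + f a *m dP (f a) + christoffel G x (f a) (f a *m P)
    + (tensorTstar G V x (f a *m P) (f a *m Q) + tensorW G V x (f a *m P) (f a *m Q))
    = tension_term (G x) P dGf dPf (f a) (F a) (wf a).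
  by rewrite /tension_term christoffelE tensorTstarE /tensorW -/(wf a) QE.
have dhE v : dh (G x) P dGf dPf v = dH v by rewrite dH_E.
have ELE a : ip (Hm x) (F a) c + ip (dH (f a)) (f a) c - 2^-1 * ip (dH c) (f a) (f a)
    = EL (G x) P dGf dPf (f a) (F a) c.
  by rewrite /EL !dhE.
rewrite (eq_bigr _ (fun a _ => TE a)) (eq_bigr _ (fun a _ => ELE a)).
apply: EL_sum_eq0.
- exact: G_unit.
- exact: G_sym.
- exact (projH_sym (V x) (G_sym Ox) (G_pos Ox)).
- exact (projH_projH (V x) (G_pos Ox)).
- by move=> a u v; exact: d_lin dif_G.
- by move=> a u v; exact: d_lin dif_P.
- exact: dG_sym.
- exact: dP_idem.
- by move=> v; rewrite dhE; exact: dH_E'.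
- move=> U Y Z UP; rewrite !dhE; exact: bundle_like_dH.
Qed.

End FoliationCalculus.

(** * The geometry of the Heisenberg frame *)

Section HeisenbergFrame.
Variables (R : realType) (m : nat).
Local Notation HH := 'rV[R]_(m + m + 1).
Local Notation dt := (d_t R m).

(** The 1-form eta, which vanishes on the horizontal frame. *)
Definition contact (p u : HH) : R := \sum_a Jz a p * u 0 (lshift 1 a) + 2^-1 * u 0 (it m).

Lemma contactE p u : (u *m (Defs.eta p)^T) 0 0 = contact p u.
Proof.
rewrite mxE big_split_ord /= big_ord_recl big_ord0 addr0; congr (_ + _).
  by apply: eq_bigr => a _; rewrite mxE eta_hor mulrC.
rewrite mxE (_ : rshift (m + m) ord0 = it m)// eta_it mulrC//.
Qed.

Lemma ip_rank1 (e u v : HH) : ip (e^T *m e) u v = (u *m e^T) 0 0 * (v *m e^T) 0 0.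
Proof.
rewrite /ip mulmxA -mulmxA mxE big_ord_recl big_ord0 addr0; congr (_ * _).
by rewrite -[v in RHS]trmxK -trmx_mul [RHS]mxE.
Qed.

Lemma mul_ebase_tr (u : HH) k : (u *m (ebase R k)^T) 0 0 = u 0 k.
Proof.
rewrite mxE (bigD1 k)//= big1 => [|l lk]; first by rewrite !mxE !eqxx mulr1 addr0.
by rewrite !mxE (negbTE lk) andbF mulr0.
Qed.

Lemma ip_gK p u v : ip (gK p) u v =
  \sum_a u 0 (lshift 1 a) * v 0 (lshift 1 a) + contact p u * contact p v.
Proof.
rewrite /gK ipDm ip_rank1 !contactE; congr (_ + _).
have ip_sum (A : 'I_m -> 'M[R]_(m + m + 1)) : ip (\sum_j A j) u v = \sum_j ip (A j) u v.
  elim/big_rec2 : _ => [|j x M _ <-]; last exact: ipDm.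
  by rewrite /ip mulmx0 mul0mx mxE.
rewrite ip_sum big_split_ord /= -big_split; apply: eq_bigr => j _ /=.
by rewrite ipDm !ip_rank1 !mul_ebase_tr.
Qed.

Lemma gK_pos p (v : HH) : v != 0 -> 0 < ip (gK p) v v.
Proof.
move=> v0; have S0 : 0 <= \sum_a v 0 (lshift 1 a) * v 0 (lshift 1 a).
  by apply: sumr_ge0 => a _; rewrite -expr2 sqr_ge0.
have C0 : 0 <= contact p v * contact p v by rewrite -expr2 sqr_ge0.
rewrite ip_gK lt0r addr_ge0// andbT; apply: contra v0.
rewrite paddr_eq0// => /andP[/eqP Sv]; rewrite mulf_eq0 orbb => /eqP Cv.
have vz a : v 0 (lshift 1 a) = 0.
  have /eqP : v 0 (lshift 1 a) * v 0 (lshift 1 a) = 0.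
    by apply: (psumr_eq0P _ Sv) => // b _; rewrite -expr2 sqr_ge0.
  by rewrite mulf_eq0 orbb => /eqP.
have vt : v 0 (it m) = 0.
  move: Cv; rewrite /contact big1 ?add0r => [|a _]; last by rewrite vz mulr0.
  by move=> /eqP; rewrite mulf_eq0 invr_eq0 pnatr_eq0 /= => /eqP.
apply/eqP/rowP => i; rewrite [RHS]mxE; case: (split_ordP i) => k ->; first exact: vz.
by rewrite ord1 -vt; congr (v 0 _); apply: val_inj.
Qed.

Lemma Xfield_hvec j : Xfield (R := R) j = hvec (lshift m j).
Proof. by apply/funext => p; rewrite /Xfield /hvec Jz_lshift mulrN scaleNr opprK. Qed.

Lemma Yfield_hvec j : Yfield (R := R) j = hvec (rshift m j).
Proof. by apply/funext => p; rewrite /Yfield /hvec Jz_rshift. Qed.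

Lemma sum_hframe (W : nmodType) (F : (HH -> HH) -> W) :
  \sum_(e <- hframe R m) F e = \sum_a F (hvec a).
Proof.
rewrite /hframe big_cat (big_map (@Xfield R m) xpredT) (big_map (@Yfield R m) xpredT).
rewrite !big_enum big_split_ord /=.
by congr (_ + _); apply: eq_bigr => j _; rewrite ?Xfield_hvec ?Yfield_hvec.
Qed.

Lemma sum_frame (W : nmodType) (F : (HH -> HH) -> W) :
  \sum_(e <- frame R m) F e = \sum_a F (hvec a) + F (@Tfield R m).
Proof. by rewrite /frame -cats1 big_cat /= big_seq1 sum_hframe. Qed.

Lemma Tfield_z p a : @Tfield R m p 0 (lshift 1 a) = 0.
Proof. by rewrite !mxE eq_lrshift andbF mulr0. Qed.

Lemma contact_hvec a p : contact p (hvec a p) = 0.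
Proof.
rewrite /contact (bigD1 a)//= big1 => [|b ba]; last first.
  by rewrite hvec_z eq_sym (negbTE ba) mulr0.
rewrite hvec_z eqxx mulr1 addr0 !mxE eq_rlshift andbF !eqxx sub0r mulr1.
by rewrite mulrN mulKf ?subrr.
Qed.

Lemma hvec_orth a (p : HH) : hvec a p *m gK p *m (VK p)^T = 0.
Proof.
have /submxP[C ->] : (VK p <= @Tfield R m p)%MS by rewrite genmxE.
rewrite trmx_mul mulmxA (_ : hvec a p *m gK p *m (Tfield p)^T = 0) ?mul0mx//.
apply/matrixP => i j; rewrite !ord1 [RHS]mxE.
have := ip_gK p (hvec a p) (Tfield p); rewrite contact_hvec mul0r addr0 /ip => ->.
by rewrite big1// => b _; rewrite Tfield_z mulr0.
Qed.

Lemma hvec_piH a (p : HH) : hvec a p *m piH p = hvec a p.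
Proof. exact: (projH_id (gK_pos p) (hvec_orth a p)). Qed.

Lemma Tfield_piH (p : HH) : Tfield p *m piH p = 0 :> HH.
Proof. by apply: (projH_leaf (gK_pos p)); rewrite genmxE. Qed.

Lemma piV_piH (p : HH) : piV p = 1%:M - piH p :> 'M[R]_(m + m + 1).
Proof. exact: projVE (gK_pos p). Qed.

Lemma hvec_piV a (p : HH) : hvec a p *m piV p = 0.
Proof. by rewrite piV_piH mulmxBr mulmx1 hvec_piH subrr. Qed.

Lemma Tfield_piV (p : HH) : Tfield p *m piV p = Tfield p :> HH.
Proof. by rewrite piV_piH mulmxBr mulmx1 Tfield_piH subr0. Qed.

Lemma derive_affine (V W : normedModType R) (f : V -> W) (p v : V) (d : W) :
  (forall h : R, f (h *: v + p) = f p + h *: d) -> is_derive p v f d.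
Proof.
move=> H; suff L : (fun h : R => h^-1 *: (f (h *: v + p) - f p)) h @[h --> 0^'] --> d.
  by split; [apply/cvg_ex; exists d|exact: cvg_lim L].
apply/cvgrPdist_le => e e0; near=> h.
have h0 : h != 0 by near: h; exact: nbhs_dnbhs_neq.
by rewrite H addrAC subrr add0r scalerA mulVf// scale1r subrr normr0 ltW.
Unshelve. all: by end_near. Qed.

Lemma Jz_lin a (h : R) (v p : HH) : Jz a (h *: v + p) = Jz a p + h * Jz a v.
Proof.
by case: (split_ordP a) => j ->; rewrite ?Jz_lshift ?Jz_rshift !mxE; ring.
Qed.

Lemma Jz_hvec a (p : HH) : Jz a (hvec a p) = 0.
Proof.
case: (split_ordP a) => j ->; rewrite ?Jz_lshift ?Jz_rshift !mxE ?eq_shift !andbF /= ?mulr0 ?subr0 ?oppr0//.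
Qed.

(** Half of d eta, obtained by differentiating the coefficients of eta. *)
Definition omega (c u : HH) : R := \sum_a Jz a c * u 0 (lshift 1 a).

Lemma omega_antisym c u : omega c u = - omega u c.
Proof.
rewrite /omega !big_split_ord /= opprD addrC -!sumrN; congr (_ + _);
  by apply: eq_bigr => j _; rewrite !Jz_lshift !Jz_rshift; ring.
Qed.

Lemma omega_self u : omega u u = 0.
Proof. by have := omega_antisym u u => H; lra. Qed.

Lemma contact_derive (c u p : HH) : is_derive p c (fun y => contact y u) (omega c u).
Proof.
apply: derive_affine => h; rewrite /contact /omega addrAC /GRing.scale /= mulr_sumr -big_split /=; congr (_ + _).
by apply: eq_bigr => a _; rewrite Jz_lin mulrDl mulrA.
Qed.

Lemma derive_gK (c u v p : HH) : 'D_c (fun y => ip (gK y) u v) p =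
  omega c u * contact p v + contact p u * omega c v.
Proof.
have -> : (fun y => ip (gK y) u v) = cst (\sum_a u 0 (lshift 1 a) * v 0 (lshift 1 a))
    + (fun y : HH => contact y u) * (fun y : HH => contact y v).
  by apply/funext => y; rewrite ip_gK.
have [d1 E1] := contact_derive c u p; have [d2 E2] := contact_derive c v p.
rewrite deriveD; [|exact: derivable_cst|exact: derivableM].
rewrite derive_cst add0r deriveM// E1 E2 /GRing.scale/= addrC; congr (_ + _).
by rewrite mulrC.
Qed.

(** By [derive_gK] and omega(u, u) = 0, the covector in the Koszul formula for
    nabla_u u is 2 contact(u) omega(u, .). *)
Lemma christoffel_gK (p u : HH) :
  contact p u = 0 \/ (forall a, u 0 (lshift 1 a) = 0) -> (forall a, Jz a u = 0) \/ contact p u = 0 ->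
  christoffel (@gK R m) p u u = 0.
Proof.
move=> H1 H2; rewrite /christoffel (_ : (\row_k _) = 0) ?mul0mx//.
apply/rowP => k; rewrite !mxE !derive_gK omega_self mul0r add0r.
rewrite (omega_antisym (ebase R k) u).
have [->|Z] : contact p u = 0 \/ omega u (ebase R k) = 0.
  by case: H2 => H; [right; rewrite /omega big1// => a _; rewrite H mul0r|left].
- by rewrite !(mul0r, mulr0) !addr0 subr0 mulr0.
- by rewrite Z !(mulr0, oppr0, mul0r) !addr0 subr0 mulr0.
Qed.

(** The integral curves of e_a are straight lines in these coordinates, and
    eta(e_a) = 0 annihilates the Christoffel term. Hence tracing over the
    frame involves second derivatives of the map only. *)
Lemma levi_civita_hvec a (p : HH) : levi_civita (@gK R m) (hvec a) (hvec a) p = 0.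
Proof.
rewrite /levi_civita christoffel_gK ?addr0; last 2 first.
- by left; exact: contact_hvec.
- by right; exact: contact_hvec.
have [_ ->//] : is_derive p (hvec a p) (hvec a) (0 : HH).
apply: derive_affine => h; rewrite scaler0 addr0 {1 3}/hvec.
by rewrite Jz_lin Jz_hvec mulr0 addr0.
Qed.

Lemma levi_civita_T (p : HH) : levi_civita (@gK R m) (@Tfield R m) (@Tfield R m) p = 0.
Proof.
rewrite /levi_civita christoffel_gK ?addr0; last 2 first.
- by right => a; exact: Tfield_z.
- by left => a; case: (split_ordP a) => j ->;
    rewrite ?Jz_lshift ?Jz_rshift Tfield_z ?oppr0.
exact: derive_cst.
Qed.

End HeisenbergFrame.

(** * The conservation law in a chart *)

Section LocalExpression.
Variables (R : realType) (m n : nat).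
Local Notation HH := 'rV[R]_(m + m + 1).
Local Notation dt := (d_t R m).
Variables (O : set HH) (phi : HH -> 'rV[R]_n).
Variables (O' : set 'rV[R]_n) (H : 'rV[R]_n -> 'M[R]_n).
Hypotheses (oO : open O) (C2phi : Ck_on 2 O phi).
Hypotheses (oO' : open O') (C1H : Ck_on 1 O' H) (Hsym : forall y, O' y -> (H y)^T = H y).
Hypothesis phiO : forall p, O p -> O' (phi p).

Definition fvec a (p : HH) : 'rV[R]_n := 'D_(hvec a p) phi p.
Definition fver (p : HH) : 'rV[R]_n := 'D_(Tfield p) phi p.

Lemma C1_dphi (v : HH) : Ck_on 1 O ('D_v phi). Proof. exact: (proj2 C2phi v). Qed.

Lemma dif_phi p : O p -> differentiable phi p. Proof. exact: (proj1 C2phi p). Qed.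

Lemma C1_phi : Ck_on 1 O phi.
Proof.
split=> [p|v p Op]; first exact: dif_phi.
exact: C1_continuous (C1_dphi v) Op.
Qed.

Lemma hvec_lin a (p : HH) : hvec a p = 1 *: ebase R (lshift 1 a) + (- (2 * Jz a p)) *: dt.
Proof. by rewrite scale1r scaleNr. Qed.

Lemma derive_hvec_vec (W : normedModType R) (h : HH -> W) a (p : HH) : differentiable h p ->
  'D_(hvec a p) h p = 'D_(ebase R (lshift 1 a)) h p - (2 * Jz a p) *: 'D_dt h p.
Proof.
by move=> dh; rewrite hvec_lin (derive_lin _ _ _ _ dh) scale1r scaleNr.
Qed.

Lemma fvecE a p : O p ->
  'D_(ebase R (lshift 1 a)) phi p - (2 * Jz a p) *: 'D_dt phi p = fvec a p.
Proof. by move=> Op; rewrite -(derive_hvec_vec a (dif_phi Op)). Qed.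

Lemma fverE p : O p -> fver p = 2 *: 'D_dt phi p.
Proof.
move=> Op; rewrite /fver /Tfield.
by have := derive_lin 2 0 dt 0 (dif_phi Op); rewrite !scale0r !addr0.
Qed.

Lemma derive_Jz a (v p : HH) : is_derive p v (Jz a) (Jz a v).
Proof. by apply: derive_affine => h; rewrite Jz_lin. Qed.

Lemma C1_Jz a : Ck_on 1 O (@Jz R m a).
Proof.
have C1c k : Ck_on 1 O (fun p : HH => p 0 k).
  by apply: Ck_onS (C1_rV R k) => x.
case: (split_ordP a) => j ->.
  have E (p : HH) : O p -> -1 * p 0 (iy j) = Jz (lshift m j) p.
    by move=> _; rewrite Jz_lshift mulN1r.
  exact: (Ck_on_ext oO E (C1M oO (C1_cst _ _) (C1c _))).
have E (p : HH) : O p -> p 0 (ix j) = Jz (rshift m j) p by move=> _; rewrite Jz_rshift.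
exact: (Ck_on_ext oO E (C1c _)).
Qed.

Lemma C1_Jdt a : Ck_on 1 O (fun p => (2 * Jz a p) *: 'D_dt phi p).
Proof.
apply/(C1_mxP oO) => i j; have /(C1_mxP oO)/(_ i j) C := C1_dphi dt.
have E p : O p -> 2 * Jz a p * 'D_dt phi p i j = ((2 * Jz a p) *: 'D_dt phi p) i j.
  by move=> _; rewrite [RHS]mxE.
exact: (Ck_on_ext oO E (C1M oO (C1M oO (C1_cst _ _) (C1_Jz a)) C)).
Qed.

Lemma C1_fvec a : Ck_on 1 O (fvec a).
Proof.
apply: (Ck_on_ext oO (fvecE a)); apply/(C1_mxP oO) => i j.
have /(C1_mxP oO)/(_ i j) C := C1_dphi (ebase R (lshift 1 a)).
have /(C1_mxP oO)/(_ i j) C' := C1_Jdt a.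
have E p : O p -> 'D_(ebase R (lshift 1 a)) phi p i j + -1 * ((2 * Jz a p) *: 'D_dt phi p) i j
    = ('D_(ebase R (lshift 1 a)) phi p - (2 * Jz a p) *: 'D_dt phi p) i j.
  by move=> _; rewrite [RHS]mxE [X in _ = _ + X]mxE mulN1r.
exact: (Ck_on_ext oO E (C1D oO C (C1M oO (C1_cst _ _) C'))).
Qed.

Lemma C1_fver : Ck_on 1 O fver.
Proof.
have E p : O p -> 2 *: 'D_dt phi p = fver p by move=> Op; rewrite fverE.
apply: (Ck_on_ext oO E); apply/(C1_mxP oO) => i j.
have /(C1_mxP oO)/(_ i j) C := C1_dphi dt.
have E' p : O p -> 2 * 'D_dt phi p i j = (2 *: 'D_dt phi p) i j by move=> _; rewrite [RHS]mxE.
exact: (Ck_on_ext oO E' (C1M oO (C1_cst _ _) C)).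
Qed.

Lemma C1_pullback (u v : HH -> 'rV[R]_n) : Ck_on 1 O u -> Ck_on 1 O v ->
  Ck_on 1 O (fun p => ip (H (phi p)) (u p) (v p)).
Proof.
move=> Cu Cv; have CHp : Ck_on 1 O (fun p => H (phi p)).
  apply/(C1_mxP oO) => i j; have /(C1_mxP oO')/(_ i j) CHij := C1H.
  exact: (C1_comp oO phiO C1_phi CHij).
have CvT := C1_trmx oO Cv.
by have /(C1_mxP oO)/(_ 0 0) := C1_mulmx oO (C1_mulmx oO Cu CHp) CvT.
Qed.


(** The second derivatives of [phi] along the frame; their failure to commute
    is [commutator]. *)
Definition ffvec a b (p : HH) : 'rV[R]_n := 'D_(hvec a p) (fvec b) p.

Lemma ffvecE a b p : O p -> ffvec a b p =
  'D_(hvec a p) ('D_(ebase R (lshift 1 b)) phi) p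
  - (2 * Jz b (hvec a p)) *: 'D_dt phi p - (2 * Jz b p) *: 'D_(hvec a p) ('D_dt phi) p.
Proof.
move=> Op; have dE := proj1 (C1_dphi (ebase R (lshift 1 b))) p Op.
have dJ := proj1 (C1_Jdt b) p Op.
have dD := proj1 (C1_dphi dt) p Op.
have -> : ffvec a b p = 'D_(hvec a p)
    (fun y => 'D_(ebase R (lshift 1 b)) phi y - (2 * Jz b y) *: 'D_dt phi y) p.
  by apply: near_eq_derive; apply: near_open oO Op _ => y Oy; rewrite fvecE.
have -> : (fun y => 'D_(ebase R (lshift 1 b)) phi y - (2 * Jz b y) *: 'D_dt phi y) =
    'D_(ebase R (lshift 1 b)) phi - (fun y => (2 * Jz b y) *: 'D_dt phi y) by [].
rewrite deriveB; [|exact: diff_derivable|exact: diff_derivable].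
rewrite -addrA; congr (_ + _); rewrite -opprD; congr (- _).
have [dJb EJb] := derive_Jz b (hvec a p) p.
apply/rowP => k.
have Ek : 'D_(hvec a p) (fun y => (2 * Jz b y) *: 'D_dt phi y) p 0 k =
    'D_(hvec a p) (fun y => (2 * Jz b y) * ('D_dt phi y 0 k)) p.
  rewrite -[LHS](derive_entry (hvec a p) 0 k dJ); congr ('D_(hvec a p) _ p).
  by apply/funext => y; rewrite mxE.
rewrite Ek.
have dDk : differentiable (fun y => 'D_dt phi y 0 k) p by move/differentiable_mxP : dD.
have dJz : differentiable (@Jz R m b) p by exact: (proj1 (C1_Jz b)).
have d2 : differentiable (fun y : HH => 2 : R) p by exact: differentiable_cst.
rewrite (derive_mulf _ (differentiableM d2 dJz) dDk) (derive_mulf _ d2 dJz) derive_cst EJb.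
rewrite [RHS]mxE [X in _ = X + _]mxE [X in _ = _ + X]mxE (derive_entry _ _ _ dD).
by rewrite mulr0 addr0 addrC (mulrC ('D_dt phi p 0 k)).
Qed.

Lemma commutator_alg (ba ab tb bt ta at' tt t : 'rV[R]_n) (ja jb jab jba : R) :
  ba = ab -> tb = bt -> ta = at' ->
  (ab - (2 * ja) *: tb - (2 * jba) *: t - (2 * jb) *: (at' - (2 * ja) *: tt))
  - (ba - (2 * jb) *: ta - (2 * jab) *: t - (2 * ja) *: (bt - (2 * jb) *: tt))
  = (- 2 * (jba - jab)) *: t.
Proof.
by move=> -> -> ->; apply/rowP => k; rewrite !mxE; ring.
Qed.

(** The second order terms cancel by [schwarz]; only the derivatives of the
    coefficients of the frame are left, and these multiply d/dt. *)
Lemma commutator a b p : O p -> ffvec a b p - ffvec b a p =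
  (- 2 * (Jz b (hvec a p) - Jz a (hvec b p))) *: 'D_dt phi p.
Proof.
move=> Op; have d v := proj1 (C1_dphi v) p Op.
have F c e : ffvec c e p =
    'D_(ebase R (lshift 1 c)) ('D_(ebase R (lshift 1 e)) phi) p
    - (2 * Jz c p) *: 'D_dt ('D_(ebase R (lshift 1 e)) phi) p
    - (2 * Jz e (hvec c p)) *: 'D_dt phi p
    - (2 * Jz e p) *: ('D_(ebase R (lshift 1 c)) ('D_dt phi) p
        - (2 * Jz c p) *: 'D_dt ('D_dt phi) p).
  exact (etrans (ffvecE c e Op) (congr2 (fun X Y => X - (2 * Jz e (hvec c p)) *: 'D_dt phi p
    - (2 * Jz e p) *: Y) (derive_hvec_vec c (d (ebase R (lshift 1 e)))) (derive_hvec_vec c (d dt)))).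
have S1 := schwarz (ebase R (lshift 1 b)) (ebase R (lshift 1 a)) oO Op C2phi.
have S2 := schwarz dt (ebase R (lshift 1 b)) oO Op C2phi.
have S3 := schwarz dt (ebase R (lshift 1 a)) oO Op C2phi.
exact (etrans (congr2 (fun u v => u - v) (F a b) (F b a)) (commutator_alg _ _ _ _ _ _ S1 S2 S3)).
Qed.

Lemma Jz_hvecb a b (p : HH) : Jz b (hvec a p) = Jz b (ebase R (lshift 1 a)).
Proof.
by rewrite /hvec -scaleNr addrC Jz_dt.
Qed.

Lemma sum_zc_Jz a (p : HH) : \sum_b zc b p * Jz a (ebase R (lshift 1 b)) = Jz a p.
Proof.
rewrite big_split_ord /=.
case: (split_ordP a) => j ->.
  rewrite big1 ?add0r => [|k _]; last first.
    by rewrite Jz_lshift !mxE !eq_shift andbF oppr0 mulr0.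
  rewrite (bigD1 j)//= big1 => [|k kj]; last first.
    by rewrite Jz_lshift !mxE !eq_shift eq_sym (negbTE kj) andbF oppr0 mulr0.
  by rewrite !Jz_lshift !mxE !eqxx addr0 mulrN mulr1.
rewrite [X in _ + X]big1 ?addr0 => [|k _]; last first.
  by rewrite Jz_rshift !mxE !eq_shift andbF mulr0.
rewrite (bigD1 j)//= big1 => [|k kj]; last first.
  by rewrite Jz_rshift !mxE !eq_shift eq_sym (negbTE kj) andbF mulr0.
by rewrite !Jz_rshift !mxE !eqxx addr0 mulr1.
Qed.

Lemma sum_zc_Jz_row a (p : HH) : \sum_b zc b p * Jz b (ebase R (lshift 1 a)) = - Jz a p.
Proof.
transitivity (omega (ebase R (lshift 1 a)) p); first by apply: eq_bigr => b _; rewrite mulrC.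
rewrite omega_antisym /omega; congr (- _).
rewrite (bigD1 a)//= big1 ?addr0 => [|b ba]; first by rewrite mxE !eqxx mulr1.
by rewrite mxE eq_lshift (negbTE ba) andbF mulr0.
Qed.

(** Since Jz is linear and antisymmetric, both sums over b return (Jz)_a, with
    signs that add up; and T = 2 d/dt. *)
Lemma radial_commutator a p : O p ->
  \sum_b zc b p *: (ffvec a b p - ffvec b a p) = (2 * Jz a p) *: fver p.
Proof.
move=> Op; rewrite fverE// (eq_bigr (fun b => (zc b p * (- 2 * (Jz b (ebase R (lshift 1 a)) -
   Jz a (ebase R (lshift 1 b))))) *: 'D_dt phi p)) => [|b _]; last first.
  by rewrite commutator// !Jz_hvecb scalerA.
rewrite -scaler_suml scalerA; congr (_ *: _).
rewrite (eq_bigr (fun b => - 2 * (zc b p * Jz b (ebase R (lshift 1 a)) -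
   zc b p * Jz a (ebase R (lshift 1 b))))) => [|b _]; last by ring.
by rewrite -mulr_sumr sumrB sum_zc_Jz sum_zc_Jz_row; ring.
Qed.


Lemma dif_form y : O' y -> differentiable H y. Proof. exact: (proj1 C1H y). Qed.

Lemma pull_alg (X : 'rV[R]_1) (M dM : 'M[R]_n) (u du v dv : 'rV[R]_n) :
  X = (du *m M + u *m dM) *m v^T + u *m M *m dv^T ->
  X 0 0 = ip dM u v + ip M du v + ip M u dv.
Proof.
move=> ->; rewrite /ip mulmxDl [LHS]mxE [X in X + _]mxE.
by rewrite (addrC ((_ *m _ *m _) 0 0)).
Qed.

Lemma derive_pull (u v : HH -> 'rV[R]_n) (c p : HH) : O p -> Ck_on 1 O u -> Ck_on 1 O v ->
  'D_c (fun p => ip (H (phi p)) (u p) (v p)) p =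
  ip ('D_('D_c phi p) H (phi p)) (u p) (v p) + ip (H (phi p)) ('D_c u p) (v p)
  + ip (H (phi p)) (u p) ('D_c v p).
Proof.
move=> Op Cu Cv.
have dH : differentiable H (phi p) by exact/dif_form/phiO.
have dp := dif_phi Op.
have du : differentiable u p by exact: (proj1 Cu).
have dv : differentiable v p by exact: (proj1 Cv).
have dHp : differentiable (fun y => H (phi y)) p by exact: (differentiable_comp dp dH).
have EH : 'D_c (fun y => H (phi y)) p = 'D_('D_c phi p) H (phi p) by exact: derive_comp.
have duH := differentiable_mulmx du dHp.
have dvT := differentiable_trmx dv.
have E1 := derive_entry c 0 0 (differentiable_mulmx duH dvT).
have E2 := derive_mulmx c duH dvT.
have E3 := derive_mulmx c du dHp.
have E4 := derive_trmx c dv.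
rewrite E3 E4 EH in E2.
exact (etrans E1 (pull_alg E2)).
Qed.

Lemma derive_form_sym (c u v y : 'rV[R]_n) : O' y -> ip ('D_c H y) u v = ip ('D_c H y) v u.
Proof.
move=> Oy; have dH := dif_form Oy; apply: ip_sym.
have E : 'D_c (fun y => (H y)^T) y = 'D_c H y.
  by apply: near_eq_derive; apply: near_open oO' Oy _ => z Oz; exact: Hsym.
by rewrite -(derive_trmx c dH) E.
Qed.

Lemma conservation_alg (d2 d1 A B P Q r r' Q' B' : R) :
  d2 = A + P + Q -> d1 = B + r + r' -> B' = A -> r' = r -> Q = Q' ->
  d2 - 2^-1 * d1 = P - r + (Q' + B' - 2^-1 * B).
Proof. by move=> -> -> -> -> <-; field. Qed.

(** Take c = f_b in the Euler-Lagrange identity. It cancels everything except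
    H(F_ab - F_ba, f_a), where F_ab comes from differentiating s_ba along e_a
    and F_ba from differentiating s_aa along e_b; summing against z_b
    evaluates this commutator. *)
Lemma conservation_law p : O p ->
  (forall c, \sum_a (ip (H (phi p)) (ffvec a a p) c + ip ('D_(fvec a p) H (phi p)) (fvec a p) c
     - 2^-1 * ip ('D_c H (phi p)) (fvec a p) (fvec a p)) = 0) ->
  \sum_b zc b p * (\sum_a 'D_(hvec a p) (fun p => ip (H (phi p)) (fvec b p) (fvec a p)) p
     - 2^-1 * \sum_a 'D_(hvec b p) (fun p => ip (H (phi p)) (fvec a p) (fvec a p)) p)
  = 2 * \sum_a Jz a p * ip (H (phi p)) (fver p) (fvec a p).
Proof.
move=> Op EL.
have HS := Hsym (phiO Op).
have D a b c : 'D_(hvec c p) (fun p => ip (H (phi p)) (fvec a p) (fvec b p)) p =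
    ip ('D_(fvec c p) H (phi p)) (fvec a p) (fvec b p) + ip (H (phi p)) (ffvec c a p) (fvec b p)
    + ip (H (phi p)) (fvec a p) (ffvec c b p).
  exact (derive_pull (hvec c p) Op (C1_fvec a) (C1_fvec b)).
pose K b := \sum_a (ip (H (phi p)) (ffvec a b p) (fvec a p) - ip (H (phi p)) (ffvec b a p) (fvec a p)).
have EK b : \sum_a 'D_(hvec a p) (fun p => ip (H (phi p)) (fvec b p) (fvec a p)) p
     - 2^-1 * \sum_a 'D_(hvec b p) (fun p => ip (H (phi p)) (fvec a p) (fvec a p)) p = K b.
  have {}EL := EL (fvec b p); apply: (etrans _ (etrans (congr1 (+%R (K b)) EL) (addr0 _))).
  rewrite mulr_sumr -sumrB -big_split; apply: eq_bigr => a _ /=.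
  have S1 := derive_form_sym (fvec a p) (fvec a p) (fvec b p) (phiO Op).
  have S2 := ip_sym (fvec a p) (ffvec b a p) HS.
  have S3 := ip_sym (fvec b p) (ffvec a a p) HS.
  exact (conservation_alg (D b a a) (D a a b) S1 S2 S3).
rewrite (eq_bigr _ (fun b _ => congr1 (fun t => zc b p * t) (EK b))).
rewrite mulr_sumr (eq_bigr (fun b => \sum_a zc b p * (ip (H (phi p)) (ffvec a b p) (fvec a p)
   - ip (H (phi p)) (ffvec b a p) (fvec a p)))) => [|b _]; last by rewrite mulr_sumr.
rewrite exchange_big /=; apply: eq_bigr => a _.
rewrite mulrA -ipZl -(radial_commutator a Op).
rewrite ip_suml; apply: eq_bigr => b _.
apply: esym; apply: (etrans (ipZl _ _ _ _)); congr (_ * _).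
apply: (etrans (ipDl _ _ _ _)); congr (_ + _).
by rewrite -scaleN1r; apply: (etrans (ipZl _ _ _ _)); rewrite mulN1r.
Qed.

End LocalExpression.

(** * Maps into a foliated manifold *)

Section ProjectionTransport.
Variables (R : realType) (n : nat) (B B' L L' J : 'M[R]_n).
Hypotheses (Bpos : forall v : 'rV[R]_n, v != 0 -> 0 < ip B v v)
  (B'pos : forall v : 'rV[R]_n, v != 0 -> 0 < ip B' v v).
Hypotheses (BJ : B = J *m B' *m J^T) (LJ : (L *m J == L')%MS).

(** The linear map J is an isometry that maps L onto the other leaf, hence it
    intertwines the two orthogonal decompositions. *)
Lemma projH_transport : projH B L *m J = J *m projH B' L'.
Proof.
have /submxP[C L'E] : (L' <= L *m J)%MS by case/andP: LJ.
have hor : projH B L *m J *m B' *m L'^T = 0.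
  rewrite L'E; move: (projH_orth B L); move: (projH B L) => P PO.
  rewrite !trmx_mul; transitivity (P *m (J *m B' *m J^T) *m L^T *m C^T).
    by rewrite !mulmxA.
  by rewrite -BJ PO mul0mx.
have ver : projV B L *m J *m projH B' L' = 0.
  apply: (projH_leaf B'pos); rewrite -(eqmxP LJ); exact: submxMr (projV_sub B L).
rewrite -[J in RHS]mul1mx -(projHV L Bpos) 2!mulmxDl ver addr0.
by rewrite (projH_id B'pos hor).
Qed.

Lemma hor_gram_transport : projH B L *m B = J *m (projH B' L' *m B') *m J^T.
Proof.
rewrite {2}BJ; move: projH_transport; move: (projH B L) (projH B' L') => P P' E.
by rewrite !mulmxA E.
Qed.

End ProjectionTransport.

Lemma ip_transport (R : realType) (n : nat) (J M : 'M[R]_n) (u v : 'rV[R]_n) :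
  ip (J *m M *m J^T) u v = ip M (u *m J) (v *m J).
Proof. by rewrite ip_mulr ip_mull. Qed.

Lemma derive_dir0 (R : realType) (V W : normedModType R) (f : V -> W) x : 'D_0 f x = 0.
Proof.
by have [_] : is_derive x 0 f (0 : W) by apply: derive_affine => h; rewrite !scaler0 add0r addr0.
Qed.

Lemma open_preimage (R : realType) (V W : normedModType R) (U : set V) (O : set W) (f : V -> W) :
  open U -> open O -> (forall x, U x -> {for x, continuous f}) -> open (U `&` f @^-1` O).
Proof.
move=> oU oO cf; rewrite openE => x [Ux Ox]; apply: filterI.
  by apply: open_nbhs_nbhs; split.
by apply: (cf x Ux); apply: open_nbhs_nbhs; split.
Qed.

Lemma christoffel0 (R : realType) (n : nat) (G : 'rV[R]_n -> 'M[R]_n) x (u : 'rV[R]_n) :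
  christoffel G x u 0 = 0.
Proof.
rewrite /christoffel (_ : (\row_k _) = 0) ?mul0mx//; apply/rowP => k; rewrite !mxE.
have -> : (fun y => ip (G y) 0 (ebase R k)) = cst 0 by apply/funext => y; rewrite ip0l.
have -> : (fun y => ip (G y) u 0) = cst 0 by apply/funext => y; rewrite ip0r.
by rewrite derive_dir0 !derive_cst addr0 subr0 mulr0.
Qed.

Section MapGeometry.
Variables (R : realType) (m n q : nat) (N : topologicalType).
Variables (A : smooth_manifold R n N) (g : riemannian_metric A) (F : foliation A q).
Variable (f : Km R m -> N).
Hypotheses (hF : riemannian_foliation g F) (fsmooth : smooth_map A f).
Local Notation HH := 'rV[R]_(m + m + 1).
Local Notation dt := (d_t R m).
Implicit Types (i j : chart A) (p : HH).
Local Notation "'phi' i" := (loc f i) (at level 10, i at level 8).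
Local Notation U i := (Defs.lift f @^-1` dom i).
Local Notation hm i := (Hm (g i) (F i)).

Definition pullback (u v : HH) (i : chart A) (p : HH) : R :=
  ip (hm i (phi i p)) ('D_u (phi i) p) ('D_v (phi i) p).

Lemma open_U i : open (U i).
Proof. by apply: open_comp; [move=> x _; exact: (proj1 fsmooth)|exact: dom_open]. Qed.

Lemma rng_phi i p : U i p -> rng i (phi i p).
Proof. by move=> Up; exists (Defs.lift f p). Qed.

Lemma dif_loc i p : U i p -> differentiable (phi i) p.
Proof. exact: (proj1 (proj2 fsmooth i 1%N) p). Qed.

(** The foliation has a smooth local basis only near each point, so all
    differentiability arguments are local both in the source and in the
    target. *)
Lemma local_data i p : U i p -> exists (O : set HH) (D : set 'rV[R]_n) (b : 'rV[R]_n -> 'M[R]_(q, n)),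
  [/\ open O, O p, O `<=` U i & forall p', O p' -> D (phi i p')] /\
  [/\ open D, D `<=` rng i, smooth_on D b & forall y, D y -> (b y == F i y)%MS].
Proof.
move=> Up; have [D [b [oD Dx sD sb bF]]] := leaf_smooth F (rng_phi Up).
exists (U i `&` phi i @^-1` D), D, b; split; split => //.
- apply: open_preimage oD _; first exact: open_U.
  by move=> x /dif_loc; exact: differentiable_continuous.
- by move=> x [].
Qed.

Lemma hm_sym i y : rng i y -> (hm i y)^T = hm i y.
Proof.
move=> ry; rewrite /Hm (trmx_mul (Pm (g i) (F i) y)) (gram_sym _ ry); apply/esym.
exact (projH_sym (F i y) (gram_sym g ry) (gram_pos g ry)).
Qed.

Lemma hm_ipE i y u v : rng i y ->
  ip (g i y) (u *m projH (g i y) (F i y)) (v *m projH (g i y) (F i y)) = ip (hm i y) u v.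
Proof. move=> ry; exact (hor_metricE (F i y) (gram_sym g ry) (gram_pos g ry) u v). Qed.

Lemma hm_ge0 i y u : rng i y -> 0 <= ip (hm i y) u u.
Proof.
move=> ry; rewrite -(hm_ipE u u ry); set v := u *m _.
have [->|v0] := eqVneq v 0; first by rewrite ip0l.
by apply: ltW; exact: (gram_pos g ry v0).
Qed.

(** Both the differential of the map and the transverse Gram matrix are
    transformed by the Jacobian of the change of charts. *)
Lemma pullback_chart u v i j p : U i p -> U j p -> pullback u v i p = pullback u v j p.
Proof.
move=> Ui Uj; set J := transition_jac i j (Defs.lift f p).
have dh : differentiable (Defs.coord j \o param i) (phi i p).
  apply: (proj1 (@transition_smooth _ _ _ A i j 1%N)).
  by exists (Defs.lift f p).
have DJ (w : HH) : 'D_w (phi j) p = 'D_w (phi i) p *m J.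
  transitivity ('D_w (fun y => (Defs.coord j \o param i) (phi i y)) p).
    apply: near_eq_derive.
    apply: (near_open (@open_U i) Ui) => y Uy.
    by rewrite /loc /= coordK.
  by rewrite (derive_comp w (dif_loc Ui) dh) deriveEjacobian.
have HJ : hm i (phi i p) = J *m hm j (phi j p) *m J^T.
  exact (hor_gram_transport (gram_pos g (rng_phi Ui)) (gram_pos g (rng_phi Uj))
    (gram_compat g Ui Uj) (leaf_compat F Ui Uj)).
by rewrite /pullback HJ ip_transport !DJ.
Qed.

Definition here (p : HH) : chart A := chart_at A (Defs.lift f p).

Lemma U_here p : U (here p) p. Proof. exact: dom_chart_at. Qed.

(** Defined with the chart chosen at each point: this makes the function
    global, while [pullback_chart] allows computing with one fixed chart in a
    neighbourhood. *)
Definition shor a b (p : HH) : R := pullback (hvec a p) (hvec b p) (here p) p.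
Definition smix a (p : HH) : R := pullback (Tfield p) (hvec a p) (here p) p.
Definition sver (p : HH) : R := pullback (Tfield p) (Tfield p) (here p) p.

Lemma shorE i a b p : U i p -> ip (hm i (phi i p)) (fvec (phi i) a p) (fvec (phi i) b p) = shor a b p.
Proof. by move=> Up; exact: (pullback_chart _ _ Up (U_here p)). Qed.

Lemma sverE i p : U i p -> ip (hm i (phi i p)) (fver (phi i) p) (fver (phi i) p) = sver p.
Proof. by move=> Up; exact: (pullback_chart _ _ Up (U_here p)). Qed.

Lemma Ck_on_local (W : normedModType R) (h : HH -> W) :
  (forall p, exists O : set HH, O p /\ Ck_on 1 O h) -> Ck_on 1 setT h.
Proof.
move=> H; split=> [p _|v p _]; have [ O [Op [dh Ch]]] := H p; [exact: dh|exact: Ch].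
Qed.

Lemma C2_loc i (O : set HH) : O `<=` U i -> Ck_on 2 O (phi i).
Proof. by move=> OU; apply: Ck_onS OU (proj2 fsmooth i 2%N). Qed.

Lemma C1_hm i D (b : 'rV[R]_n -> 'M[R]_(q, n)) : open D -> D `<=` rng i -> smooth_on D b ->
  (forall y, D y -> (b y == F i y)%MS) -> Ck_on 1 D (hm i).
Proof.
move=> oD sD sb bF; apply: (C1_Hm oD _ _ _ sb bF).
- by move=> k; exact: Ck_onS sD (gram_smooth g i k).
- by move=> y /sD; exact: gram_pos.
- by move=> y /sD; exact: leaf_rank.
Qed.

Lemma C1_shor a b : Ck_on 1 setT (shor a b).
Proof.
apply: Ck_on_local => p; have [ O [D [B [[oO Op OU OD] [oD sD sB BF]]]]] := local_data (U_here p).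
exists O; split=> //; set i := here p in OU OD sD BF *.
have E y : O y -> ip (hm i (phi i y)) (fvec (phi i) a y) (fvec (phi i) b y) = shor a b y.
  by move=> /OU; exact: shorE.
apply: (Ck_on_ext oO E); have C2 := C2_loc OU.
exact: (C1_pullback oO C2 oD (C1_hm oD sD sB BF) OD (C1_fvec oO C2 a) (C1_fvec oO C2 b)).
Qed.

Lemma sver_continuous : continuous sver.
Proof.
suff C : Ck_on 1 setT sver by move=> p; exact: (C1_continuous C).
apply: Ck_on_local => p; have [ O [D [B [[oO Op OU OD] [oD sD sB BF]]]]] := local_data (U_here p).
exists O; split=> //; set i := here p in OU OD sD BF *.
have E y : O y -> ip (hm i (phi i y)) (fver (phi i) y) (fver (phi i) y) = sver y.
  by move=> /OU; exact: sverE.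
apply: (Ck_on_ext oO E); have C2 := C2_loc OU.
exact: (C1_pullback oO C2 oD (C1_hm oD sD sB BF) OD (C1_fver oO C2) (C1_fver oO C2)).
Qed.

Lemma lift_dt (k : int) p : Defs.lift f (k%:~R *: dt + p) = Defs.lift f p.
Proof. exact (congr1 f (quoK_dt k p)). Qed.

Lemma derive_loc_dt i (k : int) (v p : HH) : 'D_v (phi i) (k%:~R *: dt + p) = 'D_v (phi i) p.
Proof.
pose quotient (x : HH) (h : R) := h^-1 *: ((phi i \o shift x) (h *: v) - phi i x).
have E : quotient (k%:~R *: dt + p) = quotient p.
  by apply/funext => h; rewrite /quotient /= /loc addrCA !lift_dt.
exact (congr1 (fun F : R -> 'rV[R]_n => lim (F @ 0^')) E).
Qed.

Lemma shor_periodic a b (k : int) p : shor a b (k%:~R *: dt + p) = shor a b p.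
Proof.
rewrite /shor /pullback /here !derive_loc_dt /loc.
by rewrite !lift_dt !hvec_dt.
Qed.

(** Positivity of the transverse metric on sum_a c_a u_a + l v, expanded. *)
Lemma form_psd (i : chart A) p (Up : U i p) (I : finType) (u : I -> 'rV[R]_n) (v : 'rV[R]_n)
    (c : I -> R) (l : R) :
  0 <= \sum_a \sum_b c a * c b * ip (hm i (phi i p)) (u a) (u b)
     + 2 * l * (\sum_a c a * ip (hm i (phi i p)) v (u a)) + l ^+ 2 * ip (hm i (phi i p)) v v.
Proof.
have := hm_ge0 (\sum_a c a *: u a + l *: v) (rng_phi Up).
have := hm_sym (rng_phi Up); move: (hm i (phi i p)) => M Ms; congr (0 <= _).
rewrite ipDl !ipDr !ipZl !ipZr (ip_sym (\sum_a _) v Ms).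
have E1 : ip M (\sum_a c a *: u a) (\sum_a c a *: u a) = \sum_a \sum_b c a * c b * ip M (u a) (u b).
  rewrite ip_suml; apply: eq_bigr => a _.
  rewrite ip_sym// ip_suml; apply: eq_bigr => b _.
  by rewrite ipZl ipZr (ip_sym _ _ Ms) mulrA (mulrC (c b)).
have E2 : ip M v (\sum_a c a *: u a) = \sum_a c a * ip M v (u a).
  rewrite ip_sym// ip_suml; apply: eq_bigr => a _.
  by rewrite ipZl (ip_sym _ _ Ms).
by rewrite E1 E2; ring.
Qed.

Lemma shor_psd (c : 'I_(m + m) -> R) (l : R) p :
  0 <= \sum_a \sum_b c a * c b * shor a b p + 2 * l * (\sum_a c a * smix a p) + l ^+ 2 * sver p.
Proof.
exact (form_psd (U_here p) (fun a => 'D_(hvec a p) (phi (here p)) p)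
  ('D_(Tfield p) (phi (here p)) p) c l).
Qed.

Lemma form_psd2 (i : chart A) p (Up : U i p) (u v : 'rV[R]_n) (x y : R) :
  x * y * (ip (hm i (phi i p)) u v + ip (hm i (phi i p)) v u) <=
  x ^+ 2 * ip (hm i (phi i p)) v v + y ^+ 2 * ip (hm i (phi i p)) u u.
Proof.
have := hm_ge0 (y *: u + (- x) *: v) (rng_phi Up).
move: (hm i (phi i p)) => M; rewrite ipDl !ipDr !ipZl !ipZr.
move: (ip M u u) (ip M u v) (ip M v u) (ip M v v) => uu uv vu vv H; lra.
Qed.

Lemma shor_psd2 a b (x y : R) p :
  x * y * (shor a b p + shor b a p) <= x ^+ 2 * shor b b p + y ^+ 2 * shor a a p.
Proof.
exact (form_psd2 (U_here p) ('D_(hvec a p) (phi (here p)) p) ('D_(hvec b p) (phi (here p)) p) x y).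
Qed.

Lemma dfHH_hvec i a p : dfHH g F f i p (hvec a p) = fvec (phi i) a p *m Pm (g i) (F i) (phi i p).
Proof. by rewrite /dfHH hvec_piH. Qed.

Lemma dfHH_T i p : dfHH g F f i p (Tfield p) = 0.
Proof. by rewrite /dfHH Tfield_piH derive_dir0 mul0mx. Qed.

Lemma dfHV_hvec i a p : dfHV g F f i p (hvec a p) =
  fvec (phi i) a p *m projV (g i (phi i p)) (F i (phi i p)).
Proof. by rewrite /dfHV hvec_piH. Qed.

Lemma dfVH_hvec i a p : dfVH g F f i p (hvec a p) = 0.
Proof. by rewrite /dfVH hvec_piV derive_dir0 mul0mx. Qed.

Lemma dfVH_T i p : dfVH g F f i p (Tfield p) =
  fver (phi i) p *m Pm (g i) (F i) (phi i p).
Proof. by rewrite /dfVH Tfield_piV. Qed.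

Lemma energy_density : normsq g f (dfHH g F f) = density shor.
Proof.
apply/funext => p; rewrite /normsq sum_frame dfHH_T ip0l addr0; apply: eq_bigr => a _.
by rewrite dfHH_hvec hm_ipE//; exact/rng_phi/dom_chart_at.
Qed.

Lemma vertical_density : normsq g f (dfVH g F f) = sver.
Proof.
apply/funext => p; rewrite /normsq sum_frame big1 ?add0r => [|a _]; last by rewrite dfVH_hvec ip0l.
by rewrite dfVH_T hm_ipE//; exact/rng_phi/dom_chart_at.
Qed.

(** The z-components of e_a are Kronecker symbols and those of T are 0, which
    fixes the coefficients of the e_a; the coefficient of T follows by
    applying eta, which vanishes on e_a. *)
Lemma hvec_decomposition (v p : HH) :
  v = \sum_a v 0 (lshift 1 a) *: hvec a p + contact p v *: Tfield p.
Proof.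
apply/rowP => k; rewrite mxE summxE; case: (split_ordP k) => l ->.
  rewrite (bigD1 l)//= big1 => [|a al]; last by rewrite mxE hvec_z (negbTE al) mulr0.
  by rewrite mxE hvec_z eqxx mulr1 addr0 [X in _ + X]mxE Tfield_z mulr0 addr0.
rewrite ord1 (_ : rshift (m + m) 0 = it m); last exact: val_inj.
rewrite (eq_bigr (fun a => - 2 * (Jz a p * v 0 (lshift 1 a)))) => [|a _]; last first.
  by rewrite !mxE eq_rlshift andbF !eqxx /=; ring.
by rewrite -mulr_sumr !mxE !eqxx /contact /=; field.
Qed.

Lemma piH_hvec (v p : HH) : v *m piH p = \sum_a v 0 (lshift 1 a) *: hvec a p.
Proof.
rewrite {1}(hvec_decomposition v p) mulmxDl -scalemxAl Tfield_piH scaler0 addr0 mulmx_suml.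
by apply: eq_bigr => a _; rewrite -scalemxAl hvec_piH.
Qed.

(** Each s_aa is the squared length of the horizontal part of f_a, and the e_a
    span the horizontal space. *)
Lemma horizontally_constant_of_density :
  (forall p, density shor p = 0) -> horizontally_constant g F f.
Proof.
move=> D0 i p Up v.
have f0 a : fvec (phi i) a p *m Pm (g i) (F i) (phi i p) = 0.
  apply: (ip_eq0 (gram_pos g (rng_phi Up))); rewrite hm_ipE; last exact: rng_phi.
  rewrite (shorE a a Up); apply: (psumr_eq0P _ (D0 p)) => // b _.
  by rewrite -(shorE b b Up); apply: hm_ge0; exact: rng_phi.
rewrite /dfHH piH_hvec deriveE; last exact: dif_loc.
rewrite linear_sum mulmx_suml big1// => a _; rewrite linearZ /= -scalemxAl.
rewrite -deriveE; last exact: dif_loc.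
exact (etrans (congr1 (fun u => v 0 (lshift 1 a) *: u) (f0 a)) (scaler0 _ _)).
Qed.

Hypothesis harmonic : horizontally_harmonic g F f.

(** The Levi-Civita terms vanish along the frame, and T has no horizontal
    part; what is left is the product rule for f_a P. *)
Lemma tension_frame i p : U i p ->
  \sum_a (ffvec (phi i) a a p *m Pm (g i) (F i) (phi i p)
    + fvec (phi i) a p *m 'D_(fvec (phi i) a p) (Pm (g i) (F i)) (phi i p)
    + christoffel (g i) (phi i p) (fvec (phi i) a p)
        (fvec (phi i) a p *m Pm (g i) (F i) (phi i p))
    + (tensorTstar (g i) (F i) (phi i p) (fvec (phi i) a p *m Pm (g i) (F i) (phi i p))
         (fvec (phi i) a p *m projV (g i (phi i p)) (F i (phi i p)))
       + tensorW (g i) (F i) (phi i p) (fvec (phi i) a p *m Pm (g i) (F i) (phi i p))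
         (fvec (phi i) a p *m projV (g i (phi i p)) (F i (phi i p))))) = 0.
Proof.
move=> Up; have := harmonic Up; rewrite /tensionHH sum_frame sum_hframe.
have betaT : betaHH g F f i (@Tfield R m) (@Tfield R m) p = 0.
  rewrite /betaHH dfHH_T christoffel0 levi_civita_T.
  rewrite (_ : (fun p' => _) = cst 0); last by apply/funext => p'; exact: dfHH_T.
  by rewrite derive_cst /dfHH mul0mx derive_dir0 mul0mx addr0 subr0.
rewrite betaT addr0 -big_split => T0; apply: (etrans _ T0); apply: eq_bigr => a _ /=.
rewrite dfHH_hvec dfHV_hvec; congr (_ + _).
rewrite /betaHH levi_civita_hvec dfHH_hvec {2}/dfHH mul0mx derive_dir0 mul0mx subr0.
congr (_ + _).
have [ O [D [B [[oO Op OU OD] [oD sD sB BF]]]]] := local_data Up.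
have C2 := C2_loc OU.
have dP : differentiable (Pm (g i) (F i)) (phi i p).
  apply: (proj1 (C1_Pm oD _ _ _ sB BF)); last exact: OD.
  - by move=> k; exact: Ck_onS sD (gram_smooth g i k).
  - by move=> y /sD; exact: gram_pos.
  - by move=> y /sD; exact: leaf_rank.
have df := proj1 (C1_fvec oO C2 a) p Op.
have dPp := differentiable_comp (dif_loc Up) dP.
have E : (fun p' => dfHH g F f i p' (hvec a p')) =
    (fun p' => fvec (phi i) a p' *m (Pm (g i) (F i) \o phi i) p').
  by apply/funext => p'; exact: dfHH_hvec.
have E2 := derive_mulmx (hvec a p) df dPp.
have E3 := derive_comp (hvec a p) (dif_loc Up) dP.
apply: esym; apply: (etrans (congr1 (fun h => 'D_(hvec a p) h p) E)).
exact (etrans E2 (congr1 (fun X => _ + fvec (phi i) a p *m X) E3)).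
Qed.

(** The conservation law in one chart around p, with the chart then forgotten. *)
Lemma shor_conservation p :
  \sum_b zc b p * (\sum_a 'D_(hvec a p) (shor b a) p - 2^-1 * \sum_a 'D_(hvec b p) (shor a a) p)
  = 2 * \sum_a Jz a p * smix a p.
Proof.
have Up := U_here p; move: (here p) Up (tension_frame Up) => i Up T0.
have [ O [D [B [[oO Op OU OD] [oD sD sB BF]]]]] := local_data Up.
have C2 := C2_loc OU; have CH := C1_hm oD sD sB BF.
have Hs y : D y -> (hm i y)^T = hm i y by move=> /sD; exact: hm_sym.
have Gs : smooth_on D (g i) by move=> k; exact: Ck_onS sD (gram_smooth g i k).
have Gy y : D y -> (g i y)^T = g i y by move=> /sD; exact: gram_sym.
have Gp y : D y -> forall v, v != 0 -> 0 < ip (g i y) v v by move=> /sD; exact: gram_pos.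
have Vr y : D y -> \rank (F i y) = q by move=> /sD; exact: leaf_rank.
have BL W Y Z : section_on (F i) D W -> smooth_on D Y -> smooth_on D Z ->
    forall y, D y -> lie_derivative2 W (hor_metric (g i) (F i)) Y Z y = 0.
  by move=> sW sY sZ y Dy; exact: (hF oD sD sW sY sZ Dy).
have EL c := euler_lagrange oD Gs Gy Gp Vr sB BF BL (OD p Op) c T0.
have := conservation_law oO C2 oD CH Hs OD Op EL.
have D1 a b v : 'D_v (fun p' => ip (hm i (phi i p')) (fvec (phi i) a p') (fvec (phi i) b p')) p
    = 'D_v (shor a b) p.
  apply: near_eq_derive; apply: near_open oO Op _ => y /OU Uy; exact: shorE.
have D2 a : ip (hm i (phi i p)) (fver (phi i) p) (fvec (phi i) a p) = smix a p.
  exact: (pullback_chart _ _ Up (U_here p)).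
move=> L.
have L1 : \sum_b zc b p * (\sum_a 'D_(hvec a p) (shor b a) p - 2^-1 * \sum_a 'D_(hvec b p) (shor a a) p)
   = \sum_b zc b p * (\sum_a 'D_(hvec a p) (fun p' => ip (hm i (phi i p')) (fvec (phi i) b p') (fvec (phi i) a p')) p
     - 2^-1 * \sum_a 'D_(hvec b p) (fun p' => ip (hm i (phi i p')) (fvec (phi i) a p') (fvec (phi i) a p')) p).
  exact (eq_bigr _ (fun b _ => congr2 (fun s t => zc b p * (s - 2^-1 * t))
    (eq_bigr _ (fun a _ => esym (D1 b a (hvec a p))))
    (eq_bigr _ (fun a _ => esym (D1 a a (hvec b p)))))).
exact (etrans L1 (etrans L (congr1 (fun t => 2 * t)
  (eq_bigr _ (fun a _ => congr1 (fun t => Jz a p * t) (D2 a)))))).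
Qed.

End MapGeometry.

(** * Rigidity of horizontally harmonic maps *)

Theorem theorem5p6 (R : realType) (m n q : nat) (N : topologicalType)
    (A : smooth_manifold R n N) (g : riemannian_metric A) (F : foliation A q)
    (f : Km R m -> N) (delta rho0 : R)
    (hF : riemannian_foliation g F)
    (fsmooth : smooth_map A f)
    (fharm : horizontally_harmonic g F f)
    (rho0_gt0 : 0 < rho0)
    (hdelta : forall rho : R, rho0 <= rho ->
       2 * rho * Num.sqrt (energyVH g F f rho)
         <= delta * Num.sqrt (energyHH g F f rho))
    (hpos : 0 < 2 * m%:R - 2 - 2 * delta)
    (hgrowth : energyHH g F f =o_+oo
       (fun rho : R => rho `^ (2 * m%:R - 2 - 2 * delta))) :
  horizontally_constant g F f.
Proof.
apply: (horizontally_constant_of_density fsmooth).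
have EH : energyHH g F f = fun rho => integralK (@Drho R m rho) (density (shor g F f)).
  by apply/funext => rho; rewrite /energyHH energy_density.
have EV : energyVH g F f = fun rho => integralK (@Drho R m rho) (sver g F f).
  by apply/funext => rho; rewrite /energyVH vertical_density.
rewrite EH in hdelta hgrowth; rewrite EV in hdelta.
exact (density_eq0 (C1_shor g F fsmooth) (@sver_continuous _ _ _ _ _ _ g F _ fsmooth) (shor_periodic g F f)
  (shor_psd g F f) (shor_psd2 g F f) (shor_conservation hF fsmooth fharm)
  rho0_gt0 hdelta hpos hgrowth).
Qed.
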